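(* Let $q$ be a complex number with $0<|q|<1$ and let $b,c,d,e,f$ be complex numbers. (i) If $\max\{|q/b|,\,|q^2/(bcdef)|\}<1$, then $${}_5\psi_5\!\left[\begin{matrix}b,c,d,e,f\\ q/b,q/c,q/d,q/e,q/f\end{matrix};q,\frac{q^2}{bcdef}\right]$$ $$=\frac{\left(q,\frac q{be},\frac q{ce},\frac q{de},\frac{eq}c,\frac{eq}d,f,f,\frac{q^2}{cdf},\frac{q^2}{bcdf};q\right)_\infty}{\left(\frac qb,\frac qc,\frac qc,\frac qd,\frac qd,\frac qe,\frac fe,ef,\frac{eq^2}{cdf},\frac{q^2}{bcdef};q\right)_\infty}\;{}_8W_7\!\left(\frac{eq}{cdf};e,be,\frac q{cd},\frac q{cf},\frac q{df};q,\frac qb\right)$$ $$+\frac{\left(q,\frac q{bf},\frac q{cf},\frac q{df},\frac{fq}c,\frac{fq}d,e,e,\frac{q^2}{cde},\frac{q^2}{bcde};q\right)_\infty}{\left(\frac qb,\frac qc,\frac qc,\frac qd,\frac qd,\frac qf,\frac ef,ef,\frac{fq^2}{cde},\frac{q^2}{bcdef};q\right)_\infty}\;{}_8W_7\!\left(\frac{fq}{cde};f,bf,\frac q{cd},\frac q{ce},\frac q{de};q,\frac qb\right).$$ (ii) If $\max\{|q/b|,\,|q^4/(bcdef)|\}<1$, then $${}_5\psi_5\!\left[\begin{matrix}b,c,d,e,f\\ q^2/b,q^2/c,q^2/d,q^2/e,q^2/f\end{matrix};q,\frac{q^4}{bcdef}\right]$$ $$=\frac{\left(q,\frac{q^2}{be},\frac{q^2}{ce},\frac{q^2}{de},\frac{eq}c,\frac{eq}d,f,\frac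 fq,\frac{q^3}{cdf},\frac{q^4}{bcdf};q\right)_\infty}{\left(\frac{q^2}b,\frac qc,\frac{q^2}c,\frac qd,\frac{q^2}d,\frac{q^2}e,\frac fe,\frac{ef}q,\frac{eq^3}{cdf},\frac{q^4}{bcdef};q\right)_\infty}\;{}_8W_7\!\left(\frac{eq^2}{cdf};e,\frac{be}q,\frac{q^2}{cd},\frac{q^2}{cf},\frac{q^2}{df};q,\frac qb\right)$$ $$+\frac{\left(q,\frac{q^2}{bf},\frac{q^2}{cf},\frac{q^2}{df},\frac{fq}c,\frac{fq}d,e,\frac eq,\frac{q^3}{cde},\frac{q^4}{bcde};q\right)_\infty}{\left(\frac{q^2}b,\frac qc,\frac{q^2}c,\frac qd,\frac{q^2}d,\frac{q^2}f,\frac ef,\frac{ef}q,\frac{fq^3}{cde},\frac{q^4}{bcdef};q\right)_\infty}\;{}_8W_7\!\left(\frac{fq^2}{cde};f,\frac{bf}q,\frac{q^2}{cd},\frac{q^2}{ce},\frac{q^2}{de};q,\frac qb\right).$$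
   Context: Notation. $(x;q)_\infty=\prod_{i=0}^\infty(1-xq^i)$ and, for every integer $n$, $(x;q)_n=(x;q)_\infty/(xq^n;q)_\infty$, i.e. $(x;q)_n=\prod_{i=0}^{n-1}(1-xq^i)$ for $n\ge0$ and $(x;q)_{-n}=\prod_{i=1}^{n}(1-xq^{-i})^{-1}$ for $n\geq 1$. For several parameters, $(x_1,\dots,x_s;q)_m=(x_1;q)_m\cdots(x_s;q)_m$ (a repeated parameter contributes a repeated factor). The very-well-poised series ${}_8W_7(\alpha;\beta_1,\dots,\beta_5;q,z)$ is $$\sum_{k=0}^\infty\frac{(\alpha,q\sqrt\alpha,-q\sqrt\alpha,\beta_1,\dots,\beta_5;q)_k}{(q,\sqrt\alpha,-\sqrt\alpha,\alpha q/\beta_1,\dots,\alpha q/\beta_5;q)_k}z^k,\qquad\text{where }\frac{(q\sqrt\alpha,-q\sqrt\alpha;q)_k}{(\sqrt\alpha,-\sqrt\alpha;q)_k}=\frac{1-\alpha q^{2k}}{1-\alpha}.$$ Bilateral series: ${}_s\psi_s\!\left[\begin{matrix}a_1,\dots,a_s\\ c_1,\dots,c_s\end{matrix};q,z\right]=\sum_{k=-\infty}^{\infty}\frac{(a_1,\dots,a_s;q)_k}{(c_1,\dots,c_s;q)_k}z^k.$ Standing convention: the parameters are such that every expression occurring is well defined (no denominator vanishes, including the denominator factors of the terms of the series). *)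

(* Defs.v *)
(* Stdlib reals with Coquelicot: C is the field of complex numbers. *)
From Stdlib Require Export Reals ZArith List.
From Coquelicot Require Export Coquelicot.
Export ListNotations.

Open Scope C_scope.

Fixpoint Cprod (u : nat -> C) (n : nat) : C :=
  match n with
  | O => 1
  | S m => Cprod u m * u m
  end.

Definition Cprod_list (l : list C) : C := fold_right Cmult 1 l.

Definition Cpowz (z : C) (k : Z) : C :=
  match k with
  | Zneg p => / (z ^ Pos.to_nat p)
  | _ => z ^ Z.to_nat k
  end.

(* Limit of a complex sequence and sum of a complex series; the values are
   meaningful only when the sequence, resp. the series, converges. *)
Definition Clim_seq (u : nat -> C) : C :=
  @iota C_CompleteNormedModule
    (fun l : C_NormedModule => filterlim u eventually (locally l)).

Definition CSeries (a : nat -> C) : C :=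
  @iota C_CompleteNormedModule
    (fun l : C_NormedModule => is_series (V := C_NormedModule) a l).

Definition ex_Cseries (a : nat -> C) : Prop :=
  ex_series (V := C_NormedModule) a.

(* (x;q)_k for an integer k. *)
Definition qpoch (x q : C) (k : Z) : C :=
  match k with
  | Zneg p => Cprod (fun i => / (1 - x / q ^ S i)) (Pos.to_nat p)
  | _ => Cprod (fun i => 1 - x * q ^ i) (Z.to_nat k)
  end.

(* (x;q)_oo; the partial products converge as soon as |q| < 1. *)
Definition qpoch_inf (x q : C) : C :=
  Clim_seq (Cprod (fun i => 1 - x * q ^ i)).

Definition qpochs (xs : list C) (q : C) (k : Z) : C :=
  Cprod_list (map (fun x => qpoch x q k) xs).

Definition qpochs_inf (xs : list C) (q : C) : C :=
  Cprod_list (map (fun x => qpoch_inf x q) xs).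

(* The general term of the bilateral series s_psi_s with upper parameters
   [us] and lower parameters [ls]. For k = -n < 0 it is
   prod_(u, l) prod_(1 <= i <= n) (1 - l q^-i) / (1 - u q^-i) * z^-n,
   also when some 1 - l q^-i vanishes: then (l;q)_-n involves / 0 = 0, and the
   term is 0, as it should be. *)
Definition psi_term (us ls : list C) (q z : C) (k : Z) : C :=
  qpochs us q k / qpochs ls q k * Cpowz z k.

Definition psi_defined (us ls : list C) (q : C) : Prop :=
  (forall l n, In l ls -> 1 - l * q ^ n <> 0) /\
  (forall u n, In u us -> 1 - u / q ^ S n <> 0).

Definition psi_cvg (us ls : list C) (q z : C) : Prop :=
  ex_Cseries (fun n => psi_term us ls q z (Z.of_nat n)) /\
  ex_Cseries (fun n => psi_term us ls q z (- Z.of_nat (S n))).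

Definition psi (us ls : list C) (q z : C) : C :=
  CSeries (fun n => psi_term us ls q z (Z.of_nat n)) +
  CSeries (fun n => psi_term us ls q z (- Z.of_nat (S n))).

(* The general term of 8W7(al; b1, ..., b5; q, z). The four factors involving
   the square root of al are written as (1 - al q^(2k)) / (1 - al), so that no
   branch of the square root has to be chosen. *)
Definition W87_term (al b1 b2 b3 b4 b5 q z : C) (k : nat) : C :=
  (1 - al * q ^ (2 * k)) / (1 - al) *
  (qpochs [al; b1; b2; b3; b4; b5] q (Z.of_nat k) /
   qpochs [q; al * q / b1; al * q / b2; al * q / b3; al * q / b4; al * q / b5]
     q (Z.of_nat k)) *
  z ^ k.

Definition W87_defined (al b1 b2 b3 b4 b5 q : C) : Prop :=
  1 - al <> 0 /\
  forall k : nat,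
    qpochs [q; al * q / b1; al * q / b2; al * q / b3; al * q / b4; al * q / b5]
      q (Z.of_nat k) <> 0.

Definition W87_cvg (al b1 b2 b3 b4 b5 q z : C) : Prop :=
  ex_Cseries (W87_term al b1 b2 b3 b4 b5 q z).

Definition W87 (al b1 b2 b3 b4 b5 q z : C) : C :=
  CSeries (W87_term al b1 b2 b3 b4 b5 q z).

(* Main.v *)
(* For a = 1 and a = q the bilateral series folds, under k -> -k and
   k -> -1-k respectively, into the very-well-poised series
   8W7(a; b, c, d, e, f; a^2 q^2 / (bcdef)), so both parts are instances of one
   three-term relation between 8W7 series with general a. In that relation the
   b-dependent part of the n-th term on the right is a product
   (aq/(bx), aq/(by);q)_oo with x = e q^n (resp. f q^n) and 1/y = Ax,
   A = aq/(cdef); expand it by the 6phi5 sum and interchange the two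
   summations. Each inner pair of series is then Bailey's nonterminating 8phi7
   sum with (a; c, d, e, f) replaced by (a q^2k; c q^k, d q^k, e q^k, f q^k).
   The 6phi5 and 8phi7 sums follow from first-order recurrences in s = 1/b,
   resp. g = 1/c, obtained by telescoping: iterating s -> sq reduces them to
   s = 0, and that value is found by starting from a point where the series
   has a single term. Degenerate parameters are reached by continuity in e
   and f. *)
Require Import Defs.
From Corelib Require Import ssreflect.
From Stdlib Require Import Reals ZArith List Lra Lia FunctionalExtensionality.
From Coquelicot Require Import Coquelicot.
Import ListNotations.
Open Scope C_scope.

(** Each series carries the infinite products of its lower parameters as a factor. Its terms are
    then continuous in the parameters, also at s = 0 and g = 0, and one majorant serves a whole
    sequence of parameters. The single-term points are s = 1, where (b;q)_k vanishes for k > 0, and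
    g = f/(aq), where moreover the whole line of f vanishes.

    A Bailey line alone satisfies only an inhomogeneous recurrence, because its certificate keeps a
    nonzero limit. With the right weight this limit is symmetric in e and f, so it is the difference
    of two lines that can be iterated; this is why two series stand on the right.

    The analytic obstacle is the interchange of summations: some factors of the double series blow
    up as the node e q^n tends to 0, and only their product decays. Both |q/b| < 1 and |Aaq/b| < 1
    are spent there.

    The evaluations divide by products that the final relation does not assume nonzero, hence the
    closing limit argument. It approaches from scale factors above 1, so that the argument Aaq/b can
    only shrink. *)

(** * Limits of complex sequences *)

(** Phrased through the real sequence of moduli, so that real limit lemmas apply directly;
    [Ccvg_filterlim] gives the filter form used by [Clim_seq] and [CSeries]. *)
Definition Ccvg (u : nat -> C) (l : C) : Prop :=
  is_lim_seq (fun n => Cmod (u n - l)) 0%R.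

Lemma Ccvg_filterlim (u : nat -> C) (l : C) :
  Ccvg u l <-> filterlim (U := C_NormedModule) u eventually (locally l).
Proof.
  split; intro h.
  - apply (proj2 (filterlim_locally_ball_norm (K := C_AbsRing) (U := C_NormedModule) u l)). intros eps.
    apply is_lim_seq_spec in h. specialize (h eps).
    apply: filter_imp h => n h.
    unfold ball_norm. change (Cmod (u n - l) < eps)%R.
    rewrite Rminus_0_r Rabs_pos_eq in h; [exact h | apply Cmod_ge_0].
  - apply is_lim_seq_spec. intros eps.
    assert (h' := proj1 (filterlim_locally_ball_norm (K := C_AbsRing) (U := C_NormedModule) u l) h eps).
    apply: filter_imp h' => n h'.
    change (Cmod (u n - l) < eps)%R in h'.
    rewrite Rminus_0_r Rabs_pos_eq; [exact h' | apply Cmod_ge_0].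
Qed.

Lemma Ccvg_unique (u : nat -> C) (l l' : C) : Ccvg u l -> Ccvg u l' -> l = l'.
Proof.
  intros h h'.
  apply (filterlim_locally_unique (V := C_NormedModule) (F := eventually) u); now apply Ccvg_filterlim.
Qed.

Lemma Ccvg_squeeze (u : nat -> C) (l : C) (v : nat -> R) :
  (forall n, Cmod (u n - l) <= v n)%R -> is_lim_seq v 0%R -> Ccvg u l.
Proof.
  intros h hv. apply is_lim_seq_le_le with (fun _ => 0%R) v; [| apply is_lim_seq_const | exact hv].
  intro n. split; [apply Cmod_ge_0 | apply h].
Qed.

Lemma Ccvg_ext (u v : nat -> C) (l : C) : (forall n, u n = v n) -> Ccvg u l -> Ccvg v l.
Proof. intros h. apply is_lim_seq_ext. intro n. now rewrite h. Qed.

Lemma Ccvg_const (l : C) : Ccvg (fun _ => l) l.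
Proof.
  apply is_lim_seq_ext with (fun _ => 0%R); [|apply is_lim_seq_const].
  intro n. replace (l - l) with (RtoC 0) by ring. now rewrite Cmod_0.
Qed.

Lemma Ccvg_bound (u : nat -> C) (l : C) : Ccvg u l -> exists R, forall n, (Cmod (u n) <= R)%R.
Proof.
  intros h.
  assert (b : exists M, forall n, (Rabs (Cmod (u n - l)) <= M)%R).
  { destruct (filterlim_bounded (K := R_AbsRing) (V := R_NormedModule) (fun n => Cmod (u n - l))) as [M hM].
    - exists 0%R. exact h.
    - exists M. exact hM. }
  destruct b as [M hM]. exists (M + Cmod l)%R. intro n.
  replace (u n) with ((u n - l) + l) by ring.
  eapply Rle_trans; [apply Cmod_triangle|]. apply Rplus_le_compat_r.
  eapply Rle_trans; [apply Rle_abs | apply hM].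
Qed.

Lemma Ccvg_plus (u v : nat -> C) (l m : C) :
  Ccvg u l -> Ccvg v m -> Ccvg (fun n => u n + v n) (l + m).
Proof.
  intros hu hv.
  apply Ccvg_squeeze with (fun n => Cmod (u n - l) + Cmod (v n - m))%R.
  - intro n. replace (u n + v n - (l + m)) with ((u n - l) + (v n - m)) by ring. apply Cmod_triangle.
  - replace (Finite 0) with (Finite (0 + 0)) by (f_equal; ring).
    now apply is_lim_seq_plus'.
Qed.

Lemma Ccvg_mult (u v : nat -> C) (l m : C) :
  Ccvg u l -> Ccvg v m -> Ccvg (fun n => u n * v n) (l * m).
Proof.
  intros hu hv. destruct (Ccvg_bound _ _ hv) as [R hR].
  apply Ccvg_squeeze with (fun n => Cmod (u n - l) * R + Cmod l * Cmod (v n - m))%R.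
  - intro n. replace (u n * v n - l * m) with ((u n - l) * v n + l * (v n - m)) by ring.
    eapply Rle_trans; [apply Cmod_triangle|]. rewrite 2!Cmod_mult.
    apply Rplus_le_compat_r, Rmult_le_compat_l; [apply Cmod_ge_0 | apply hR].
  - replace (Finite 0) with (Finite (0 * R + Cmod l * 0)) by (f_equal; ring).
    apply is_lim_seq_plus'.
    + apply is_lim_seq_mult'; [exact hu | apply is_lim_seq_const].
    + apply is_lim_seq_mult'; [apply is_lim_seq_const | exact hv].
Qed.

Lemma Ccvg_minus (u v : nat -> C) (l m : C) :
  Ccvg u l -> Ccvg v m -> Ccvg (fun n => u n - v n) (l - m).
Proof.
  intros hu hv. replace (l - m) with (l + -(1) * m) by ring.
  apply Ccvg_ext with (fun n => u n + -(1) * v n); [intro; ring|].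
  apply Ccvg_plus; [exact hu|]. apply Ccvg_mult; [apply Ccvg_const | exact hv].
Qed.

Lemma Ccvg_inv (u : nat -> C) (l : C) : l <> 0 -> Ccvg u l -> Ccvg (fun n => / u n) (/ l).
Proof.
  intros hl hu. assert (hl' := proj1 (Cmod_gt_0 l) hl).
  apply is_lim_seq_spec. intros eps.
  (* The first bound keeps |u n| above |l|/2; given that, the second makes |u n - l| / (|u n| |l|)
     smaller than [eps]. *)
  assert (he : (0 < Rmin (Cmod l / 2) (eps * (Cmod l * Cmod l) / 2))%R).
  { apply Rmin_glb_lt; [lra|]. assert (0 < eps * (Cmod l * Cmod l))%R; [|lra].
    apply Rmult_lt_0_compat; [apply cond_pos | nra]. }
  apply is_lim_seq_spec in hu. specialize (hu (mkposreal _ he)). simpl in hu.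
  apply: filter_imp hu => n hu.
  rewrite Rminus_0_r Rabs_pos_eq in hu; [|apply Cmod_ge_0].
  rewrite Rminus_0_r Rabs_pos_eq; [|apply Cmod_ge_0].
  assert (h1 := Rlt_le_trans _ _ _ hu (Rmin_l _ _)).
  assert (h2 := Rlt_le_trans _ _ _ hu (Rmin_r _ _)).
  assert (h3 : (Cmod l <= Cmod (u n) + Cmod (u n - l))%R).
  { replace l with (u n + - (u n - l)) at 1 by ring.
    eapply Rle_trans; [apply Cmod_triangle|]. rewrite Cmod_opp. lra. }
  assert (h4 : u n <> 0). { apply Cmod_gt_0. lra. }
  replace (/ u n - / l) with (- (u n - l) * / (u n * l)) by (field; split; assumption).
  rewrite Cmod_mult Cmod_opp Cmod_inv; [|now apply Cmult_neq_0]. rewrite Cmod_mult.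
  assert (h5 : (0 < Cmod (u n) * Cmod l)%R) by nra.
  apply (Rmult_lt_reg_r (Cmod (u n) * Cmod l)); [exact h5|].
  rewrite Rmult_assoc Rinv_l; [|lra]. rewrite Rmult_1_r.
  eapply Rlt_le_trans; [exact h2|]. assert (0 < eps)%R by apply cond_pos.
  assert (h6 : (Cmod l * Cmod l / 2 <= Cmod (u n) * Cmod l)%R) by nra.
  apply Rle_trans with (eps * (Cmod l * Cmod l / 2))%R; [right; field|].
  apply Rmult_le_compat_l; lra.
Qed.

Lemma Ccvg_incr (u : nat -> C) (l : C) : Ccvg u l -> Ccvg (fun n => u (S n)) l.
Proof. intro h. apply (is_lim_seq_incr_1 (fun n => Cmod (u n - l))). exact h. Qed.

Lemma Ccvg_le (u : nat -> C) (l : C) (M : R) :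
  Ccvg u l -> (forall n, Cmod (u n) <= M)%R -> (Cmod l <= M)%R.
Proof.
  intros h hM.
  assert (h' : is_lim_seq (fun n => M + Cmod (u n - l))%R (M + 0)%R).
  { apply is_lim_seq_plus'; [apply is_lim_seq_const | exact h]. }
  rewrite Rplus_0_r in h'.
  apply (is_lim_seq_le (fun _ => Cmod l) (fun n => M + Cmod (u n - l))%R (Cmod l) M);
    [|apply is_lim_seq_const | exact h'].
  intro n. replace l with (u n + - (u n - l)) at 1 by ring.
  eapply Rle_trans; [apply Cmod_triangle|]. rewrite Cmod_opp. apply Rplus_le_compat_r, hM.
Qed.

Lemma Clim_seq_unique (u : nat -> C) (l : C) : Ccvg u l -> Clim_seq u = l.
Proof.
  intro h. unfold Clim_seq. apply (iota_unique (V := C_CompleteNormedModule)).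
  - intros y hy. apply (Ccvg_unique u); [apply Ccvg_filterlim; exact hy | exact h].
  - now apply Ccvg_filterlim.
Qed.

(** * Complex series *)

Notation Cseries_is := (is_series (V := C_NormedModule)).

Lemma CSeries_unique (a : nat -> C) (l : C) : Cseries_is a l -> CSeries a = l.
Proof.
  intro h. unfold CSeries. apply (iota_unique (V := C_CompleteNormedModule)).
  - intros y hy. apply (filterlim_locally_unique (V := C_NormedModule) (F := eventually) (sum_n (G := C_NormedModule) a)); assumption.
  - exact h.
Qed.

Lemma CSeries_correct (a : nat -> C) : ex_Cseries a -> Cseries_is a (CSeries a).
Proof. intros [l h]. now rewrite (CSeries_unique a l h). Qed.

Lemma Cseries_is_cvg (a : nat -> C) (l : C) :
  Cseries_is a l <-> Ccvg (sum_n (G := C_NormedModule) a) l.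
Proof. symmetry. apply Ccvg_filterlim. Qed.

Lemma CSeries_ext (a b : nat -> C) : (forall n, a n = b n) -> CSeries a = CSeries b.
Proof.
  intro h. f_equal. now apply functional_extensionality.
Qed.

Lemma ex_Cseries_scal (c : C) (a : nat -> C) : ex_Cseries a -> ex_Cseries (fun n => c * a n).
Proof. apply (ex_series_scal (V := C_NormedModule) c a). Qed.

Lemma CSeries_scal (c : C) (a : nat -> C) :
  ex_Cseries a -> CSeries (fun n => c * a n) = c * CSeries a.
Proof.
  intro h. apply CSeries_unique.
  apply (is_series_scal (V := C_NormedModule) c a). now apply CSeries_correct.
Qed.

Lemma CSeries_plus (a b : nat -> C) :
  ex_Cseries a -> ex_Cseries b -> CSeries (fun n => a n + b n) = CSeries a + CSeries b.
Proof.
  intros h h'. apply CSeries_unique.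
  apply (is_series_plus (V := C_NormedModule) a b); now apply CSeries_correct.
Qed.

Lemma Csum_n_bound (a : nat -> C) (b : nat -> R) (n : nat) :
  (forall n, Cmod (a n) <= b n)%R ->
  (Cmod (sum_n (G := C_NormedModule) a n) <= sum_n (G := R_NormedModule) b n)%R.
Proof.
  intro h. eapply Rle_trans; [apply (norm_sum_n_m (V := C_NormedModule))|].
  apply sum_n_m_le. intro k. apply h.
Qed.

Lemma ex_Cseries_le (a : nat -> C) (b : nat -> R) :
  (forall n, Cmod (a n) <= b n)%R -> ex_series b -> ex_Cseries a.
Proof. intros h. now apply (ex_series_le (V := C_CompleteNormedModule)). Qed.

Lemma CSeries_bound (a : nat -> C) (b : nat -> R) :
  (forall n, Cmod (a n) <= b n)%R -> ex_series b -> (Cmod (CSeries a) <= Series b)%R.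
Proof.
  intros h hb.
  assert (ha := CSeries_correct a (ex_Cseries_le a b h hb)).
  apply Cseries_is_cvg in ha. apply (Ccvg_le _ _ _ ha). intro n.
  eapply Rle_trans; [apply (Csum_n_bound a b n h)|].
  assert (hs := Series_correct b hb).
  apply (is_lim_seq_incr_compare (sum_n (G := R_NormedModule) b) (Series b) hs).
  intro k. rewrite sum_Sn. change plus with Rplus.
  assert (h1 := h (S k)). assert (h2 := Cmod_ge_0 (a (S k))). lra.
Qed.

Lemma CSeries_incr_n (a : nat -> C) (n : nat) :
  ex_Cseries a ->
  CSeries a = sum_n (G := C_NormedModule) a n + CSeries (fun k => a (S n + k)%nat).
Proof.
  intro h. apply CSeries_unique.
  apply (is_series_decr_n (V := C_NormedModule) a (S n)); [lia|].
  simpl pred.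
  match goal with |- is_series _ ?l =>
    replace l with (CSeries (fun k => a (S n + k)%nat)) end.
  - apply CSeries_correct. apply (ex_series_incr_n (V := C_NormedModule) a (S n)). exact h.
  - change plus with Cplus. change opp with Copp. ring.
Qed.

Lemma Csum_n_cvg (a : nat -> nat -> C) (l : nat -> C) (n : nat) :
  (forall k, Ccvg (fun j => a j k) (l k)) ->
  Ccvg (fun j => sum_n (G := C_NormedModule) (a j) n) (sum_n (G := C_NormedModule) l n).
Proof.
  intro h. induction n as [|n IH].
  - apply Ccvg_ext with (fun j => a j O); [intro; now rewrite sum_O|]. rewrite sum_O. apply h.
  - rewrite sum_Sn.
    apply Ccvg_ext with (fun j => sum_n (G := C_NormedModule) (a j) n + a j (S n)).
    + intro j. now rewrite sum_Sn.
    + apply Ccvg_plus; [exact IH | apply h].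
Qed.

Lemma Series_tail_lim (b : nat -> R) :
  ex_series b -> is_lim_seq (fun n => Series (fun k => b (S n + k)%nat)) 0%R.
Proof.
  intro hb.
  apply is_lim_seq_ext with (fun n => Series b - sum_n (G := R_NormedModule) b n)%R.
  - intro n. rewrite (Series_incr_n b (S n)); [|lia | exact hb]. simpl pred.
    rewrite <- sum_n_Reals.
    match goal with |- (?x + ?y - ?x' = ?y')%R => change y' with y; change x' with x end. ring.
  - replace (Finite 0) with (Finite (Series b - Series b)) by (f_equal; ring).
    apply is_lim_seq_minus'; [apply is_lim_seq_const|]. exact (Series_correct b hb).
Qed.

(** Dominated convergence for series: past a fixed [N] both tails are below [eps / 3] by the
    majorant, and the finite head converges termwise. *)
Lemma Tannery (a : nat -> nat -> C) (l : nat -> C) (b : nat -> R) :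
  (forall j k, Cmod (a j k) <= b k)%R -> ex_series b ->
  (forall k, Ccvg (fun j => a j k) (l k)) ->
  ex_Cseries l /\ Ccvg (fun j => CSeries (a j)) (CSeries l).
Proof.
  intros hab hb hl.
  assert (hlb : forall k, (Cmod (l k) <= b k)%R).
  { intro k. apply (Ccvg_le _ _ _ (hl k)). intro j. apply hab. }
  split; [now apply ex_Cseries_le with b|].
  apply is_lim_seq_spec. intros eps.
  assert (he : (0 < eps / 3)%R) by (assert (h := cond_pos eps); lra).
  assert (ht := Series_tail_lim b hb). apply is_lim_seq_spec in ht.
  destruct (ht (mkposreal _ he)) as [N hN]. specialize (hN N (Nat.le_refl N)). simpl in hN.
  assert (hs := Csum_n_cvg a l N hl). apply is_lim_seq_spec in hs.
  specialize (hs (mkposreal _ he)). simpl in hs.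
  apply: filter_imp hs => j hs.
  rewrite Rminus_0_r Rabs_pos_eq in hs; [|apply Cmod_ge_0].
  rewrite Rminus_0_r Rabs_pos_eq; [|apply Cmod_ge_0].
  rewrite Rminus_0_r in hN. apply Rabs_lt_between in hN.
  assert (hbt : ex_series (fun k => b (S N + k)%nat)) by now apply ex_series_incr_n.
  assert (t1 := CSeries_bound (fun k => a j (S N + k)%nat) _ (fun k => hab j (S N + k)%nat) hbt).
  assert (t2 := CSeries_bound (fun k => l (S N + k)%nat) _ (fun k => hlb (S N + k)%nat) hbt).
  rewrite (CSeries_incr_n (a j) N); [|now apply ex_Cseries_le with b].
  rewrite (CSeries_incr_n l N); [|now apply ex_Cseries_le with b].
  match goal with |- (Cmod (?x + ?y - (?z + ?w)) < _)%R =>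
    replace (x + y - (z + w)) with ((x - z) + (y + - w)) by ring end.
  eapply Rle_lt_trans; [apply Cmod_triangle|].
  eapply Rle_lt_trans; [apply Rplus_le_compat_l, Cmod_triangle|]. rewrite Cmod_opp.
  simpl in t1, t2, hN |- *. lra.
Qed.

Lemma sum_n_CSeries (a : nat -> nat -> C) (n : nat) :
  (forall k, ex_Cseries (a k)) ->
  ex_Cseries (fun i => sum_n (G := C_NormedModule) (fun k => a k i) n) /\
  CSeries (fun i => sum_n (G := C_NormedModule) (fun k => a k i) n) =
  sum_n (G := C_NormedModule) (fun k => CSeries (a k)) n.
Proof.
  intro h.
  assert (Cseries_is (fun i => sum_n (G := C_NormedModule) (fun k => a k i) n)
            (sum_n (G := C_NormedModule) (fun k => CSeries (a k)) n)) as H.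
  { induction n as [|n IH].
    - rewrite sum_O. apply (is_series_ext (V := C_NormedModule) (a O)); [intro; now rewrite sum_O|].
      now apply CSeries_correct.
    - rewrite sum_Sn.
      apply (is_series_ext (V := C_NormedModule)
        (fun i => plus (sum_n (G := C_NormedModule) (fun k => a k i) n) (a (S n) i))).
      + intro i. now rewrite sum_Sn.
      + apply (is_series_plus (V := C_NormedModule)); [exact IH | now apply CSeries_correct]. }
  split; [eexists; exact H | now apply CSeries_unique].
Qed.

Lemma ex_series_mul (c : R) (a : nat -> R) : ex_series a -> ex_series (fun n => c * a n)%R.
Proof. apply (ex_series_scal_l (K := R_AbsRing) (V := R_NormedModule) c a). Qed.

Lemma CSeries_exchange (a : nat -> nat -> C) (b d : nat -> R) :
  (forall n k, Cmod (a n k) <= b n * d k)%R -> ex_series b -> ex_series d ->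
  CSeries (fun n => CSeries (a n)) = CSeries (fun k => CSeries (fun n => a n k)).
Proof.
  intros h hb hd.
  assert (hr : forall n, ex_Cseries (a n)).
  { intro n. apply ex_Cseries_le with (fun k => b n * d k)%R; [apply h|]. now apply ex_series_mul. }
  assert (hc : forall k, ex_Cseries (fun n => a n k)).
  { intro k. apply ex_Cseries_le with (fun n => b n * d k)%R; [intro; apply h|]. now apply ex_series_scal_r. }
  assert (hcb : forall k, (Cmod (CSeries (fun n => a n k)) <= Series b * d k)%R).
  { intro k. rewrite <- Series_scal_r. apply CSeries_bound; [intro; apply h | now apply ex_series_scal_r]. }
  assert (d0 : forall n k, (0 <= b n * d k)%R).
  { intros n k. eapply Rle_trans; [apply Cmod_ge_0 | apply h]. }
  assert (hex : ex_Cseries (fun k => CSeries (fun n => a n k))).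
  { apply ex_Cseries_le with (fun k => Series b * d k)%R; [exact hcb | now apply ex_series_mul]. }
  (* Here the limit index is the truncation [K] of the inner sum: the truncated double sums are
     dominated by [b n * Series d] and can be swapped as finite sums. *)
  destruct (Tannery (fun K n => sum_n (G := C_NormedModule) (a n) K) (fun n => CSeries (a n))
              (fun n => b n * Series d)%R) as [_ H].
  - intros K n. eapply Rle_trans; [apply (Csum_n_bound (a n) (fun k => b n * d k)%R), h|].
    rewrite <- Series_scal_l.
    assert (hs := Series_correct _ (ex_series_mul (b n) d hd)).
    apply (is_lim_seq_incr_compare (sum_n (G := R_NormedModule) (fun k => b n * d k)%R) _ hs).
    intro k. rewrite sum_Sn. change plus with Rplus. assert (h0 := d0 n (S k)). lra.
  - now apply ex_series_scal_r.
  - intro n. apply Cseries_is_cvg. now apply CSeries_correct.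
  - apply (Ccvg_unique _ _ _ H).
    apply Ccvg_ext with (sum_n (G := C_NormedModule) (fun k => CSeries (fun n => a n k))).
    + intro K. symmetry. apply (sum_n_CSeries (fun k n => a n k) K hc).
    + apply Cseries_is_cvg. now apply CSeries_correct.
Qed.

(** * Shifted factorials *)

Definition qnorm (q : C) : Prop := (0 < Cmod q < 1)%R.

Definition poch (x q : C) (n : nat) : C := Cprod (fun i => 1 - x * q ^ i) n.

(** From |1 - x q^i| <= 1 + B |q|^i <= exp (B |q|^i), multiplied over all i: a bound for (x;q)_n
    that is uniform in n and in |x| <= B. *)
Definition poch_max (q : C) (B : R) : R := exp (B / (1 - Cmod q)).

Lemma qnorm_neq0 {q : C} : qnorm q -> q <> 0.
Proof. intros [h _]. now apply Cmod_gt_0. Qed.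

Lemma poch_0 (x q : C) : poch x q 0 = 1.
Proof. reflexivity. Qed.

Lemma poch_Sr (x q : C) (n : nat) : poch x q (S n) = poch x q n * (1 - x * q ^ n).
Proof. reflexivity. Qed.

Lemma poch_Sl (x q : C) (n : nat) : poch x q (S n) = (1 - x) * poch (x * q) q n.
Proof.
  induction n as [|n IH].
  - unfold poch. simpl. ring.
  - rewrite poch_Sr IH (poch_Sr (x * q)) Cpow_S. ring.
Qed.

Lemma poch_add (x q : C) (n m : nat) : poch x q (n + m) = poch x q n * poch (x * q ^ n) q m.
Proof.
  induction m as [|m IH].
  - rewrite Nat.add_0_r poch_0. ring.
  - rewrite Nat.add_succ_r poch_Sr IH poch_Sr Cpow_add_r. ring.
Qed.

Lemma poch_zero (q : C) (n : nat) : poch 0 q n = 1.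
Proof. induction n as [|n IH]; [reflexivity|]. rewrite poch_Sr IH. ring. Qed.

Lemma poch_neq0 (x q : C) (n : nat) : (forall i, 1 - x * q ^ i <> 0) -> poch x q n <> 0.
Proof.
  intro h. induction n as [|n IH]; [exact C1_nz|].
  rewrite poch_Sr. now apply Cmult_neq_0.
Qed.

Definition geom_sum (r : R) (n : nat) : R := ((1 - r ^ n) / (1 - r))%R.

Lemma geom_sum_S (r : R) (n : nat) : (0 < r < 1)%R -> geom_sum r (S n) = (geom_sum r n + r ^ n)%R.
Proof. intro h. unfold geom_sum. simpl. field. lra. Qed.

Lemma geom_sum_bounds (r : R) (n : nat) : (0 < r < 1)%R -> (0 <= geom_sum r n <= / (1 - r))%R.
Proof.
  intro h. unfold geom_sum.
  assert (h1 : (0 <= r ^ n <= 1)%R).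
  { split; [apply pow_le; lra|]. rewrite <- (pow1 n). apply pow_incr. lra. }
  assert (h2 : (0 < / (1 - r))%R) by (apply Rinv_0_lt_compat; lra).
  unfold Rdiv. split; [apply Rmult_le_pos; lra|].
  rewrite <- (Rmult_1_l (/ (1 - r))) at 2. apply Rmult_le_compat_r; lra.
Qed.

Lemma poch_bound_aux (q x : C) (B : R) (n : nat) :
  qnorm q -> (Cmod x <= B)%R -> (Cmod (poch x q n) <= exp (B * geom_sum (Cmod q) n))%R.
Proof.
  intros hq hx. assert (h0 := Cmod_ge_0 x). induction n as [|n IH].
  - rewrite poch_0 Cmod_1. unfold geom_sum. simpl.
    replace (B * ((1 - 1) / (1 - Cmod q)))%R with 0%R by (unfold Rdiv; ring).
    rewrite exp_0. lra.
  - rewrite poch_Sr Cmod_mult (geom_sum_S _ _ hq) Rmult_plus_distr_l exp_plus.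
    apply Rmult_le_compat; [apply Cmod_ge_0 | apply Cmod_ge_0 | exact IH |].
    eapply Rle_trans; [apply Cmod_triangle|].
    rewrite Cmod_1 Cmod_opp Cmod_mult Cmod_pow.
    eapply Rle_trans; [| apply exp_ineq1_le].
    apply Rplus_le_compat_l, Rmult_le_compat_r; [|exact hx]. apply pow_le. apply Cmod_ge_0.
Qed.

Lemma poch_max_aux (q : C) (B : R) (n : nat) :
  qnorm q -> (0 <= B)%R -> (exp (B * geom_sum (Cmod q) n) <= poch_max q B)%R.
Proof.
  intros hq hR. unfold poch_max. destruct (geom_sum_bounds (Cmod q) n hq) as [_ h].
  assert (h' : (B * geom_sum (Cmod q) n <= B / (1 - Cmod q))%R).
  { apply Rmult_le_compat_l; [exact hR | exact h]. }
  destruct h' as [h'|h']; [left; now apply exp_increasing | right; now rewrite h'].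
Qed.

Lemma poch_max_pos (q : C) (B : R) : (0 < poch_max q B)%R.
Proof. apply exp_pos. Qed.

Lemma poch_bound {q : C} (hq : qnorm q) (x : C) (B : R) (n : nat) :
  (Cmod x <= B)%R -> (Cmod (poch x q n) <= poch_max q B)%R.
Proof.
  intros hx. assert (h0 := Cmod_ge_0 x).
  eapply Rle_trans; [exact (poch_bound_aux q x B n hq hx) | apply poch_max_aux; [assumption | lra]].
Qed.

(** The constant does not depend on [n], so the estimate passes to the infinite product; continuity
    of (x;q)_oo in x rests on this. *)
Lemma poch_lipschitz {q : C} (hq : qnorm q) (x y : C) (B : R) (n : nat) :
  (Cmod x <= B)%R -> (Cmod y <= B)%R ->
  (Cmod (poch x q n - poch y q n) <= poch_max q B / (1 - Cmod q) * Cmod (x - y))%R.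
Proof.
  intros hx hy. assert (h0 := Cmod_ge_0 x). assert (hxy := Cmod_ge_0 (x - y)).
  assert (H : (Cmod (poch x q n - poch y q n) <=
    exp (B * geom_sum (Cmod q) n) * geom_sum (Cmod q) n * Cmod (x - y))%R).
  { induction n as [|n IH].
    - rewrite !poch_0. replace (1 - 1) with (RtoC 0) by ring. rewrite Cmod_0.
      apply Rmult_le_pos; [|exact hxy]. apply Rmult_le_pos; [left; apply exp_pos|].
      apply (geom_sum_bounds (Cmod q) 0 hq).
    - rewrite !poch_Sr.
      replace (poch x q n * (1 - x * q ^ n) - poch y q n * (1 - y * q ^ n)) with
        ((poch x q n - poch y q n) * (1 - x * q ^ n) + poch y q n * (- (x - y) * q ^ n)) by ring.
      eapply Rle_trans; [apply Cmod_triangle|].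
      rewrite !Cmod_mult Cmod_opp Cmod_pow.
      assert (hp : (0 <= Cmod q ^ n)%R) by (apply pow_le, Cmod_ge_0).
      assert (hg := geom_sum_bounds (Cmod q) n hq).
      assert (h1 : (Cmod (1 - x * q ^ n) <= exp (B * Cmod q ^ n))%R).
      { eapply Rle_trans; [apply Cmod_triangle|].
        rewrite Cmod_1 Cmod_opp Cmod_mult Cmod_pow.
        eapply Rle_trans; [| apply exp_ineq1_le].
        apply Rplus_le_compat_l, Rmult_le_compat_r; assumption. }
      assert (h2 := poch_bound_aux q y B n hq hy).
      assert (h3 : (1 <= exp (B * Cmod q ^ n))%R).
      { eapply Rle_trans; [| apply exp_ineq1_le]. assert (0 <= B * Cmod q ^ n)%R; [|lra].
        apply Rmult_le_pos; lra. }
      rewrite (geom_sum_S _ _ hq) (Rmult_plus_distr_l B) exp_plus.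
      assert (hE : (0 < exp (B * geom_sum (Cmod q) n))%R) by apply exp_pos.
      assert (hdg := Cmod_ge_0 (1 - x * q ^ n)).
      assert (hd := Cmod_ge_0 (poch x q n - poch y q n)).
      apply Rle_trans with
        (exp (B * geom_sum (Cmod q) n) * geom_sum (Cmod q) n * Cmod (x - y) * exp (B * Cmod q ^ n)
         + exp (B * geom_sum (Cmod q) n) * (Cmod (x - y) * Cmod q ^ n))%R.
      { apply Rplus_le_compat; [now apply Rmult_le_compat|].
        apply Rmult_le_compat_r; [now apply Rmult_le_pos | exact h2]. }
      assert (h4 : (exp (B * geom_sum (Cmod q) n) * (Cmod (x - y) * Cmod q ^ n) * 1 <=
        exp (B * geom_sum (Cmod q) n) * (Cmod (x - y) * Cmod q ^ n) * exp (B * Cmod q ^ n))%R).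
      { apply Rmult_le_compat_l; [|exact h3]. apply Rmult_le_pos; [lra | now apply Rmult_le_pos]. }
      lra. }
  eapply Rle_trans; [exact H|]. apply Rmult_le_compat_r; [exact hxy|].
  assert (hg := geom_sum_bounds (Cmod q) n hq).
  apply Rmult_le_compat; [left; apply exp_pos | lra | apply poch_max_aux; [assumption|lra] | lra].
Qed.

(** The increments are -(x;q)_n x q^n, hence geometrically small, and the partial products are
    partial sums of an absolutely convergent series. *)
Lemma poch_Ccvg_ex {q : C} (hq : qnorm q) (x : C) : exists l, Ccvg (poch x q) l.
Proof.
  assert (he : ex_Cseries (fun n => poch x q (S n) - poch x q n)).
  { apply ex_Cseries_le with (fun n => (poch_max q (Cmod x) * Cmod x) * Cmod q ^ n)%R.
    - intro n. rewrite poch_Sr.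
      replace (poch x q n * (1 - x * q ^ n) - poch x q n) with (- (poch x q n * x * q ^ n)) by ring.
      rewrite Cmod_opp !Cmod_mult Cmod_pow.
      apply Rmult_le_compat_r; [apply pow_le, Cmod_ge_0|].
      apply Rmult_le_compat_r; [apply Cmod_ge_0|]. apply poch_bound; [assumption | apply Rle_refl].
    - apply ex_series_mul, ex_series_geom. rewrite Rabs_pos_eq; [apply hq | apply Cmod_ge_0]. }
  destruct he as [l hl]. apply Cseries_is_cvg in hl.
  exists (1 + l).
  assert (h : Ccvg (fun n => poch x q (S n)) (1 + l)).
  { apply Ccvg_ext with
      (fun n => 1 + sum_n (G := C_NormedModule) (fun n => poch x q (S n) - poch x q n) n).
    - intro n. induction n as [|n IH].
      + rewrite sum_O poch_0. ring.
      + rewrite sum_Sn. change plus with Cplus. rewrite Cplus_assoc IH. ring.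
    - apply Ccvg_plus; [apply Ccvg_const | exact hl]. }
  apply (is_lim_seq_incr_1 (fun n => Cmod (poch x q n - (1 + l)))). exact h.
Qed.

Lemma poch_Ccvg {q : C} (hq : qnorm q) (x : C) : Ccvg (poch x q) (qpoch_inf x q).
Proof.
  destruct (poch_Ccvg_ex hq x) as [l hl]. unfold qpoch_inf.
  fold (poch x q). rewrite (Clim_seq_unique _ _ hl). exact hl.
Qed.

Lemma pinf_bound {q : C} (hq : qnorm q) (x : C) (B : R) :
  (Cmod x <= B)%R -> (Cmod (qpoch_inf x q) <= poch_max q B)%R.
Proof. intro h. apply (Ccvg_le _ _ _ (poch_Ccvg hq x)). intro n. now apply poch_bound. Qed.

Lemma pinf_lipschitz {q : C} (hq : qnorm q) (x y : C) (B : R) :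
  (Cmod x <= B)%R -> (Cmod y <= B)%R ->
  (Cmod (qpoch_inf x q - qpoch_inf y q) <= poch_max q B / (1 - Cmod q) * Cmod (x - y))%R.
Proof.
  intros hx hy.
  apply (Ccvg_le _ _ _ (Ccvg_minus _ _ _ _ (poch_Ccvg hq x) (poch_Ccvg hq y))).
  intro n. now apply poch_lipschitz.
Qed.

Lemma pinf_poch {q : C} (hq : qnorm q) (x : C) (n : nat) :
  qpoch_inf x q = poch x q n * qpoch_inf (x * q ^ n) q.
Proof.
  apply (Ccvg_unique (fun m => poch x q (n + m))).
  - assert (h := proj1 (is_lim_seq_incr_n (fun m => Cmod (poch x q m - qpoch_inf x q)) n 0%R) (poch_Ccvg hq x)).
    apply: is_lim_seq_ext h => m. now rewrite Nat.add_comm.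
  - apply Ccvg_ext with (fun m => poch x q n * poch (x * q ^ n) q m).
    + intro m. now rewrite poch_add.
    + apply Ccvg_mult; [apply Ccvg_const | now apply poch_Ccvg].
Qed.

Lemma pinf_S {q : C} (hq : qnorm q) (x : C) :
  qpoch_inf x q = (1 - x) * qpoch_inf (x * q) q.
Proof.
  rewrite (pinf_poch hq x 1) poch_Sr poch_0.
  replace (x * q ^ 1) with (x * q) by (simpl; ring). simpl. ring.
Qed.

Lemma pinf_0 {q : C} (hq : qnorm q) : qpoch_inf 0 q = 1.
Proof.
  apply (Ccvg_unique _ _ _ (poch_Ccvg hq 0)).
  apply Ccvg_ext with (fun _ => 1); [intro n; now rewrite poch_zero | apply Ccvg_const].
Qed.

Lemma pinf_1 {q : C} (hq : qnorm q) : qpoch_inf 1 q = 0.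
Proof. rewrite (pinf_S hq). ring. Qed.

Lemma Ccvg_poch {q : C} (hq : qnorm q) (u : nat -> C) (l : C) (n : nat) :
  Ccvg u l -> Ccvg (fun j => poch (u j) q n) (poch l q n).
Proof.
  intro h. induction n as [|n IH]; [exact (Ccvg_const 1)|].
  apply (Ccvg_mult _ _ _ _ IH). apply Ccvg_minus; [apply (Ccvg_const 1)|].
  apply Ccvg_mult; [exact h | apply (Ccvg_const (q ^ n))].
Qed.

Lemma Ccvg_pinf {q : C} (hq : qnorm q) (u : nat -> C) (l : C) :
  Ccvg u l -> Ccvg (fun j => qpoch_inf (u j) q) (qpoch_inf l q).
Proof.
  intro h. destruct (Ccvg_bound _ _ h) as [B hR].
  assert (hl := Ccvg_le _ _ _ h hR).
  apply Ccvg_squeeze with (fun j => poch_max q B / (1 - Cmod q) * Cmod (u j - l))%R.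
  - intro j. now apply pinf_lipschitz.
  - replace (Finite 0) with (Finite (poch_max q B / (1 - Cmod q) * 0)) by (f_equal; ring).
    apply is_lim_seq_mult'; [apply is_lim_seq_const | exact h].
Qed.

Lemma Ccvg_pow {z : C} : (Cmod z < 1)%R -> Ccvg (fun n => z ^ n) 0.
Proof.
  intro h. apply Ccvg_squeeze with (fun n => Cmod z ^ n)%R.
  - intro n. replace (z ^ n - 0) with (z ^ n) by ring. rewrite Cmod_pow. apply Rle_refl.
  - apply is_lim_seq_geom. rewrite Rabs_pos_eq; [exact h | apply Cmod_ge_0].
Qed.

Lemma Ccvg_qpow {q : C} (hq : qnorm q) (x : C) : Ccvg (fun n => x * q ^ n) 0.
Proof.
  replace (RtoC 0) with (x * 0) by ring.
  apply Ccvg_mult; [apply Ccvg_const | apply Ccvg_pow, hq].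
Qed.

Lemma pinf_tail {q : C} (hq : qnorm q) (x : C) : Ccvg (fun n => qpoch_inf (x * q ^ n) q) 1.
Proof. rewrite <- (pinf_0 hq). apply (Ccvg_pinf hq), (Ccvg_qpow hq). Qed.

(** If the product were 0 with no factor equal to 0, every tail (x q^n;q)_oo would be 0, whereas the
    tails tend to 1. *)
Lemma pinf_neq0 {q : C} (hq : qnorm q) (x : C) :
  (forall i, 1 - x * q ^ i <> 0) -> qpoch_inf x q <> 0.
Proof.
  intros h h0. apply C1_nz. symmetry.
  apply (Ccvg_unique (fun n => qpoch_inf (x * q ^ n) q)); [|apply (pinf_tail hq)].
  apply Ccvg_ext with (fun _ => RtoC 0); [|apply Ccvg_const].
  intro n. rewrite (pinf_poch hq x n) in h0.
  destruct (Ceq_dec (qpoch_inf (x * q ^ n) q) 0) as [e|e]; [now rewrite e|].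
  exfalso. now apply (Cmult_neq_0 _ _ (poch_neq0 x q n h) e).
Qed.

Lemma pinf_neq0_shift {q : C} (hq : qnorm q) (x : C) (n : nat) :
  qpoch_inf x q <> 0 -> qpoch_inf (x * q ^ n) q <> 0.
Proof. intros h h0. apply h. rewrite (pinf_poch hq x n) h0. ring. Qed.

Lemma poch_neq0_pinf {q : C} (hq : qnorm q) (x : C) (n : nat) :
  qpoch_inf x q <> 0 -> poch x q n <> 0.
Proof. intros h h0. apply h. rewrite (pinf_poch hq x n) h0. ring. Qed.

Lemma pinf_small_neq0 {q : C} (hq : qnorm q) (x : C) : (Cmod x < 1)%R -> qpoch_inf x q <> 0.
Proof.
  intro h. apply (pinf_neq0 hq). intros i h0.
  assert (h1 : x * q ^ i = 1) by (replace (x * q ^ i) with (1 - (1 - x * q ^ i)) by ring; rewrite h0; ring).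
  assert (h2 : Cmod (x * q ^ i) = 1%R) by (rewrite h1; apply Cmod_1).
  rewrite Cmod_mult Cmod_pow in h2.
  assert (h3 : (Cmod q ^ i <= 1)%R).
  { rewrite <- (pow1 i). apply pow_incr. destruct hq. lra. }
  assert (h4 : (0 <= Cmod q ^ i)%R) by (apply pow_le, Cmod_ge_0).
  assert (h5 := Cmod_ge_0 x). nra.
Qed.

Lemma pinf_q_neq0 {q : C} (hq : qnorm q) : qpoch_inf q q <> 0.
Proof. apply (pinf_small_neq0 hq), hq. Qed.

(** * Very-well-poised series *)

(* For a <> 1 this is (1 - a q^2n) / (1 - a) * (a;q)_n / (q;q)_n. *)
Definition vwp (a q : C) (n : nat) : C :=
  match n with
  | O => 1
  | S m => (1 - a * q ^ (2 * n)) * poch (a * q) q m / poch q q n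
  end.

(* A pair (x, y) stands for the factor (x;q)_n / (y;q)_n, multiplied by
   (y;q)_oo so that no denominator remains. *)
Definition pair_prod (L : list (C * C)) (q : C) (n : nat) : C :=
  fold_right (fun p acc => poch (fst p) q n * qpoch_inf (snd p * q ^ n) q * acc) 1 L.

Definition Wterm (a : C) (L : list (C * C)) (q z : C) (n : nat) : C :=
  vwp a q n * pair_prod L q n * z ^ n.

Definition Wsum (a : C) (L : list (C * C)) (q z : C) : C := CSeries (Wterm a L q z).

(** Entrywise convergence of lists of one fixed length, made inductive so that uniform bounds and
    limits of [pair_prod] follow by induction on the derivation. *)
Inductive pairs_cvg : (nat -> list (C * C)) -> list (C * C) -> Prop :=
| pairs_cvg_nil : pairs_cvg (fun _ => []) []
| pairs_cvg_cons u v x y Ls L :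
    Ccvg u x -> Ccvg v y -> pairs_cvg Ls L ->
    pairs_cvg (fun j => (u j, v j) :: Ls j) ((x, y) :: L).

Lemma pairs_cvg_const (L : list (C * C)) : pairs_cvg (fun _ => L) L.
Proof.
  induction L as [|[x y] L IH]; [constructor|].
  apply (pairs_cvg_cons (fun _ => x) (fun _ => y) x y (fun _ => L)); [apply Ccvg_const | apply Ccvg_const | exact IH].
Qed.

Lemma poch_q_neq0 {q : C} (hq : qnorm q) (n : nat) : poch q q n <> 0.
Proof. apply (poch_neq0_pinf hq), (pinf_q_neq0 hq). Qed.

Lemma Cmod_mul_le (x y : C) (A B : R) :
  (Cmod x <= A)%R -> (Cmod y <= B)%R -> (Cmod (x * y) <= A * B)%R.
Proof. intros h h'. rewrite Cmod_mult. apply Rmult_le_compat; auto using Cmod_ge_0. Qed.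

Lemma Cmod_qpow_le {q : C} (hq : qnorm q) (x : C) (n : nat) : (Cmod (x * q ^ n) <= Cmod x)%R.
Proof.
  rewrite -[X in (_ <= X)%R]Rmult_1_r. rewrite Cmod_mult Cmod_pow.
  apply Rmult_le_compat_l; [apply Cmod_ge_0|].
  rewrite <- (pow1 n). apply pow_incr. destruct hq. lra.
Qed.

Lemma vwp_bound {q : C} (hq : qnorm q) (B : R) :
  exists K, forall a n, (Cmod a <= B)%R -> (Cmod (vwp a q n) <= K)%R.
Proof.
  assert (hq0 := proj1 (Cmod_gt_0 _) (pinf_q_neq0 hq)).
  set (K := ((1 + B) * poch_max q B * (poch_max q 1 / Cmod (qpoch_inf q q)))%R).
  exists (Rmax 1 K). intros a [|m] ha.
  - simpl vwp. rewrite Cmod_1. apply Rmax_l.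
  - eapply Rle_trans; [|apply Rmax_r]. unfold vwp, Cdiv.
    assert (h0 := Cmod_ge_0 a).
    apply Cmod_mul_le; [apply Cmod_mul_le|].
    + eapply Rle_trans; [apply Cmod_triangle|]. rewrite Cmod_1 Cmod_opp.
      apply Rplus_le_compat_l. eapply Rle_trans; [apply (Cmod_qpow_le hq) | exact ha].
    + apply (poch_bound hq). eapply Rle_trans; [|exact ha].
      replace (a * q) with (a * q ^ 1) by (simpl; ring). apply (Cmod_qpow_le hq).
    + rewrite (Cmod_inv _ (poch_q_neq0 hq (S m))).
      (* 1/(q;q)_n is (q^(n+1);q)_oo / (q;q)_oo, and this form is bounded uniformly in n. *)
      replace (/ Cmod (poch q q (S m)))%R with
        (Cmod (qpoch_inf (q * q ^ S m) q) / Cmod (qpoch_inf q q))%R.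
      * apply Rmult_le_compat_r; [left; now apply Rinv_0_lt_compat|].
        apply (pinf_bound hq). eapply Rle_trans; [apply (Cmod_qpow_le hq)|]. destruct hq. lra.
      * rewrite (pinf_poch hq q (S m)) Cmod_mult. field.
        rewrite (pinf_poch hq q (S m)) Cmod_mult in hq0.
        split; intro h; rewrite h in hq0; lra.
Qed.

Lemma pairs_cvg_bound {q : C} (hq : qnorm q) (Ls : nat -> list (C * C)) (L : list (C * C)) :
  pairs_cvg Ls L -> exists K, forall j n, (Cmod (pair_prod (Ls j) q n) <= K)%R.
Proof.
  induction 1 as [|u v x y Ls L hu hv _ [K IH]].
  - exists 1%R. intros j n. simpl. rewrite Cmod_1. apply Rle_refl.
  - destruct (Ccvg_bound _ _ hu) as [A hA]. destruct (Ccvg_bound _ _ hv) as [B hB].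
    exists (poch_max q A * poch_max q B * K)%R. intros j n. simpl.
    apply Cmod_mul_le; [apply Cmod_mul_le|apply IH].
    + now apply (poch_bound hq).
    + apply (pinf_bound hq). eapply Rle_trans; [apply (Cmod_qpow_le hq) | apply hB].
Qed.

Lemma Ccvg_pair_prod {q : C} (hq : qnorm q) (Ls : nat -> list (C * C)) (L : list (C * C)) (n : nat) :
  pairs_cvg Ls L -> Ccvg (fun j => pair_prod (Ls j) q n) (pair_prod L q n).
Proof.
  induction 1 as [|u v x y Ls L hu hv _ IH]; [exact (Ccvg_const 1)|].
  simpl. apply Ccvg_mult; [apply Ccvg_mult | exact IH].
  - now apply (Ccvg_poch hq).
  - apply (Ccvg_pinf hq). apply Ccvg_mult; [exact hv | apply (Ccvg_const (q ^ n))].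
Qed.

Lemma Ccvg_Cpow (u : nat -> C) (l : C) (n : nat) : Ccvg u l -> Ccvg (fun j => u j ^ n) (l ^ n).
Proof.
  intro h. induction n as [|n IH]; [exact (Ccvg_const 1)|].
  simpl. now apply Ccvg_mult.
Qed.

Lemma Ccvg_vwp {q : C} (hq : qnorm q) (u : nat -> C) (l : C) (n : nat) :
  Ccvg u l -> Ccvg (fun j => vwp (u j) q n) (vwp l q n).
Proof.
  intro h. destruct n as [|m]; [exact (Ccvg_const 1)|].
  unfold vwp, Cdiv. apply Ccvg_mult; [apply Ccvg_mult | apply Ccvg_const].
  - apply Ccvg_minus; [apply Ccvg_const|]. apply Ccvg_mult; [exact h | apply Ccvg_const].
  - apply (Ccvg_poch hq). apply Ccvg_mult; [exact h | apply Ccvg_const].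
Qed.

Lemma Wterm_bound {q : C} (hq : qnorm q) (u zs : nat -> C) (l : C) Ls L (r : R) :
  Ccvg u l -> pairs_cvg Ls L -> (forall j, Cmod (zs j) <= r)%R ->
  exists K, forall j n, (Cmod (Wterm (u j) (Ls j) q (zs j) n) <= K * r ^ n)%R.
Proof.
  intros hu hL hz. destruct (Ccvg_bound _ _ hu) as [A hA].
  destruct (vwp_bound hq A) as [K1 h1]. destruct (pairs_cvg_bound hq Ls L hL) as [K2 h2].
  exists (K1 * K2)%R. intros j n. unfold Wterm.
  apply Cmod_mul_le; [apply Cmod_mul_le; auto|].
  rewrite Cmod_pow. apply pow_incr. split; [apply Cmod_ge_0 | apply hz].
Qed.

Lemma ex_series_mul_geom (K r : R) : (0 <= r < 1)%R -> ex_series (fun n => K * r ^ n)%R.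
Proof. intro h. apply ex_series_mul, ex_series_geom. rewrite Rabs_pos_eq; lra. Qed.

Lemma ex_Wsum {q : C} (hq : qnorm q) (a z : C) L :
  (Cmod z < 1)%R -> ex_Cseries (Wterm a L q z).
Proof.
  intro hz.
  destruct (Wterm_bound hq (fun _ => a) (fun _ => z) a (fun _ => L) L (Cmod z)) as [K hK].
  - apply Ccvg_const.
  - apply pairs_cvg_const.
  - intros _. apply Rle_refl.
  - apply ex_Cseries_le with (fun n => K * Cmod z ^ n)%R; [exact (hK O)|].
    apply ex_series_mul_geom. split; [apply Cmod_ge_0 | exact hz].
Qed.

(** Joint continuity in base, parameters and argument. The common bound [r] on the arguments turns
    [Wterm_bound] into the geometric majorant that [Tannery] asks for. *)
Lemma Ccvg_Wsum {q : C} (hq : qnorm q) (u zs : nat -> C) (a z : C) Ls L (r : R) :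
  Ccvg u a -> pairs_cvg Ls L -> Ccvg zs z -> (forall j, Cmod (zs j) <= r)%R -> (r < 1)%R ->
  Ccvg (fun j => Wsum (u j) (Ls j) q (zs j)) (Wsum a L q z).
Proof.
  intros hu hL hz hr r1.
  destruct (Wterm_bound hq u zs a Ls L r hu hL hr) as [K hK].
  apply (Tannery (fun j => Wterm (u j) (Ls j) q (zs j)) (Wterm a L q z) (fun n => K * r ^ n)%R).
  - exact hK.
  - apply ex_series_mul_geom. split; [|exact r1]. eapply Rle_trans; [apply Cmod_ge_0 | apply (hr O)].
  - intro n. unfold Wterm. apply Ccvg_mult; [apply Ccvg_mult|].
    + now apply (Ccvg_vwp hq).
    + now apply (Ccvg_pair_prod hq).
    + now apply Ccvg_Cpow.
Qed.

Lemma vwp_eq {q : C} (hq : qnorm q) (a : C) (n : nat) :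
  1 - a <> 0 -> (1 - a * q ^ (2 * n)) / (1 - a) * (poch a q n / poch q q n) = vwp a q n.
Proof.
  intro h. destruct n as [|m].
  - unfold vwp, poch. simpl. field. exact h.
  - unfold vwp. rewrite (poch_Sl a). field. split; [exact (poch_q_neq0 hq (S m)) | exact h].
Qed.

Lemma vwp_pinf {q : C} (hq : qnorm q) (a : C) (n : nat) :
  qpoch_inf a q <> 0 ->
  qpoch_inf q q * vwp a q n =
  (1 - a * q ^ (2 * n)) * qpoch_inf (q * q ^ n) q * qpoch_inf (a * q) q / qpoch_inf (a * q ^ n) q.
Proof.
  intro h. rewrite (pinf_poch hq q n).
  assert (h1 := poch_q_neq0 hq n).
  destruct n as [|m].
  - unfold vwp. rewrite poch_0. rewrite (pinf_S hq a) in h.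
    replace (a * q ^ 0) with a by (simpl; ring). rewrite (pinf_S hq a).
    replace (a * q ^ (2 * 0)) with a by (simpl; ring). field.
    split; intro h'; apply h; rewrite h'; ring.
  - unfold vwp. rewrite (pinf_poch hq (a * q) m).
    assert (h2 := pinf_neq0_shift hq a (S m) h).
    replace (a * q * q ^ m) with (a * q ^ S m) by (simpl; ring).
    field. split; assumption.
Qed.

(** * The nonterminating 6phi5 sum *)

(* s^-k g_k(s) = (1/s;q)_k; unlike (b;q)_k this extends to s = 1/b = 0. *)
Definition gprod (s q : C) (k : nat) : C := Cprod (fun i => s - q ^ i) k.

(** The term of the 6phi5 series with base a and upper parameters x, y, 1/s, multiplied by (aq/x,
    aq/y, aqs;q)_oo. *)
Definition six_term (a x y q s : C) (k : nat) : C :=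
  vwp a q k * (poch x q k * poch y q k) *
  (qpoch_inf (a * q / x * q ^ k) q * qpoch_inf (a * q / y * q ^ k) q *
   qpoch_inf (a * q * s * q ^ k) q) *
  ((a * q / (x * y)) ^ k * gprod s q k).

(** An antidifference in k for the recurrence s -> sq. It is 0 at k = 0, so after summation only its
    limit at infinity could survive. *)
Definition six_cert (a x y q s : C) (k : nat) : C :=
  match k with
  | O => 0
  | S m =>
    - (s * (poch (a * q) q m / poch q q m) * (poch x q k * poch y q k) *
       (qpoch_inf (a * q / x * q ^ m) q * qpoch_inf (a * q / y * q ^ m) q *
        qpoch_inf (a * q * s * q ^ k) q) *
       (a * q / (x * y) * ((a * q / (x * y)) ^ m * gprod s q m)))
  end.

Lemma gprod_Sr (s q : C) (k : nat) : gprod s q (S k) = gprod s q k * (s - q ^ k).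
Proof. reflexivity. Qed.

Lemma gprod_shift (s q : C) (m : nat) :
  gprod (s * q) q (S m) = (s * q - 1) * q ^ m * gprod s q m.
Proof.
  induction m as [|m IH]; [unfold gprod; simpl; ring|].
  rewrite gprod_Sr IH (gprod_Sr s) !Cpow_S. ring.
Qed.

Lemma pinf_qpow_S {q : C} (hq : qnorm q) (x : C) (m : nat) :
  qpoch_inf (x * q ^ m) q = (1 - x * q ^ m) * qpoch_inf (x * q ^ S m) q.
Proof. rewrite (pinf_S hq). do 2 f_equal. simpl. ring. Qed.

Lemma six_telescope {q : C} (hq : qnorm q) (a x y s : C) (k : nat) : x <> 0 -> y <> 0 ->
  (1 - a * q / (x * y) * s) * six_term a x y q s k =
  (1 - a * q * s / x) * (1 - a * q * s / y) * six_term a x y q (s * q) k +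
  (six_cert a x y q s (S k) - six_cert a x y q s k).
Proof.
  intros hx hy. destruct k as [|m].
  - unfold six_term, six_cert, vwp. rewrite !poch_Sr !poch_0.
    rewrite (pinf_qpow_S hq (a * q * s) 0).
    replace (a * q * (s * q) * q ^ 0) with (a * q * s * q ^ 1) by (simpl; ring).
    replace (q ^ 0) with (RtoC 1) by reflexivity.
    unfold gprod. simpl. field. split; assumption.
  - unfold six_term, six_cert, vwp.
    replace (a * q * (s * q) * q ^ S m) with (a * q * s * q ^ S (S m)) by (simpl; ring).
    rewrite gprod_shift !(gprod_Sr s).
    rewrite (poch_Sr (a * q) q m) (poch_Sr q q m) (poch_Sr x q (S m)) (poch_Sr y q (S m)).
    rewrite (pinf_qpow_S hq (a * q / x) m) (pinf_qpow_S hq (a * q / y) m).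
    rewrite (pinf_qpow_S hq (a * q * s) (S m)).
    assert (h1 := poch_q_neq0 hq m). assert (h2 := poch_q_neq0 hq (S m)).
    rewrite poch_Sr in h2.
    assert (h3 : 1 - q * q ^ m <> 0) by (intro h; apply h2; rewrite h; ring).
    replace (q ^ (2 * S m)) with (q * q * (q ^ m * q ^ m))
      by (replace (2 * S m)%nat with (2 + (m + m))%nat by lia; rewrite !Cpow_add_r; simpl; ring).
    replace (q ^ S m) with (q * q ^ m) by reflexivity.
    replace ((a * q / (x * y)) ^ S m) with ((a * q / (x * y)) * (a * q / (x * y)) ^ m) by reflexivity.
    (* All factors common to the three terms become variables; what is left is a rational identity
       in Q = q^m. *)
    generalize (qpoch_inf (a * q / x * (q * q ^ m)) q) (qpoch_inf (a * q / y * (q * q ^ m)) q)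
      (qpoch_inf (a * q * s * q ^ S (S m)) q) (gprod s q m) ((a * q / (x * y)) ^ m)
      (poch x q (S m)) (poch y q (S m)) (poch (a * q) q m).
    intros. generalize dependent (q ^ m). intros Q h2 h3. generalize dependent (poch q q m). intros P h1 h2.
    field. repeat split; assumption.
Qed.

Lemma CSeries_first (a : nat -> C) : (forall k, a (S k) = 0) -> Cseries_is a (a O).
Proof.
  intro h. apply Cseries_is_cvg. apply Ccvg_ext with (fun _ => a O); [|apply Ccvg_const].
  intro n. induction n as [|n IH]; [now rewrite sum_O|].
  rewrite sum_Sn -IH h. change plus with Cplus. ring.
Qed.

(** The limit [l] is kept general: it is 0 for the 6phi5 series, but not for Bailey's series. *)
Lemma CSeries_telescope (u v c : nat -> C) (A B l : C) :
  ex_Cseries u -> ex_Cseries v -> Ccvg c l -> c O = 0 ->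
  (forall k, A * u k = B * v k + (c (S k) - c k)) ->
  A * CSeries u = B * CSeries v + l.
Proof.
  intros hu hv hc c0 h.
  rewrite <- (CSeries_scal _ _ hu), <- (CSeries_scal _ _ hv).
  rewrite (CSeries_ext _ _ h).
  assert (hd : Cseries_is (fun k => c (S k) - c k) l).
  { apply Cseries_is_cvg. apply Ccvg_ext with (fun n => c (S n)); [|now apply Ccvg_incr].
    intro n. induction n as [|n IH].
    - rewrite sum_O c0. ring.
    - rewrite sum_Sn -IH. change plus with Cplus. ring. }
  rewrite CSeries_plus; [| now apply ex_Cseries_scal | eexists; exact hd].
  now rewrite (CSeries_unique _ _ hd).
Qed.

Definition gdecay (w s q : C) : Prop :=
  exists K r, (0 <= r < 1)%R /\ forall k, (Cmod (w ^ k * gprod s q k) <= K * r ^ k)%R.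

(** Each factor satisfies |s - q^i| <= s0 (1 + |q|^i / s0). A positive [s0] in place of |s| keeps
    1/s0 meaningful at s = 0. *)
Lemma gprod_bound {q : C} (hq : qnorm q) (s : C) (s0 : R) (k : nat) :
  (0 < s0)%R -> (Cmod s <= s0)%R -> (Cmod (gprod s q k) <= poch_max q (/ s0) * s0 ^ k)%R.
Proof.
  intros hs0 hs.
  assert (hi : (0 < / s0)%R) by now apply Rinv_0_lt_compat.
  assert (H : (Cmod (gprod s q k) <= exp (/ s0 * geom_sum (Cmod q) k) * s0 ^ k)%R).
  { induction k as [|k IH].
    - unfold gprod. simpl Cprod. rewrite Cmod_1. unfold geom_sum. simpl.
      replace (/ s0 * ((1 - 1) / (1 - Cmod q)))%R with 0%R by (unfold Rdiv; ring).
      rewrite exp_0. lra.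
    - rewrite gprod_Sr. rewrite (geom_sum_S _ _ hq) Rmult_plus_distr_l exp_plus.
      replace (exp (/ s0 * geom_sum (Cmod q) k) * exp (/ s0 * Cmod q ^ k) * s0 ^ S k)%R with
        (exp (/ s0 * geom_sum (Cmod q) k) * s0 ^ k * (s0 * exp (/ s0 * Cmod q ^ k)))%R by (simpl; ring).
      apply Cmod_mul_le; [exact IH|].
      eapply Rle_trans; [apply Cmod_triangle|]. rewrite Cmod_opp Cmod_pow.
      apply Rle_trans with (s0 * (1 + / s0 * Cmod q ^ k))%R.
      + replace (s0 * (1 + / s0 * Cmod q ^ k))%R with (s0 + Cmod q ^ k)%R by (field; lra). lra.
      + apply Rmult_le_compat_l; [lra | apply exp_ineq1_le]. }
  eapply Rle_trans; [exact H|]. apply Rmult_le_compat_r; [apply pow_le; lra|].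
  apply poch_max_aux; [exact hq | lra].
Qed.

Lemma gprod_pow_bound {q : C} (hq : qnorm q) (w s : C) (s0 : R) (k : nat) :
  (0 < s0)%R -> (Cmod s <= s0)%R ->
  (Cmod (w ^ k * gprod s q k) <= poch_max q (/ s0) * (Cmod w * s0) ^ k)%R.
Proof.
  intros hs0 hs. rewrite Cmod_mult Cmod_pow Rpow_mult_distr.
  assert (h := gprod_bound hq s s0 k hs0 hs).
  assert (h0 : (0 <= Cmod w ^ k)%R) by (apply pow_le, Cmod_ge_0).
  assert (h1 := Rmult_le_compat_l _ _ _ h0 h). lra.
Qed.

Lemma gdecay_small {q : C} (hq : qnorm q) (w s : C) : (Cmod (w * s) < 1)%R -> gdecay w s q.
Proof.
  intro h. rewrite Cmod_mult in h.
  assert (hw := Cmod_ge_0 w). assert (hs := Cmod_ge_0 s).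
  (* The margin is small enough for |w| (|s| + d) < 1, while |s| + d stays positive even for s =
     0. *)
  set (d := ((1 - Cmod w * Cmod s) / (2 * (Cmod w + 1)))%R).
  assert (hd : (0 < d)%R) by (apply Rdiv_lt_0_compat; lra).
  assert (hd' : (Cmod w * d < 1 - Cmod w * Cmod s)%R).
  { apply Rlt_le_trans with (2 * (Cmod w + 1) * d)%R; [nra|]. unfold d. right. field. lra. }
  exists (poch_max q (/ (Cmod s + d))), (Cmod w * (Cmod s + d))%R. split.
  - split; [apply Rmult_le_pos; lra | lra].
  - intro k. apply (gprod_pow_bound hq); lra.
Qed.

Lemma gdecay_1 (w q : C) : gdecay w 1 q.
Proof.
  exists 1%R, 0%R. split; [lra|]. intros [|k].
  - unfold gprod. simpl. rewrite Cmult_1_l Cmod_1. lra.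
  - replace (gprod 1 q (S k)) with (RtoC 0).
    + rewrite Cmult_0_r Cmod_0. simpl. lra.
    + induction k as [|k IH]; [unfold gprod; simpl; ring|]. rewrite gprod_Sr -IH. ring.
Qed.

Lemma gdecay_shift {q : C} (hq : qnorm q) (w s : C) : gdecay w s q -> gdecay w (s * q) q.
Proof.
  intros [K [r [hr h]]].
  (* The rate [r] may be 0, as in [gdecay_1], and the index shift below divides by the rate; hence
     the maximum with 1/2. *)
  assert (hr' : (Rmax r (/ 2) < 1)%R) by (apply Rmax_lub_lt; lra).
  assert (h2 : (/ 2 <= Rmax r (/ 2))%R) by apply Rmax_r.
  assert (hrr : (r <= Rmax r (/ 2))%R) by apply Rmax_l.
  set (r' := Rmax r (/ 2)) in *.
  assert (hK : (0 <= K)%R).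
  { specialize (h O). assert (h0 := Cmod_ge_0 (w ^ 0 * gprod s q 0)). simpl in *. lra. }
  exists (1 + Cmod (w * (s * q - 1)) * K / r')%R, r'. split; [lra|].
  assert (hc : (0 <= Cmod (w * (s * q - 1)) * K / r')%R).
  { apply Rmult_le_pos; [apply Rmult_le_pos; [apply Cmod_ge_0 | exact hK]|].
    left. apply Rinv_0_lt_compat. lra. }
  intros [|k].
  - unfold gprod. simpl. rewrite Cmult_1_l Cmod_1. lra.
  - rewrite gprod_shift.
    replace (w ^ S k * ((s * q - 1) * q ^ k * gprod s q k)) with
      ((w * (s * q - 1)) * (w ^ k * gprod s q k * q ^ k)) by (simpl; ring).
    apply Rle_trans with (Cmod (w * (s * q - 1)) * (K * r' ^ k))%R.
    + apply Cmod_mul_le; [apply Rle_refl|].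
      eapply Rle_trans; [apply (Cmod_qpow_le hq)|]. eapply Rle_trans; [apply h|].
      apply Rmult_le_compat_l; [exact hK|]. apply pow_incr. lra.
    + assert (hp : (0 <= r' ^ S k)%R) by (apply pow_le; lra).
      rewrite Rmult_plus_distr_r.
      replace (Cmod (w * (s * q - 1)) * K / r' * r' ^ S k)%R with (Cmod (w * (s * q - 1)) * (K * r' ^ k))%R
        by (simpl; field; lra). lra.
Qed.

Lemma six_term_bound {q : C} (hq : qnorm q) (a x y : C) (ss : nat -> C) (l : C) : Ccvg ss l ->
  exists K, (0 <= K)%R /\ forall j k, (Cmod (six_term a x y q (ss j) k) <=
    K * Cmod ((a * q / (x * y)) ^ k * gprod (ss j) q k))%R.
Proof.
  intro hs.
  destruct (Wterm_bound hq (fun _ => a) (fun _ => 1) a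
    (* Since (0;q)_n = 1, the pair with first entry 0 encodes the lone factor (aqs q^n;q)_oo, and
       the general bound applies. *)
    (fun j => [(x, a * q / x); (y, a * q / y); (RtoC 0, a * q * ss j)])
    [(x, a * q / x); (y, a * q / y); (RtoC 0, a * q * l)] 1) as [K hK].
  - apply Ccvg_const.
  - repeat constructor; try apply Ccvg_const.
    apply Ccvg_mult; [apply Ccvg_const | exact hs].
  - intros _. rewrite Cmod_1. apply Rle_refl.
  - assert (h : forall j k, (Cmod (six_term a x y q (ss j) k) <=
      K * Cmod ((a * q / (x * y)) ^ k * gprod (ss j) q k))%R).
    { intros j k.
      replace (six_term a x y q (ss j) k) with
        (Wterm a [(x, a * q / x); (y, a * q / y); (RtoC 0, a * q * ss j)] q 1 k *
         ((a * q / (x * y)) ^ k * gprod (ss j) q k)).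
      - apply Cmod_mul_le; [|apply Rle_refl]. specialize (hK j k). rewrite pow1 Rmult_1_r in hK. exact hK.
      - unfold six_term, Wterm. simpl pair_prod. rewrite poch_zero Cpow_1_l. ring. }
    exists K. split; [|exact h].
    specialize (hK O O). simpl in hK. rewrite Rmult_1_r in hK. eapply Rle_trans; [apply Cmod_ge_0 | exact hK].
Qed.

Lemma ex_six {q : C} (hq : qnorm q) (a x y s : C) :
  gdecay (a * q / (x * y)) s q -> ex_Cseries (six_term a x y q s).
Proof.
  intros [K [r [hr h]]].
  destruct (six_term_bound hq a x y (fun _ => s) s (Ccvg_const s)) as [K' [h0 h']].
  apply ex_Cseries_le with (fun n => K' * K * r ^ n)%R; [|now apply ex_series_mul_geom].
  intro n. eapply Rle_trans; [apply (h' O)|]. rewrite Rmult_assoc. apply Rmult_le_compat_l; [exact h0 | apply h].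
Qed.

Lemma six_rec {q : C} (hq : qnorm q) (a x y s : C) : x <> 0 -> y <> 0 ->
  gdecay (a * q / (x * y)) s q ->
  (1 - a * q / (x * y) * s) * CSeries (six_term a x y q s) =
  (1 - a * q * s / x) * (1 - a * q * s / y) * CSeries (six_term a x y q (s * q)).
Proof.
  intros hx hy h.
  rewrite -(Cplus_0_r (_ * CSeries (six_term a x y q (s * q)))).
  apply CSeries_telescope with (six_cert a x y q s).
  - now apply (ex_six hq).
  - apply (ex_six hq). now apply (gdecay_shift hq).
  (* The certificate tends to 0: [gdecay] kills its last factor and all others converge. *)
  - assert (H : Ccvg (fun m => six_cert a x y q s (S m)) 0).
    { assert (hg : Ccvg (fun m => (a * q / (x * y)) ^ m * gprod s q m) 0).
      { destruct h as [K [r [hr h]]]. apply Ccvg_squeeze with (fun m => K * r ^ m)%R.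
        - intro m. match goal with |- (Cmod ?u <= _)%R => replace u with ((a * q / (x * y)) ^ m * gprod s q m) by ring end. apply h.
        - replace (Finite 0) with (Finite (K * 0)) by (f_equal; ring).
          apply is_lim_seq_mult'; [apply is_lim_seq_const|]. apply is_lim_seq_geom. rewrite Rabs_pos_eq; lra. }
      unfold six_cert.
      replace (RtoC 0) with (0 - (s * (qpoch_inf (a * q) q / qpoch_inf q q) * (qpoch_inf x q * qpoch_inf y q) *
        (1 * 1 * 1) * (a * q / (x * y) * 0))) by ring.
      eapply Ccvg_ext; [intro m; symmetry; rewrite <- Cplus_0_l at 1; reflexivity|].
      apply (Ccvg_minus (fun _ => 0)); [apply Ccvg_const|].
      assert (hS : forall u, Ccvg (fun m => poch u q (S m)) (qpoch_inf u q)).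
      { intro u. apply (Ccvg_incr (poch u q)), (poch_Ccvg hq). }
      apply Ccvg_mult; [apply Ccvg_mult; [apply Ccvg_mult; [apply Ccvg_mult|apply Ccvg_mult] |
        apply Ccvg_mult; [apply Ccvg_mult|]]|apply Ccvg_mult].
      - apply Ccvg_const.
      - apply Ccvg_mult; [apply (poch_Ccvg hq)|].
        apply Ccvg_inv; [apply (pinf_q_neq0 hq) | apply (poch_Ccvg hq)].
      - apply hS.
      - apply hS.
      - apply (pinf_tail hq).
      - apply (pinf_tail hq).
      - apply (Ccvg_incr (fun m => qpoch_inf (a * q * s * q ^ m) q)), (pinf_tail hq).
      - apply Ccvg_const.
      - exact hg. }
    apply (is_lim_seq_incr_1 (fun m => Cmod (six_cert a x y q s m - 0))). exact H.
  - reflexivity.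
  - intro k. now apply (six_telescope hq).
Qed.

Lemma gdecay_qpow {q : C} (hq : qnorm q) (w s : C) (n : nat) : gdecay w s q -> gdecay w (s * q ^ n) q.
Proof.
  intro h. induction n as [|n IH]; [simpl; now rewrite Cmult_1_r|].
  replace (s * q ^ S n) with (s * q ^ n * q) by (simpl; ring). now apply (gdecay_shift hq).
Qed.

Lemma six_iter {q : C} (hq : qnorm q) (a x y s : C) (n : nat) : x <> 0 -> y <> 0 ->
  gdecay (a * q / (x * y)) s q ->
  poch (a * q / (x * y) * s) q n * CSeries (six_term a x y q s) =
  poch (a * q * s / x) q n * poch (a * q * s / y) q n * CSeries (six_term a x y q (s * q ^ n)).
Proof.
  intros hx hy h. induction n as [|n IH].
  - rewrite !poch_0. replace (s * q ^ 0) with s by (simpl; ring). ring.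
  - rewrite !poch_Sr.
    replace (a * q / (x * y) * s * q ^ n) with (a * q / (x * y) * (s * q ^ n)) by ring.
    assert (hr := six_rec hq a x y (s * q ^ n) hx hy (gdecay_qpow hq _ _ n h)).
    replace (s * q ^ S n) with (s * q ^ n * q) by (simpl; ring).
    match goal with |- ?A * ?B * ?D = _ => replace (A * B * D) with (B * (A * D)) by ring end.
    rewrite IH.
    match goal with |- ?A * (?B * ?D) = _ => replace (A * (B * D)) with (B * (A * D)) by ring end.
    rewrite hr. field. split; assumption.
Qed.

Lemma Ccvg_six {q : C} (hq : qnorm q) (a x y s : C) :
  Ccvg (fun n => CSeries (six_term a x y q (s * q ^ n))) (CSeries (six_term a x y q 0)).
Proof.
  set (w := a * q / (x * y)).
  assert (hw := Cmod_ge_0 w).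
  (* This radius gives |w| s0 < 1. Once |s q^n| is below it, all later series share one geometric
     majorant, so finitely many initial indices are dropped. *)
  set (s0 := (/ (2 * (Cmod w + 1)))%R).
  assert (hs0 : (0 < s0)%R) by (apply Rinv_0_lt_compat; lra).
  assert (hws : (0 <= Cmod w * s0 < 1)%R).
  { split; [apply Rmult_le_pos; lra|].
    apply Rlt_le_trans with (2 * (Cmod w + 1) * s0)%R; [nra|]. unfold s0. right. field. lra. }
  assert (hl := Ccvg_qpow hq s).
  assert (hl' := hl). apply is_lim_seq_spec in hl'. destruct (hl' (mkposreal _ hs0)) as [N hN]. simpl in hN.
  apply (is_lim_seq_incr_n (fun n => Cmod (CSeries (six_term a x y q (s * q ^ n)) - CSeries (six_term a x y q 0))) N).
  assert (hlN : Ccvg (fun j => s * q ^ (j + N)) 0).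
  { exact (proj1 (is_lim_seq_incr_n (fun n => Cmod (s * q ^ n - 0)) N 0%R) hl). }
  destruct (six_term_bound hq a x y _ _ hlN) as [K [hK h]].
  apply (Tannery (fun j => six_term a x y q (s * q ^ (j + N))) (six_term a x y q 0)
    (fun k => K * poch_max q (/ s0) * (Cmod w * s0) ^ k)%R).
  - intros j k. eapply Rle_trans; [apply h|]. rewrite Rmult_assoc. apply Rmult_le_compat_l; [exact hK|].
    apply (gprod_pow_bound hq); [exact hs0|].
    specialize (hN (j + N)%nat ltac:(lia)). rewrite Rminus_0_r Rabs_pos_eq in hN; [|apply Cmod_ge_0].
    replace (s * q ^ (j + N) - 0) with (s * q ^ (j + N)) in hN by ring. lra.
  - now apply ex_series_mul_geom.
  - intro k. unfold six_term.
    assert (hg : Ccvg (fun j => gprod (s * q ^ (j + N)) q k) (gprod 0 q k)).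
    { induction k as [|k IH]; [exact (Ccvg_const 1)|]. apply Ccvg_mult; [exact IH|].
      apply Ccvg_minus; [exact hlN | apply (Ccvg_const (q ^ k))]. }
    repeat apply Ccvg_mult; try apply Ccvg_const; try exact hg.
    apply (Ccvg_pinf hq). repeat apply Ccvg_mult; try apply Ccvg_const. exact hlN.
Qed.

Lemma six_limit {q : C} (hq : qnorm q) (a x y s : C) : x <> 0 -> y <> 0 ->
  gdecay (a * q / (x * y)) s q ->
  qpoch_inf (a * q / (x * y) * s) q * CSeries (six_term a x y q s) =
  qpoch_inf (a * q * s / x) q * qpoch_inf (a * q * s / y) q * CSeries (six_term a x y q 0).
Proof.
  intros hx hy h.
  apply (Ccvg_unique (fun n => poch (a * q / (x * y) * s) q n * CSeries (six_term a x y q s))).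
  - apply Ccvg_mult; [apply (poch_Ccvg hq) | apply Ccvg_const].
  - eapply Ccvg_ext; [intro n; symmetry; now apply (six_iter hq)|].
    apply Ccvg_mult; [apply Ccvg_mult; apply (poch_Ccvg hq) | apply (Ccvg_six hq)].
Qed.

Lemma Cmult_cancel_l (u v w : C) : u <> 0 -> u * v = u * w -> v = w.
Proof.
  intros hu h. replace v with (/ u * (u * v)) by (field; exact hu).
  rewrite h. field. exact hu.
Qed.

Lemma six_phi_five {q : C} (hq : qnorm q) (a x y s : C) : x <> 0 -> y <> 0 ->
  qpoch_inf (a * q / x) q <> 0 -> qpoch_inf (a * q / y) q <> 0 ->
  (Cmod (a * q / (x * y) * s) < 1)%R ->
  qpoch_inf (a * q / (x * y) * s) q * CSeries (six_term a x y q s) =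
  qpoch_inf (a * q * s / x) q * qpoch_inf (a * q * s / y) q *
  (qpoch_inf (a * q) q * qpoch_inf (a * q / (x * y)) q).
Proof.
  intros hx hy h1 h2 hs.
  rewrite (six_limit hq a x y s hx hy (gdecay_small hq _ _ hs)). f_equal.
  (* At s = 1 the series consists of its term k = 0. *)
  assert (h := six_limit hq a x y 1 hx hy (gdecay_1 _ q)).
  assert (hb : CSeries (six_term a x y q 1) =
    qpoch_inf (a * q / x) q * qpoch_inf (a * q / y) q * qpoch_inf (a * q) q).
  { assert (h0 : forall k, six_term a x y q 1 (S k) = 0).
    { intro k. unfold six_term. replace (gprod 1 q (S k)) with (RtoC 0); [ring|].
      induction k as [|k IH]; [unfold gprod; simpl; ring|]. rewrite gprod_Sr -IH. ring. }
    rewrite (CSeries_unique _ _ (CSeries_first _ h0)).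
    unfold six_term, gprod. rewrite !poch_0. simpl. rewrite !Cmult_1_r. ring. }
  rewrite hb !Cmult_1_r in h.
  (* These products occur on both sides of the identity at s = 1; cancelling them gives the value
     (aq, aq/(xy);q)_oo at s = 0. *)
  assert (h3 : qpoch_inf (a * q / x) q * qpoch_inf (a * q / y) q <> 0) by now apply Cmult_neq_0.
  apply (Cmult_cancel_l _ _ _ h3). rewrite <- h. ring.
Qed.

(** * Bailey's nonterminating 8phi7 sum *)

(* Here g = 1/c and A = aq/(cdef); the n-th term belongs to the node x = e q^n. *)
Definition bailey_term (a d e f q g : C) (n : nat) : C :=
  let A := a * q / (d * e * f) * g in
  qpoch_inf (a * q * g / e) q *
  (poch e q n * poch (e / a) q n * poch (a * q / (d * f)) q n *
   poch (a * q * g / f) q n * poch (a * q * g / d) q n) *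
  (qpoch_inf (q * q ^ n) q * qpoch_inf (q * e / f * q ^ n) q * qpoch_inf (q * e / d * q ^ n) q *
   qpoch_inf (q * e * g * q ^ n) q * qpoch_inf (A * e * q * q ^ n) q *
   qpoch_inf (A * a * e * q * q ^ n) q) *
  ((1 - A * e * e * q ^ (2 * n)) / qpoch_inf (A * e * e * q ^ n) q * q ^ n).

(** The antidifference in n for g -> gq. Unlike [six_cert] it has in general a nonzero limit,
    computed in [Ccvg_bailey_cert]. *)
Definition bailey_cert (a d e f q g : C) (n : nat) : C :=
  let A := a * q / (d * e * f) * g in
  match n with
  | O => 0
  | S m =>
    - (a * q * g / e *
    (qpoch_inf (a * q * g * q / e) q *
    (poch e q n * poch (e / a) q n * poch (a * q / (d * f)) q n *
     poch (a * q * g * q / f) q m * poch (a * q * g * q / d) q m) *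
    (qpoch_inf (q * q ^ m) q * qpoch_inf (q * e / f * q ^ m) q * qpoch_inf (q * e / d * q ^ m) q *
     qpoch_inf (q * e * g * q ^ n) q * qpoch_inf (A * e * q * q ^ n) q *
     qpoch_inf (A * a * e * q * q ^ n) q) *
    ((1 - A * a * g * e * q * q ^ n) / qpoch_inf (A * e * e * q ^ n) q)))
  end.

Lemma bailey_telescope {q : C} (hq : qnorm q) (a d e f g : C) (n : nat) :
  a <> 0 -> d <> 0 -> e <> 0 -> f <> 0 ->
  qpoch_inf (a * q / (d * e * f) * g * e * e) q <> 0 ->
  bailey_term a d e f q g n =
  (1 - q * g) * (1 - a * q * g) * (1 - a * q / (d * e * f) * g * a * q) *
    bailey_term a d e f q (g * q) n +
  (bailey_cert a d e f q g (S n) - bailey_cert a d e f q g n).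
Proof.
  intros ha hd he hf. unfold bailey_term, bailey_cert. cbv zeta.
  set (al := a * q / (d * e * f) * g * e * e). intro h0.
  assert (h1 := pinf_neq0_shift hq al n h0).
  rewrite (pinf_qpow_S hq al n) in h1.
  assert (h2 : 1 - al * q ^ n <> 0) by (intro h; apply h1; rewrite h; ring).
  assert (h3 : qpoch_inf (al * q ^ S n) q <> 0) by (intro h; apply h1; rewrite h; ring).
  rewrite (pinf_S hq (a * q * g / e)).
  rewrite (pinf_qpow_S hq (q * e * g) n)
    (pinf_qpow_S hq (a * q / (d * e * f) * g * e * q) n)
    (pinf_qpow_S hq (a * q / (d * e * f) * g * a * e * q) n)
    (pinf_qpow_S hq al n).
  replace (q * e * (g * q) * q ^ n) with (q * e * g * q ^ S n) by (simpl; ring).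
  replace (a * q / (d * e * f) * (g * q) * e * q * q ^ n) with
    (a * q / (d * e * f) * g * e * q * q ^ S n) by (simpl; ring).
  replace (a * q / (d * e * f) * (g * q) * a * e * q * q ^ n) with
    (a * q / (d * e * f) * g * a * e * q * q ^ S n) by (simpl; ring).
  replace (a * q / (d * e * f) * (g * q) * e * e * q ^ n) with (al * q ^ S n) by (unfold al; simpl; ring).
  replace (a * q * (g * q)) with (a * q * g * q) by ring.
  replace (a * q * g / e * q) with (a * q * g * q / e) by (field; exact he).
  rewrite (poch_Sr e q n) (poch_Sr (e / a) q n) (poch_Sr (a * q / (d * f)) q n).
  generalize dependent (qpoch_inf (al * q ^ S n) q). intros w h1 h3.
  generalize (qpoch_inf (q * e * g * q ^ S n) q)
    (qpoch_inf (a * q / (d * e * f) * g * e * q * q ^ S n) q)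
    (qpoch_inf (a * q / (d * e * f) * g * a * e * q * q ^ S n) q)
    (qpoch_inf (a * q * g * q / e) q). intros V1 V2 V3 V4.
  destruct n as [|m].
  - rewrite !poch_0.
    generalize (qpoch_inf (q * q ^ 0) q) (qpoch_inf (q * e / f * q ^ 0) q) (qpoch_inf (q * e / d * q ^ 0) q).
    intros. revert h2. unfold al. simpl.  rewrite !Cmult_1_r. intro h2.
    (* With e cancelled, the nonvanishing of 1 - al q^n takes the polynomial form that [field] will
       ask for. *)
    replace (a * q / (d * e * f) * g * e * e) with (a * q * g * e / (d * f)) in * by (field; auto).
    assert (d * f - a * q * g * e <> 0).
    { intro h. apply h2. replace (1 - a * q * g * e / (d * f)) with ((d * f - a * q * g * e) / (d * f)) by (field; auto).
      rewrite h. field. auto. }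
    field. repeat split; try assumption.
  - rewrite (poch_Sl (a * q * g / f)) (poch_Sl (a * q * g / d)).
    replace (a * q * g / f * q) with (a * q * g * q / f) by (field; exact hf).
    replace (a * q * g / d * q) with (a * q * g * q / d) by (field; exact hd).
    rewrite (poch_Sr (a * q * g * q / f)) (poch_Sr (a * q * g * q / d)).
    rewrite (pinf_qpow_S hq q m) (pinf_qpow_S hq (q * e / f) m) (pinf_qpow_S hq (q * e / d) m).
    generalize (qpoch_inf (q * q ^ S m) q) (qpoch_inf (q * e / f * q ^ S m) q)
      (qpoch_inf (q * e / d * q ^ S m) q) (poch (a * q * g * q / f) q m) (poch (a * q * g * q / d) q m)
      (poch e q (S m)) (poch (e / a) q (S m)) (poch (a * q / (d * f)) q (S m)).
    intros. revert h2. unfold al.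
    replace (q ^ (2 * S m)) with (q * q * (q ^ m * q ^ m))
      by (replace (2 * S m)%nat with (2 + (m + m))%nat by lia; rewrite !Cpow_add_r; simpl; ring).
    rewrite !Cpow_S. generalize (q ^ m). intros Q h2.
    replace (a * q / (d * e * f) * g * e * e) with (a * q * g * e / (d * f)) in * by (field; auto).
    assert (d * f - a * q * g * e * (q * Q) <> 0).
    { intro h. apply h2. replace (1 - a * q * g * e / (d * f) * (q * Q)) with ((d * f - a * q * g * e * (q * Q)) / (d * f)) by (field; auto).
      rewrite h. field. auto. }
    field. repeat split; try assumption.
Qed.

(** With base al = A e^2, the five first entries multiply to al^2 q, the balancing condition of
    Bailey's sum; each second entry is al q divided by the first. *)
Definition bailey_pairs (a d e f q g : C) : list (C * C) :=
  let A := a * q / (d * e * f) * g in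
  [(e, A * e * q); (e / a, A * a * e * q); (a * q / (d * f), q * e * g);
   (a * q * g / f, q * e / d); (a * q * g / d, q * e / f)].

(** The recurrence is proved on [bailey_term], while convergence and limits are known for [Wterm];
    this identity transfers them. *)
Lemma bailey_term_W {q : C} (hq : qnorm q) (a d e f g : C) (n : nat) :
  qpoch_inf (a * q / (d * e * f) * g * e * e) q <> 0 ->
  bailey_term a d e f q g n =
  qpoch_inf (a * q * g / e) q *
  (qpoch_inf q q / qpoch_inf (a * q / (d * e * f) * g * e * e * q) q) *
  Wterm (a * q / (d * e * f) * g * e * e) (bailey_pairs a d e f q g) q q n.
Proof.
  intro h. unfold bailey_term, Wterm, bailey_pairs. cbv zeta. simpl pair_prod.
  assert (hv := vwp_pinf hq _ n h).
  set (A := a * q / (d * e * f) * g) in *.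
  assert (h1 := pinf_neq0_shift hq (A * e * e) n h).
  assert (h2 := pinf_neq0_shift hq (A * e * e) 1 h). rewrite Cpow_1_r in h2.
  assert (hv' : vwp (A * e * e) q n = (1 - A * e * e * q ^ (2 * n)) * qpoch_inf (q * q ^ n) q *
    qpoch_inf (A * e * e * q) q * / qpoch_inf (A * e * e * q ^ n) q * / qpoch_inf q q).
  { apply (Cmult_cancel_l _ _ _ (pinf_q_neq0 hq)). rewrite hv. field. split; [apply (pinf_q_neq0 hq) | exact h1]. }
  rewrite hv'. assert (h3 := pinf_q_neq0 hq).
  transitivity (qpoch_inf q q * / qpoch_inf q q * (qpoch_inf (A * e * e * q) q * / qpoch_inf (A * e * e * q) q) *
    bailey_term a d e f q g n).
  - rewrite !Cinv_r; try assumption. unfold bailey_term. cbv zeta. fold A. unfold Cdiv. ring.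
  - unfold bailey_term. cbv zeta. fold A. unfold Cdiv. ring.
Qed.

Lemma ex_bailey {q : C} (hq : qnorm q) (a d e f g : C) :
  qpoch_inf (a * q / (d * e * f) * g * e * e) q <> 0 -> ex_Cseries (bailey_term a d e f q g).
Proof.
  intro h.
  eapply (ex_series_ext (V := C_NormedModule)); [intro n; symmetry; now apply (bailey_term_W hq)|].
  apply ex_Cseries_scal, (ex_Wsum hq), hq.
Qed.

Lemma bailey_W {q : C} (hq : qnorm q) (a d e f g : C) :
  qpoch_inf (a * q / (d * e * f) * g * e * e) q <> 0 ->
  CSeries (bailey_term a d e f q g) =
  qpoch_inf (a * q * g / e) q *
  (qpoch_inf q q / qpoch_inf (a * q / (d * e * f) * g * e * e * q) q) *
  Wsum (a * q / (d * e * f) * g * e * e) (bailey_pairs a d e f q g) q q.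
Proof.
  intro h. unfold Wsum. rewrite <- CSeries_scal; [|apply (ex_Wsum hq), hq].
  apply CSeries_ext. intro n. now apply (bailey_term_W hq).
Qed.

Lemma Ccvg_bailey {q : C} (hq : qnorm q) (a d e f g : C) :
  qpoch_inf (a * q / (d * e * f) * g * e * e) q <> 0 ->
  Ccvg (fun n => CSeries (bailey_term a d e f q (g * q ^ n))) (CSeries (bailey_term a d e f q 0)).
Proof.
  intro h.
  assert (h0 : qpoch_inf (a * q / (d * e * f) * 0 * e * e) q <> 0).
  { replace (a * q / (d * e * f) * 0 * e * e) with (RtoC 0) by ring. rewrite (pinf_0 hq). exact C1_nz. }
  assert (hn : forall n, qpoch_inf (a * q / (d * e * f) * (g * q ^ n) * e * e) q <> 0).
  { intro n. replace (a * q / (d * e * f) * (g * q ^ n) * e * e) with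
      (a * q / (d * e * f) * g * e * e * q ^ n) by ring. now apply (pinf_neq0_shift hq). }
  eapply Ccvg_ext; [intro n; symmetry; apply (bailey_W hq), hn|].
  rewrite (bailey_W hq _ _ _ _ _ h0).
  assert (hg := Ccvg_qpow hq g).
  assert (hl : forall u, Ccvg (fun n => u * (g * q ^ n)) (u * 0)).
  { intro u. apply Ccvg_mult; [apply Ccvg_const | exact hg]. }
  assert (hr : forall u v w, Ccvg u w -> Ccvg (fun n => u n * v) (w * v)).
  { intros u v w hu. apply Ccvg_mult; [exact hu | apply Ccvg_const]. }
  assert (hal : Ccvg (fun n => a * q / (d * e * f) * (g * q ^ n) * e * e) (a * q / (d * e * f) * 0 * e * e)).
  { apply hr, hr, hl. }
  apply Ccvg_mult; [apply Ccvg_mult|].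
  - apply (Ccvg_pinf hq), hr, hl.
  - apply Ccvg_mult; [apply Ccvg_const|]. apply Ccvg_inv.
    + replace (a * q / (d * e * f) * 0 * e * e * q) with (RtoC 0) by ring. rewrite (pinf_0 hq). exact C1_nz.
    + apply (Ccvg_pinf hq), hr, hal.
  - apply (Ccvg_Wsum hq) with (Cmod q).
    + exact hal.
    + unfold bailey_pairs. cbv zeta. repeat constructor; try apply Ccvg_const.
      * apply hr, hr, hl.
      * apply hr, hr, hr, hl.
      * apply hl.
      * apply hr, hl.
      * apply hr, hl.
    + apply Ccvg_const.
    + intros _. apply Rle_refl.
    + apply hq.
Qed.

Lemma Ccvg_bailey_cert {q : C} (hq : qnorm q) (a d e f g : C) :
  Ccvg (bailey_cert a d e f q g)
    (- (a * q * g / e * (qpoch_inf (a * q * g * q / e) q *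
      (qpoch_inf e q * qpoch_inf (e / a) q * qpoch_inf (a * q / (d * f)) q *
       qpoch_inf (a * q * g * q / f) q * qpoch_inf (a * q * g * q / d) q)))).
Proof.
  apply (is_lim_seq_incr_1 (fun m => Cmod (bailey_cert a d e f q g m - _))).
  change (Ccvg (fun m => bailey_cert a d e f q g (S m)) (- (a * q * g / e * (qpoch_inf (a * q * g * q / e) q *
      (qpoch_inf e q * qpoch_inf (e / a) q * qpoch_inf (a * q / (d * f)) q *
       qpoch_inf (a * q * g * q / f) q * qpoch_inf (a * q * g * q / d) q))))).
  unfold bailey_cert. cbv zeta. set (A := a * q / (d * e * f) * g).
  match goal with |- Ccvg _ (- (?x * (?y * ?z))) =>
    replace (- (x * (y * z))) with (0 - x * (y * z * (1 * 1 * 1 * 1 * 1 * 1) * ((1 - 0) / 1))) by (generalize x y z; intros; field; exact C1_nz) end.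
  eapply Ccvg_ext; [intro m; symmetry; rewrite <- Cplus_0_l at 1; reflexivity|].
  apply (Ccvg_minus (fun _ => 0)); [apply Ccvg_const|].
  assert (hS : forall u, Ccvg (fun m => poch u q (S m)) (qpoch_inf u q)).
  { intro u. apply (Ccvg_incr (poch u q)), (poch_Ccvg hq). }
  assert (hT : forall u, Ccvg (fun m => qpoch_inf (u * q ^ S m) q) 1).
  { intro u. apply (Ccvg_incr (fun m => qpoch_inf (u * q ^ m) q)), (pinf_tail hq). }
  apply Ccvg_mult; [apply Ccvg_const|].
  apply Ccvg_mult; [apply Ccvg_mult; [apply Ccvg_mult; [apply Ccvg_const|]|]|].
  - apply Ccvg_mult; [apply Ccvg_mult; [apply Ccvg_mult; [apply Ccvg_mult|]|]|].
    + apply hS.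
    + apply hS.
    + apply hS.
    + apply (poch_Ccvg hq).
    + apply (poch_Ccvg hq).
  - apply Ccvg_mult; [apply Ccvg_mult; [apply Ccvg_mult; [apply Ccvg_mult; [apply Ccvg_mult|]|]|]|].
    + apply (pinf_tail hq q).
    + apply (pinf_tail hq (q * e / f)).
    + apply (pinf_tail hq (q * e / d)).
    + apply (hT (q * e * g)).
    + apply (hT (A * e * q)).
    + apply (hT (A * a * e * q)).
  - apply Ccvg_mult.
    + apply Ccvg_minus; [apply Ccvg_const|].
      apply (Ccvg_incr (fun m => A * a * g * e * q * q ^ m)), (Ccvg_qpow hq).
    + apply Ccvg_inv; [exact C1_nz | apply (hT (A * e * e))].
Qed.

(** The weight is chosen so that the certificate limit multiplied by it is symmetric in e and f: the
    prefactor e absorbs the 1/e in aqg/e, and the products supply the partners of (e, e/a,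
    aq/(df);q)_oo. *)
Definition bailey_line (a d e f q g : C) : C :=
  e * (qpoch_inf f q * qpoch_inf (f / a) q * qpoch_inf (a * q / (d * e)) q) *
  CSeries (bailey_term a d e f q g).

Lemma bailey_rec {q : C} (hq : qnorm q) (a d e f g : C) :
  a <> 0 -> d <> 0 -> e <> 0 -> f <> 0 ->
  qpoch_inf (a * q / (d * e * f) * g * e * e) q <> 0 ->
  qpoch_inf (a * q / (d * f * e) * g * f * f) q <> 0 ->
  bailey_line a d e f q g - bailey_line a d f e q g =
  (1 - q * g) * (1 - a * q * g) * (1 - a * q / (d * e * f) * a * q * g) *
  (bailey_line a d e f q (g * q) - bailey_line a d f e q (g * q)).
Proof.
  intros ha hd he hf h1 h2.
  assert (hs : forall u, qpoch_inf (u * g * e * e) q <> 0 -> qpoch_inf (u * (g * q) * e * e) q <> 0).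
  { intros u h. replace (u * (g * q) * e * e) with (u * g * e * e * q ^ 1) by (simpl; ring).
    now apply (pinf_neq0_shift hq). }
  assert (hs' : forall u, qpoch_inf (u * g * f * f) q <> 0 -> qpoch_inf (u * (g * q) * f * f) q <> 0).
  { intros u h. replace (u * (g * q) * f * f) with (u * g * f * f * q ^ 1) by (simpl; ring).
    now apply (pinf_neq0_shift hq). }
  assert (r1 := CSeries_telescope _ _ _ 1 _ _ (ex_bailey hq _ _ _ _ _ h1) (ex_bailey hq _ _ _ _ _ (hs _ h1))
    (Ccvg_bailey_cert hq a d e f g) eq_refl
    (fun n => eq_trans (Cmult_1_l _) (bailey_telescope hq a d e f g n ha hd he hf h1))).
  assert (r2 := CSeries_telescope _ _ _ 1 _ _ (ex_bailey hq _ _ _ _ _ h2) (ex_bailey hq _ _ _ _ _ (hs' _ h2))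
    (Ccvg_bailey_cert hq a d f e g) eq_refl
    (fun n => eq_trans (Cmult_1_l _) (bailey_telescope hq a d f e g n ha hd hf he h2))).
  rewrite Cmult_1_l in r1. rewrite Cmult_1_l in r2.
  unfold bailey_line. rewrite r1 r2.
  replace (a * q / (d * f * e)) with (a * q / (d * e * f)) by (field; auto).
  (* The two boundary terms now agree and cancel in the difference, which leaves a homogeneous
     recurrence. *)
  generalize (CSeries (bailey_term a d e f q (g * q))) (CSeries (bailey_term a d f e q (g * q))).
  intros. field. auto.
Qed.

Lemma bailey_limit {q : C} (hq : qnorm q) (a d e f g : C) :
  a <> 0 -> d <> 0 -> e <> 0 -> f <> 0 ->
  qpoch_inf (a * q / (d * e * f) * g * e * e) q <> 0 ->
  qpoch_inf (a * q / (d * f * e) * g * f * f) q <> 0 ->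
  bailey_line a d e f q g - bailey_line a d f e q g =
  qpoch_inf (q * g) q * qpoch_inf (a * q * g) q * qpoch_inf (a * q / (d * e * f) * a * q * g) q *
  (bailey_line a d e f q 0 - bailey_line a d f e q 0).
Proof.
  intros ha hd he hf h1 h2.
  assert (H : forall n, bailey_line a d e f q g - bailey_line a d f e q g =
    poch (q * g) q n * poch (a * q * g) q n * poch (a * q / (d * e * f) * a * q * g) q n *
    (bailey_line a d e f q (g * q ^ n) - bailey_line a d f e q (g * q ^ n))).
  { induction n as [|n IH].
    - rewrite !poch_0. replace (g * q ^ 0) with g by (simpl; ring). ring.
    - rewrite IH. rewrite (bailey_rec hq a d e f (g * q ^ n)); try assumption.
      + rewrite !poch_Sr. replace (g * q ^ S n) with (g * q ^ n * q) by (simpl; ring). ring.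
      + replace (a * q / (d * e * f) * (g * q ^ n) * e * e) with (a * q / (d * e * f) * g * e * e * q ^ n) by ring.
        now apply (pinf_neq0_shift hq).
      + replace (a * q / (d * f * e) * (g * q ^ n) * f * f) with (a * q / (d * f * e) * g * f * f * q ^ n) by ring.
        now apply (pinf_neq0_shift hq). }
  apply (Ccvg_unique (fun _ => bailey_line a d e f q g - bailey_line a d f e q g)); [apply Ccvg_const|].
  eapply Ccvg_ext; [intro n; symmetry; apply H|].
  apply Ccvg_mult; [apply Ccvg_mult; [apply Ccvg_mult|]; apply (poch_Ccvg hq)|].
  apply Ccvg_minus; (apply Ccvg_mult; [apply Ccvg_const | now apply (Ccvg_bailey hq)]).
Qed.

(** The last five nonvanishing conditions belong to the evaluation at g0 = f/(aq): two keep the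
    bases e/d and f^2/(de) admissible there, three allow division by the products that the iteration
    yields. *)
Lemma bailey_sum {q : C} (hq : qnorm q) (a d e f g : C) :
  a <> 0 -> d <> 0 -> e <> 0 -> f <> 0 ->
  qpoch_inf (a * q / (d * e * f) * g * e * e) q <> 0 ->
  qpoch_inf (a * q / (d * f * e) * g * f * f) q <> 0 ->
  qpoch_inf f q <> 0 -> qpoch_inf (f / a) q <> 0 -> qpoch_inf (a * q / (d * e)) q <> 0 ->
  qpoch_inf (e / d) q <> 0 -> qpoch_inf (f * f / (d * e)) q <> 0 ->
  bailey_line a d e f q g - bailey_line a d f e q g =
  e * (qpoch_inf q q * qpoch_inf (f / e) q * qpoch_inf (q * e / f) q) *
  (qpoch_inf (q / d) q * qpoch_inf (a * q / d) q * qpoch_inf (e * f / a) q) *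
  (qpoch_inf (q * g) q * qpoch_inf (a * q * g) q * qpoch_inf (a * q / (d * e * f) * a * q * g) q).
Proof.
  intros ha hd he hf h1 h2 n1 n2 n3 n4 n5.
  assert (hq0 := qnorm_neq0 hq).
  rewrite (bailey_limit hq a d e f g ha hd he hf h1 h2).
  (* At g0 the line of f vanishes and that of e consists of its term n = 0. *)
  set (g0 := f / (a * q)).
  assert (a1 : a * q / (d * e * f) * g0 * e * e = e / d) by (unfold g0; field; auto).
  assert (a2 : a * q / (d * f * e) * g0 * f * f = f * f / (d * e)) by (unfold g0; field; auto).
  assert (B0 := bailey_limit hq a d e f g0 ha hd he hf). rewrite a1 a2 in B0. specialize (B0 n4 n5).
  replace (q * g0) with (f / a) in B0 by (unfold g0; field; auto).
  replace (a * q * g0) with f in B0 by (unfold g0; field; auto).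
  replace (a * q / (d * e * f) * a * q * g0) with (a * q / (d * e)) in B0 by (unfold g0; field; auto).
  assert (L2 : bailey_line a d f e q g0 = 0).
  { unfold bailey_line.
    assert (hz : forall n, bailey_term a d f e q g0 n = 0).
    { intro n. unfold bailey_term. cbv zeta. replace (a * q * g0 / f) with (RtoC 1) by (unfold g0; field; auto).
      rewrite (pinf_1 hq). ring. }
    rewrite (CSeries_unique _ _ (CSeries_first _ (fun k => hz (S k)))) hz. ring. }
  assert (L1 : bailey_line a d e f q g0 = e * (qpoch_inf f q * qpoch_inf (f / a) q * qpoch_inf (a * q / (d * e)) q) *
    (qpoch_inf (f / e) q * (qpoch_inf q q * qpoch_inf (q * e / f) q * qpoch_inf (e * f / a) q *
      qpoch_inf (q / d) q * qpoch_inf (a * q / d) q))).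
  { unfold bailey_line. f_equal.
    assert (hz : forall k, bailey_term a d e f q g0 (S k) = 0).
    { intro k. unfold bailey_term. cbv zeta. rewrite (poch_Sl (a * q * g0 / f)).
      replace (a * q * g0 / f) with (RtoC 1) by (unfold g0; field; auto). ring. }
    rewrite (CSeries_unique _ _ (CSeries_first _ hz)).
    unfold bailey_term. cbv zeta. rewrite !poch_0.
    replace (q ^ 0) with (RtoC 1) by reflexivity. replace (q ^ (2 * 0)) with (RtoC 1) by reflexivity.
    rewrite !Cmult_1_r a1.
    replace (a * q * g0 / e) with (f / e) by (unfold g0; field; auto).
    replace (q * e * g0) with (e * f / a) by (unfold g0; field; auto).
    replace (a * q / (d * e * f) * g0 * e * q) with (q / d) by (unfold g0; field; auto).
    replace (a * q / (d * e * f) * g0 * a * e * q) with (a * q / d) by (unfold g0; field; auto).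
    replace (q * e / d) with (e / d * q) by (field; auto).
    rewrite (pinf_S hq (e / d)). rewrite (pinf_S hq (e / d)) in n4.
    assert (m1 : 1 - e / d <> 0) by (intro h; apply n4; rewrite h; ring).
    assert (m2 : qpoch_inf (e / d * q) q <> 0) by (intro h; apply n4; rewrite h; ring).
    generalize dependent (e / d). intros t _ _ m1 m2. field. split; assumption. }
  rewrite L1 L2 in B0.
  assert (hp : qpoch_inf (f / a) q * qpoch_inf f q * qpoch_inf (a * q / (d * e)) q <> 0).
  { repeat apply Cmult_neq_0; assumption. }
  assert (E : bailey_line a d e f q 0 - bailey_line a d f e q 0 =
    e * (qpoch_inf q q * qpoch_inf (f / e) q * qpoch_inf (q * e / f) q) *
    (qpoch_inf (q / d) q * qpoch_inf (a * q / d) q * qpoch_inf (e * f / a) q)).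
  { apply (Cmult_cancel_l _ _ _ hp). rewrite <- B0. ring. }
  rewrite E. ring.
Qed.

(** * The three-term transformation *)

(** This is u^n q^(n(n-1)/2), the monomial produced by reversing a shifted factorial, written
    without a binomial exponent. *)
Definition mono (u q : C) (n : nat) : C := Cprod (fun i => u * q ^ i) n.

Lemma mono_Sr (u q : C) (n : nat) : mono u q (S n) = mono u q n * (u * q ^ n).
Proof. reflexivity. Qed.

Lemma mono_scale (u v q : C) (n : nat) : mono (u * v) q n = mono u q n * v ^ n.
Proof. induction n as [|n IH]; [unfold mono; simpl; ring|]. rewrite !mono_Sr IH Cpow_S. ring. Qed.

Lemma qpow_neq0 {q : C} (hq : qnorm q) (n : nat) : q ^ n <> 0.
Proof. apply Cpow_nz, (qnorm_neq0 hq). Qed.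

Lemma Cinv_neq0 (x : C) : x <> 0 -> / x <> 0.
Proof. intros h h0. apply C1_nz. rewrite -(Cinv_r x h) h0. ring. Qed.

Lemma Cdiv_neq0 (x y : C) : x <> 0 -> y <> 0 -> x / y <> 0.
Proof. intros hx hy. apply Cmult_neq_0; [exact hx | now apply Cinv_neq0]. Qed.

(** Each new factor is turned over by (1 - 1/(u q^i)) (-u q^i) = 1 - u q^i. *)
Lemma pinf_reverse {q : C} (hq : qnorm q) (u : C) (n : nat) : u <> 0 ->
  qpoch_inf (q / (u * q ^ n)) q * mono (- u) q n = qpoch_inf (q / u) q * poch u q n.
Proof.
  intro hu. assert (hq0 := qnorm_neq0 hq). induction n as [|n IH].
  - rewrite poch_0. unfold mono. simpl. now rewrite (Cmult_1_r u).
  - rewrite poch_Sr mono_Sr (Cmult_assoc (qpoch_inf (q / u) q)) -IH.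
    rewrite (pinf_S hq (q / (u * q ^ S n))).
    assert (h := qpow_neq0 hq n).
    replace (q / (u * q ^ S n) * q) with (q / (u * q ^ n)) by (rewrite Cpow_S; field; auto).
    rewrite Cpow_S. generalize (qpoch_inf (q / (u * q ^ n)) q). intro. field. auto.
Qed.

Lemma poch_swap (x q : C) (n k : nat) :
  poch x q n * poch (x * q ^ n) q k = poch x q k * poch (x * q ^ k) q n.
Proof. now rewrite -!poch_add Nat.add_comm. Qed.

Lemma gprod_inv (w b q : C) (k : nat) : b <> 0 ->
  w ^ k * gprod (/ b) q k = (w / b) ^ k * poch b q k.
Proof.
  intro hb. induction k as [|k IH]; [unfold gprod, poch; simpl; ring|].
  rewrite gprod_Sr poch_Sr !Cpow_S.
  replace (w * w ^ k * (gprod (/ b) q k * (/ b - q ^ k))) with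
    (w ^ k * gprod (/ b) q k * (w * (/ b - q ^ k))) by ring.
  rewrite IH. field. exact hb.
Qed.

(** The inversion theta(1/x) = -theta(x)/x of theta(x) = (x, q/x;q)_oo at x = e/f. Its sign turns
    the sum of the two lines into the difference that Bailey's sum evaluates. *)
Lemma theta_swap {q : C} (hq : qnorm q) (e f : C) : e <> 0 -> f <> 0 ->
  f * (qpoch_inf (e / f) q * qpoch_inf (q * f / e) q) =
  - (e * (qpoch_inf (f / e) q * qpoch_inf (q * e / f) q)).
Proof.
  intros he hf. rewrite (pinf_S hq (e / f)) (pinf_S hq (f / e)).
  replace (e / f * q) with (q * e / f) by (field; auto).
  replace (f / e * q) with (q * f / e) by (field; auto).
  generalize (qpoch_inf (q * e / f) q) (qpoch_inf (q * f / e) q). intros. field. auto.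
Qed.

(** What remains of the n-th term of a line once the pair and the power that involve b are taken
    out. *)
Definition core_term (A a c d e f q : C) (n : nat) : C :=
  vwp (A * e * e) q n *
  pair_prod [(e, A * e * q); (a * q / (c * d), q * e / f); (a * q / (c * f), q * e / d);
             (a * q / (d * f), q * e / c)] q n.

Definition line_pairs (A a b c d e f q : C) : list (C * C) :=
  [(e, A * e * q); (b * e / a, A * a * e * q / b); (a * q / (c * d), q * e / f);
   (a * q / (c * f), q * e / d); (a * q / (d * f), q * e / c)].

Definition double_term (A a b c d e f q : C) (n k : nat) : C :=
  core_term A a c d e f q n * mono (- (e * q / a)) q n *
  six_term a (e * q ^ n) (/ (A * (e * q ^ n))) q (/ b) k.

(** Reversing (be/a;q)_n produces (aq/(bx);q)_oo, and the powers of b in the monomial and in (q/b)^n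
    cancel. So b survives only in a product that the 6phi5 sum can expand. *)
Lemma line_term {q : C} (hq : qnorm q) (A a b c d e f : C) (n : nat) :
  A <> 0 -> a <> 0 -> b <> 0 -> e <> 0 ->
  qpoch_inf (a * q / (b * e)) q * Wterm (A * e * e) (line_pairs A a b c d e f q) q (q / b) n =
  core_term A a c d e f q n * mono (- (e * q / a)) q n *
  (qpoch_inf (a * q * / b / (e * q ^ n)) q * qpoch_inf (a * q * / b / / (A * (e * q ^ n))) q).
Proof.
  intros hA ha hb he. assert (h := qpow_neq0 hq n). assert (hq0 := qnorm_neq0 hq).
  unfold Wterm, core_term, line_pairs. simpl pair_prod.
  assert (hr := pinf_reverse hq (b * e / a) n).
  replace (q / (b * e / a * q ^ n)) with (a * q * / b / (e * q ^ n)) in hr by (field; auto).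
  replace (q / (b * e / a)) with (a * q / (b * e)) in hr by (field; auto).
  replace (mono (- (e * q / a)) q n) with (mono (- (b * e / a)) q n * (q / b) ^ n)
    by (rewrite -mono_scale; f_equal; field; auto).
  replace (a * q * / b / / (A * (e * q ^ n))) with (A * a * e * q / b * q ^ n) by (field; auto 6).
  assert (hne : b * e / a <> 0) by (apply Cdiv_neq0; [now apply Cmult_neq_0 | exact ha]).
  specialize (hr hne).
  set (X := qpoch_inf (a * q / (b * e)) q) in *. set (Y := qpoch_inf (a * q * / b / (e * q ^ n)) q) in *.
  set (P := poch (b * e / a) q n) in *. set (M := mono (- (b * e / a)) q n) in *.
  match goal with |- X * (?v * (?e0 * ?e1 * (P * ?y * ?r)) * ?z) = _ =>
    transitivity (v * (e0 * e1 * (y * r)) * z * (X * P)) end; [ring|].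
  rewrite -hr. ring.
Qed.

(** Under the shift by Q = q^k, A becomes A/Q^2, so the base A e^2 is unchanged, as are the ratios
    aq/(cd), aq/(cf), aq/(df) and e/c, e/d, e/f. Only the factors that mix n and k must be
    reorganised. *)
Lemma double_term_column {q : C} (hq : qnorm q) (a b c d e f : C) (n k : nat) :
  a <> 0 -> b <> 0 -> c <> 0 -> d <> 0 -> e <> 0 -> f <> 0 ->
  let A := a * q / (c * d * e * f) in
  let Q := q ^ k in
  double_term A a b c d e f q n k =
  vwp a q k * (poch b q k * qpoch_inf (a * q / b * Q) q) * (A * a * q / b) ^ k *
  (poch e q k * qpoch_inf (a * q / e * Q) q * mono (- / (A * e)) q k) *
  Wterm (A * e * e) (bailey_pairs (a * (Q * Q)) (d * Q) (e * Q) (f * Q) q (/ (c * Q))) q q n.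
Proof.
  intros ha hb hc hd he hf A Q. assert (hq0 := qnorm_neq0 hq).
  assert (hQ : Q <> 0) by apply (qpow_neq0 hq).
  assert (hN := qpow_neq0 hq n).
  assert (hA : A <> 0) by (unfold A; apply Cdiv_neq0; repeat apply Cmult_neq_0; assumption).
  unfold double_term, core_term, six_term, Wterm, bailey_pairs. cbv zeta. simpl pair_prod.
  rewrite (gprod_inv _ b q k hb).
  set (N := q ^ n) in *. fold Q.
  set (A' := a * (Q * Q) * q / (d * Q * (e * Q) * (f * Q)) * / (c * Q)).
  assert (eA : A' = A / (Q * Q)) by (unfold A', A; field; auto 6).
  (* Three exchanges carry the proof: [s1] splits (e;q)_(n+k) the other way, [s2] reverses in n,
     [s4] reverses in k. The rest matches monomials, with Q^n = N^k. *)
  assert (s1 : poch e q n * poch (e * N) q k = poch e q k * poch (e * Q) q n) by apply poch_swap.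
  assert (s2 := pinf_reverse hq (e * Q / (a * (Q * Q))) n
    ltac:(apply Cdiv_neq0; repeat apply Cmult_neq_0; assumption)).
  fold N in s2.
  replace (q / (e * Q / (a * (Q * Q)) * N)) with (a * q / (e * N) * Q) in s2 by (field; auto).
  replace (q / (e * Q / (a * (Q * Q)))) with (a * q / e * Q) in s2 by (field; auto).
  assert (s3 : mono (- (e * q / a)) q n = mono (- (e * Q / (a * (Q * Q)))) q n * (q * Q) ^ n).
  { rewrite -mono_scale. f_equal. field. auto. }
  assert (s4 := pinf_reverse hq (/ (A * (e * N))) k
    (Cinv_neq0 _ (Cmult_neq_0 _ _ hA (Cmult_neq_0 _ _ he hN)))).
  fold Q in s4.
  replace (q / (/ (A * (e * N)) * Q)) with (A' * (e * Q) * q * N) in s4 by (rewrite eA; field; auto 6).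
  replace (q / / (A * (e * N))) with (A * e * q * N) in s4 by (field; auto).
  assert (s5 : mono (- / (A * (e * N))) q k * N ^ k = mono (- / (A * e)) q k).
  { rewrite -mono_scale. f_equal. field. auto. }
  assert (s6 : Q ^ n = N ^ k) by (unfold Q, N; rewrite -!Cpow_mult_r; f_equal; lia).
  replace (A * a * q / b) with (a * q / (e * N * / (A * (e * N))) / b) by (field; auto 6).
  replace (a * q * / b * Q) with (a * q / b * Q) by (field; auto).
  replace (a * q / / (A * (e * N)) * Q) with (A' * (a * (Q * Q)) * (e * Q) * q * N) by (rewrite eA; field; auto).
  replace (a * (Q * Q) * q / (d * Q * (f * Q))) with (a * q / (d * f)) by (field; auto).
  replace (a * (Q * Q) * q * / (c * Q) / (f * Q)) with (a * q / (c * f)) by (field; auto).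
  replace (a * (Q * Q) * q * / (c * Q) / (d * Q)) with (a * q / (c * d)) by (field; auto).
  replace (q * (e * Q) * / (c * Q) * N) with (q * e / c * N) by (field; auto).
  replace (q * (e * Q) / (d * Q) * N) with (q * e / d * N) by (field; auto).
  replace (q * (e * Q) / (f * Q) * N) with (q * e / f * N) by (field; auto).
  rewrite s3 -s5 Cpow_mult_l s6. fold N. fold Q.
  generalize dependent (poch (/ (A * (e * N))) q k). intros y s4.
  generalize dependent (qpoch_inf (A * e * q * N) q). intros U s4.
  generalize dependent (qpoch_inf (A' * (e * Q) * q * N) q). intros U' s4.
  generalize dependent (mono (- / (A * (e * N))) q k). intros m s5 s4.
  generalize dependent (qpoch_inf (a * q / (e * N) * Q) q). intros V s2.
  generalize dependent (mono (- (e * Q / (a * (Q * Q)))) q n). intros M s3 s2.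
  generalize dependent (qpoch_inf (a * q / e * Q) q). intros V' s2.
  generalize dependent (poch (e * Q / (a * (Q * Q))) q n). intros P s2.
  generalize dependent (poch e q n). intros e1 s1.
  generalize dependent (poch (e * N) q k). intros e2 s1.
  generalize dependent (poch e q k). intros e3 s1.
  generalize dependent (poch (e * Q) q n). intros e4 s1.
  match goal with |- ?v * (_ * _ * (?p1 * ?r1 * (?p2 * ?r2 * (?p3 * ?r3 * _)))) * _ *
      (?w * _ * (_ * ?t * ?u) * (?z * ?b1)) = _ =>
    transitivity (v * (p1 * r1 * (p2 * r2 * (p3 * r3))) * (w * t * u * z * b1) *
      (e1 * e2) * (U * y) * (V * M) * (N * N ^ k)) end; [ring|].
  rewrite s1 -s4 s2. ring.
Qed.

Lemma mono_square (u v q : C) (k : nat) : mono u q k * mono v q k = mono (u * v) (q * q) k.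
Proof.
  induction k as [|k IH]; [unfold mono; simpl; ring|].
  rewrite !mono_Sr -IH Cpow_mult_l. ring.
Qed.

(** The weight of a line that turns each of its columns into a [bailey_line], up to a theta factor
    and a factor symmetric in e and f. *)
Definition line_const (A a c d e f q : C) : C :=
  qpoch_inf (a * q / (c * e)) q * qpoch_inf (a * q / (d * e)) q * qpoch_inf f q *
  qpoch_inf (f / a) q * qpoch_inf (a * q / f) q /
  (qpoch_inf (f / e) q * qpoch_inf (q * e / f) q * qpoch_inf (A * e * e * q) q).

Definition double_column (A a c d e f q : C) (k : nat) : C :=
  poch e q k * qpoch_inf (a * q / e * q ^ k) q * mono (- / (A * e)) q k *
  Wsum (A * e * e) (bailey_pairs (a * (q ^ k * q ^ k)) (d * q ^ k) (e * q ^ k) (f * q ^ k) q (/ (c * q ^ k))) q q.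

(** The last factor on the left is the theta factor in the value of [bailey_sum], so the two will
    cancel. The other factors on the right do not change when e and f are swapped. *)
Lemma column_bailey {q : C} (hq : qnorm q) (a c d e f : C) (k : nat) :
  a <> 0 -> c <> 0 -> d <> 0 -> e <> 0 -> f <> 0 ->
  let A := a * q / (c * d * e * f) in
  let Q := q ^ k in
  qpoch_inf (A * e * e) q <> 0 ->
  qpoch_inf (f / e) q <> 0 -> qpoch_inf (q * e / f) q <> 0 ->
  line_const A a c d e f q * double_column A a c d e f q k *
  (e * Q * (qpoch_inf q q * qpoch_inf (f / e) q * qpoch_inf (q * e / f) q)) =
  poch f q k * poch e q k * qpoch_inf (a * q / f * Q) q * qpoch_inf (a * q / e * Q) q *
  mono (c * d) (q * q) k *
  bailey_line (a * (Q * Q)) (d * Q) (e * Q) (f * Q) q (/ (c * Q)).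
Proof.
  intros ha hc hd he hf A Q h0 h1 h2. assert (hq0 := qnorm_neq0 hq).
  assert (hQ : Q <> 0) by apply (qpow_neq0 hq).
  assert (hal : a * (Q * Q) * q / (d * Q * (e * Q) * (f * Q)) * / (c * Q) * (e * Q) * (e * Q) = A * e * e).
  { unfold A. field. auto 6. }
  unfold bailey_line. rewrite (bailey_W hq); rewrite hal; [|exact h0].
  unfold line_const, double_column. fold Q.
  assert (h3 := pinf_neq0_shift hq _ 1 h0). rewrite Cpow_1_r in h3.
  replace (a * (Q * Q) * q / (d * Q * (e * Q))) with (a * q / (d * e)) by (field; auto).
  replace (a * (Q * Q) * q * / (c * Q) / (e * Q)) with (a * q / (c * e)) by (field; auto).
  rewrite (pinf_poch hq f k). fold Q.
  assert (haf : a * q / f <> 0) by (apply Cdiv_neq0; [now apply Cmult_neq_0 | exact hf]).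
  assert (r1 := pinf_reverse hq (a * q / f) k haf). fold Q in r1.
  replace (q / (a * q / f * Q)) with (f * Q / (a * (Q * Q))) in r1 by (field; auto).
  replace (q / (a * q / f)) with (f / a) in r1 by (field; auto).
  assert (r2 := pinf_poch hq (a * q / f) k). fold Q in r2.
  assert (r3 : mono (c * d) (q * q) k = mono (- / (A * e)) q k * mono (- (a * q / f)) q k).
  { rewrite mono_square. f_equal. unfold A. field. auto 6. }
  rewrite r2 r3.
  generalize dependent (qpoch_inf (A * e * e * q) q). intros al h3.
  generalize (Wsum (A * e * e) (bailey_pairs (a * (Q * Q)) (d * Q) (e * Q) (f * Q) q (/ (c * Q))) q q). intro W.
  generalize dependent (qpoch_inf (f * Q / (a * (Q * Q))) q). intros F' r1.
  generalize dependent (qpoch_inf (f / a) q). intros F r1.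
  generalize dependent (poch (a * q / f) q k). intros p r2 r1.
  generalize dependent (mono (- (a * q / f)) q k). intros m r3 r1.
  generalize (mono (- / (A * e)) q k). intro m'.
  generalize dependent (qpoch_inf (f / e) q). intros t1 h1.
  generalize dependent (qpoch_inf (q * e / f) q). intros t2 h2.
  generalize (qpoch_inf (a * q / f * Q) q) (qpoch_inf (a * q / (d * e)) q) (qpoch_inf (a * q / (c * e)) q)
    (qpoch_inf (a * q / e * Q) q) (poch f q k) (poch e q k) (qpoch_inf (f * Q) q) (qpoch_inf q q).
  intros v1 v2 v3 v4 v5 v6 v7 v8.
  transitivity (v3 * v2 * v5 * v7 * v1 * v6 * v4 * m' * W * e * Q * v8 / al * (F * p)).
  - field. auto.
  - rewrite -r1. field. auto.
Qed.

Lemma column_sum {q : C} (hq : qnorm q) (a c d e f : C) (k : nat) :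
  a <> 0 -> c <> 0 -> d <> 0 -> e <> 0 -> f <> 0 ->
  let A := a * q / (c * d * e * f) in
  let Q := q ^ k in
  qpoch_inf (A * e * e) q <> 0 -> qpoch_inf (A * f * f) q <> 0 ->
  qpoch_inf (f / e) q <> 0 -> qpoch_inf (e / f) q <> 0 ->
  qpoch_inf f q <> 0 -> qpoch_inf (f / (a * Q)) q <> 0 -> qpoch_inf (a * q / (d * e)) q <> 0 ->
  qpoch_inf (e / d) q <> 0 -> qpoch_inf (f * f / (d * e)) q <> 0 ->
  line_const A a c d e f q * double_column A a c d e f q k +
  line_const A a c d f e q * double_column A a c d f e q k =
  qpoch_inf (q / c) q * qpoch_inf (q / d) q * qpoch_inf (e * f / a) q * qpoch_inf (A * a * q) q *
  (poch c q k * qpoch_inf (a * q / c * Q) q * (poch d q k * qpoch_inf (a * q / d * Q) q) *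
   (poch e q k * qpoch_inf (a * q / e * Q) q) * (poch f q k * qpoch_inf (a * q / f * Q) q)).
Proof.
  intros ha hc hd he hf A Q n1 n2 n3 n4 n5 n6 n7 n8 n9.
  assert (hq0 := qnorm_neq0 hq).
  assert (hQ : Q <> 0) by apply (qpow_neq0 hq).
  assert (n3' : qpoch_inf (q * f / e) q <> 0).
  { replace (q * f / e) with (f / e * q ^ 1) by (simpl; field; auto). now apply (pinf_neq0_shift hq). }
  assert (n4' : qpoch_inf (q * e / f) q <> 0).
  { replace (q * e / f) with (e / f * q ^ 1) by (simpl; field; auto). now apply (pinf_neq0_shift hq). }
  assert (eA : a * q / (c * d * f * e) = A) by (unfold A; field; auto).
  assert (l1 := column_bailey hq a c d e f k ha hc hd he hf n1 n3 n4').
  assert (l2 := column_bailey hq a c d f e k ha hc hd hf he).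
  cbv zeta in l1, l2. rewrite eA in l2. specialize (l2 n2 n4 n3'). fold A in l1. fold Q in l1, l2.
  assert (s := bailey_sum hq (a * (Q * Q)) (d * Q) (e * Q) (f * Q) (/ (c * Q))).
  replace (a * (Q * Q) * q / (d * Q * (e * Q) * (f * Q)) * / (c * Q) * (e * Q) * (e * Q)) with (A * e * e) in s
    by (unfold A; field; auto 6).
  replace (a * (Q * Q) * q / (d * Q * (f * Q) * (e * Q)) * / (c * Q) * (f * Q) * (f * Q)) with (A * f * f) in s
    by (unfold A; field; auto 6).
  replace (f * Q / (a * (Q * Q))) with (f / (a * Q)) in s by (field; auto).
  replace (a * (Q * Q) * q / (d * Q * (e * Q))) with (a * q / (d * e)) in s by (field; auto).
  replace (e * Q / (d * Q)) with (e / d) in s by (field; auto).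
  replace (f * Q * (f * Q) / (d * Q * (e * Q))) with (f * f / (d * e)) in s by (field; auto).
  replace (f * Q / (e * Q)) with (f / e) in s by (field; auto).
  replace (q * (e * Q) / (f * Q)) with (q * e / f) in s by (field; auto).
  replace (a * (Q * Q) * q / (d * Q)) with (a * q / d * Q) in s by (field; auto).
  replace (e * Q * (f * Q) / (a * (Q * Q))) with (e * f / a) in s by (field; auto).
  replace (q * / (c * Q)) with (q / (c * Q)) in s by reflexivity.
  replace (a * (Q * Q) * q * / (c * Q)) with (a * q / c * Q) in s by (field; auto).
  replace (a * (Q * Q) * q / (d * Q * (e * Q) * (f * Q)) * (a * (Q * Q)) * q * / (c * Q)) with (A * a * q) in s
    by (unfold A; field; auto 6).
  assert (s' := s (Cmult_neq_0 _ _ ha (Cmult_neq_0 _ _ hQ hQ)) (Cmult_neq_0 _ _ hd hQ) (Cmult_neq_0 _ _ he hQ)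
    (Cmult_neq_0 _ _ hf hQ) n1 n2 (pinf_neq0_shift hq f k n5) n6 n7 n8 n9). clear s.
  assert (r1 := pinf_reverse hq c k hc). assert (r2 := pinf_reverse hq d k hd). fold Q in r1, r2.
  assert (r3 : mono (c * d) (q * q) k = mono (- c) q k * mono (- d) q k).
  { rewrite mono_square. f_equal. ring. }
  assert (th := theta_swap hq e f he hf).
  (* Swapping e and f changes [T] into [- T] by [theta_swap], so multiplying by [T] gives a
     difference of two Bailey lines. *)
  set (T := e * Q * (qpoch_inf q q * qpoch_inf (f / e) q * qpoch_inf (q * e / f) q)) in *.
  assert (hT : T <> 0).
  { unfold T. repeat apply Cmult_neq_0; try assumption. apply (pinf_q_neq0 hq). }
  apply (Cmult_cancel_l T _ _ hT).
  assert (hT2 : f * Q * (qpoch_inf q q * qpoch_inf (e / f) q * qpoch_inf (q * f / e) q) = - T).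
  { unfold T. replace (f * Q * (qpoch_inf q q * qpoch_inf (e / f) q * qpoch_inf (q * f / e) q)) with
      (Q * qpoch_inf q q * (f * (qpoch_inf (e / f) q * qpoch_inf (q * f / e) q))) by ring.
    rewrite th. ring. }
  rewrite hT2 in l2.
  rewrite Cmult_plus_distr_l.
  replace (T * (line_const A a c d f e q * double_column A a c d f e q k)) with
    (- (line_const A a c d f e q * double_column A a c d f e q k * - T)) by ring.
  rewrite l2. rewrite (Cmult_comm T) l1.
  match goal with |- ?P * bailey_line ?x1 ?x2 ?x3 ?x4 ?x5 ?x6 + - (?P' * ?L) = _ =>
    transitivity (P * (bailey_line x1 x2 x3 x4 x5 x6 - L)) end; [ring|].
  rewrite s' r3.
  match goal with |- _ = T * (?x * ?y * ?ef * ?aa * (?cc * ?c2 * (?dd * ?d2) * ?u * ?v)) =>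
    transitivity (T * (ef * aa * c2 * d2 * u * v) * (x * cc) * (y * dd)) end; [|ring].
  rewrite -r1 -r2. ring.
Qed.

(* From (n,k) to (n+1,k+1) the double series picks up only the factor
   (q/b) (1 - A e q^(n+1)), so its decay is read off the borders n = 0 and k = 0. *)
Lemma diag_bound {q : C} (hq : qnorm q) (Y : nat -> nat -> C) (z t v : C) (K r : R) :
  (Cmod z <= r)%R -> (Cmod q <= r)%R -> (Cmod t <= r)%R -> (0 <= K)%R ->
  (forall k, Cmod (Y O k) <= K * Cmod z ^ k)%R ->
  (forall n, Cmod (Y n O) <= K * Cmod q ^ n)%R ->
  (forall n k, Y (S n) (S k) = Y n k * (t * (1 - v * q ^ n))) ->
  forall n k, (Cmod (Y n k) <= K * exp (Cmod v * geom_sum (Cmod q) n) * r ^ Nat.max n k)%R.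
Proof.
  intros hz hqr ht hK h0 h1 h2.
  assert (hr : (0 <= r)%R) by (eapply Rle_trans; [apply Cmod_ge_0 | exact hz]).
  assert (he : forall n, (1 <= exp (Cmod v * geom_sum (Cmod q) n))%R).
  { intro n. eapply Rle_trans; [|apply exp_ineq1_le].
    assert (0 <= Cmod v * geom_sum (Cmod q) n)%R; [|lra].
    apply Rmult_le_pos; [apply Cmod_ge_0 | apply (geom_sum_bounds _ n hq)]. }
  assert (hb : forall n m w, (Cmod w <= r)%R ->
    (K * Cmod w ^ m <= K * exp (Cmod v * geom_sum (Cmod q) n) * r ^ m)%R).
  { intros n m w hw.
    apply Rle_trans with (K * 1 * r ^ m)%R.
    - rewrite Rmult_1_r. apply Rmult_le_compat_l; [exact hK|]. apply pow_incr. split; [apply Cmod_ge_0 | exact hw].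
    - apply Rmult_le_compat_r; [now apply pow_le|]. apply Rmult_le_compat_l; [exact hK | apply he]. }
  induction n as [|n IH]; intro k.
  - rewrite Nat.max_0_l. eapply Rle_trans; [apply h0 | now apply hb].
  - destruct k as [|k].
    + rewrite Nat.max_0_r. eapply Rle_trans; [apply h1 | now apply hb].
    + rewrite h2 -Nat.succ_max_distr (geom_sum_S _ _ hq) Rmult_plus_distr_l exp_plus.
      replace (K * (exp (Cmod v * geom_sum (Cmod q) n) * exp (Cmod v * Cmod q ^ n)) * r ^ S (Nat.max n k))%R with
        (K * exp (Cmod v * geom_sum (Cmod q) n) * r ^ Nat.max n k * (r * exp (Cmod v * Cmod q ^ n)))%R
        by (simpl; ring).
      apply Cmod_mul_le; [apply IH|]. apply Cmod_mul_le; [exact ht|].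
      eapply Rle_trans; [apply Cmod_triangle|]. rewrite Cmod_1 Cmod_opp Cmod_mult Cmod_pow. apply exp_ineq1_le.
Qed.

(** Since 2 max(n,k) >= n + k, a bound by the maximum splits into the product form required by
    [CSeries_exchange]. *)
Lemma pow_max_sqrt (r : R) (n k : nat) : (0 < r < 1)%R ->
  (r ^ Nat.max n k <= sqrt r ^ n * sqrt r ^ k)%R.
Proof.
  intro hr.
  assert (h0 : (0 < sqrt r)%R) by (apply sqrt_lt_R0; lra).
  assert (h1 : (sqrt r <= 1)%R) by (rewrite -sqrt_1; apply sqrt_le_1_alt; lra).
  assert (hs : forall m p, (sqrt r ^ (m + p) <= sqrt r ^ m)%R).
  { intros m p. rewrite pow_add. rewrite -[X in (_ <= X)%R]Rmult_1_r.
    apply Rmult_le_compat_l; [apply pow_le; lra|]. rewrite -(pow1 p). apply pow_incr. lra. }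
  replace (r ^ Nat.max n k)%R with ((sqrt r * sqrt r) ^ Nat.max n k)%R by (rewrite sqrt_sqrt; [reflexivity | lra]).
  rewrite Rpow_mult_distr -pow_add.
  replace (Nat.max n k + Nat.max n k)%nat with ((n + k) + (Nat.max n k + Nat.max n k - (n + k)))%nat by lia.
  rewrite -pow_add. apply hs.
Qed.

Lemma double_term_bound {q : C} (hq : qnorm q) (A a b c d e f : C) :
  A <> 0 -> a <> 0 -> b <> 0 -> e <> 0 ->
  (Cmod (q / b) < 1)%R -> (Cmod (A * a * q / b) < 1)%R ->
  exists K r, (0 <= r < 1)%R /\
    forall n k, (Cmod (double_term A a b c d e f q n k) <= K * r ^ n * r ^ k)%R.
Proof.
  intros hA ha hb he ht hz. assert (hq0 := qnorm_neq0 hq).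
  set (z := A * a * q / b) in *. set (t := q / b) in *.
  (* [Y] collects the factors that are not uniformly bounded one by one, since 1/(A e q^n) and aq/(e
     q^n) are unbounded in n; everything else is bounded by [Wterm_bound] and the product bounds. *)
  set (Y := fun n k => mono (- (e * q / a)) q n * poch (/ (A * (e * q ^ n))) q k *
    qpoch_inf (a * q / (e * q ^ n) * q ^ k) q * z ^ k).
  set (K1 := (poch_max q (Cmod (/ (A * e))) * poch_max q (Cmod (a * q / e)))%R).
  set (K2 := (poch_max q (Cmod (a * q / e)) * poch_max q (Cmod (e / a)))%R).
  assert (p1 : (0 < K1)%R) by (apply Rmult_lt_0_compat; apply poch_max_pos).
  assert (p2 : (0 < K2)%R) by (apply Rmult_lt_0_compat; apply poch_max_pos).
  set (r := Rmax (Cmod z) (Rmax (Cmod q) (Cmod t))).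
  assert (rz : (Cmod z <= r)%R) by apply Rmax_l.
  assert (rq : (Cmod q <= r)%R) by (eapply Rle_trans; [|apply Rmax_r]; apply Rmax_l).
  assert (rt : (Cmod t <= r)%R) by (eapply Rle_trans; [|apply Rmax_r]; apply Rmax_r).
  assert (r1 : (r < 1)%R) by (repeat apply Rmax_lub_lt; try assumption; apply hq).
  assert (r0 : (0 < r)%R) by (destruct hq; lra).
  assert (hY := diag_bound hq Y z t (A * e * q) (K1 + K2) r rz rq rt ltac:(lra)).
  assert (HY : forall n k, (Cmod (Y n k) <= (K1 + K2) * exp (Cmod (A * e * q) * geom_sum (Cmod q) n) * r ^ Nat.max n k)%R).
  { apply hY; clear hY.
    - intro k. apply Rle_trans with (K1 * Cmod z ^ k)%R.
      + unfold Y. replace (mono (- (e * q / a)) q 0) with (RtoC 1) by reflexivity.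
        replace (e * q ^ 0) with e by (simpl; ring). rewrite Cmult_1_l.
        apply Cmod_mul_le; [apply Cmod_mul_le|].
        * apply (poch_bound hq), Rle_refl.
        * apply (pinf_bound hq), (Cmod_qpow_le hq).
        * rewrite Cmod_pow. apply Rle_refl.
      + apply Rmult_le_compat_r; [apply pow_le, Cmod_ge_0 | lra].
    - intro n. apply Rle_trans with (K2 * Cmod q ^ n)%R.
      (* On the border k = 0, reversal absorbs the growing product into the monomial and leaves a
         factor q^n. *)
      + assert (hr := pinf_reverse hq (e / a) n (Cdiv_neq0 _ _ he ha)).
        assert (hN := qpow_neq0 hq n).
        replace (q / (e / a * q ^ n)) with (a * q / (e * q ^ n)) in hr by (field; auto).
        replace (q / (e / a)) with (a * q / e) in hr by (field; auto).
        replace (Y n O) with (qpoch_inf (a * q / e) q * poch (e / a) q n * q ^ n).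
        * apply Cmod_mul_le; [apply Cmod_mul_le|].
          -- apply (pinf_bound hq), Rle_refl.
          -- apply (poch_bound hq), Rle_refl.
          -- rewrite Cmod_pow. apply Rle_refl.
        * rewrite -hr. unfold Y. rewrite poch_0.
          replace (- (e * q / a)) with (- (e / a) * q) by (field; auto).
          rewrite mono_scale. replace (q ^ 0) with (RtoC 1) by reflexivity.
          replace (z ^ 0) with (RtoC 1) by reflexivity. rewrite (Cmult_1_r (a * q / (e * q ^ n))). ring.
      + apply Rmult_le_compat_r; [apply pow_le, Cmod_ge_0 | lra].
    - intros n k. unfold Y. assert (hN := qpow_neq0 hq n).
      rewrite mono_Sr poch_Sl.
      replace (/ (A * (e * q ^ S n)) * q) with (/ (A * (e * q ^ n))) by (rewrite Cpow_S; field; auto).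
      replace (a * q / (e * q ^ S n) * q ^ S k) with (a * q / (e * q ^ n) * q ^ k) by (rewrite !Cpow_S; field; auto).
      rewrite !Cpow_S. generalize (qpoch_inf (a * q / (e * q ^ n) * q ^ k) q) (poch (/ (A * (e * q ^ n))) q k) (z ^ k)
        (mono (- (e * q / a)) q n). intros. unfold z, t. field. auto 8. }
  destruct (Wterm_bound hq (fun _ => A * e * e) (fun _ => 1) (A * e * e)
    (fun _ => [(e, A * e * q); (a * q / (c * d), q * e / f); (a * q / (c * f), q * e / d);
             (a * q / (d * f), q * e / c)]) [(e, A * e * q); (a * q / (c * d), q * e / f); (a * q / (c * f), q * e / d);
             (a * q / (d * f), q * e / c)] 1) as [K3 h3].
  { apply Ccvg_const. } { apply pairs_cvg_const. } { intros _. rewrite Cmod_1. apply Rle_refl. }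
  destruct (Wterm_bound hq (fun _ => a) (fun _ => 1) a (fun _ => [(b, a * q * / b)]) [(b, a * q * / b)] 1) as [K4 h4].
  { apply Ccvg_const. } { apply pairs_cvg_const. } { intros _. rewrite Cmod_1. apply Rle_refl. }
  exists (K3 * K4 * (poch_max q (Cmod e) * poch_max q (Cmod (A * a * e * q))) *
    ((K1 + K2) * poch_max q (Cmod (A * e * q))))%R, (sqrt r).
  split.
  { split; [apply sqrt_pos|]. rewrite -sqrt_1. apply sqrt_lt_1_alt. lra. }
  intros n k. assert (hN := qpow_neq0 hq n).
  replace (double_term A a b c d e f q n k) with
    (Wterm (A * e * e) [(e, A * e * q); (a * q / (c * d), q * e / f); (a * q / (c * f), q * e / d);
             (a * q / (d * f), q * e / c)] q 1 n * Wterm a [(b, a * q * / b)] q 1 k *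
     (poch (e * q ^ n) q k * qpoch_inf (A * a * e * q * q ^ n * q ^ k) q) * Y n k).
  - rewrite Rmult_assoc. rewrite (Rmult_assoc (K3 * K4 * _)).
    apply Cmod_mul_le; [apply Cmod_mul_le; [apply Cmod_mul_le|apply Cmod_mul_le]|].
    + specialize (h3 O n). now rewrite pow1 Rmult_1_r in h3.
    + specialize (h4 O k). now rewrite pow1 Rmult_1_r in h4.
    + apply (poch_bound hq), (Cmod_qpow_le hq).
    + apply (pinf_bound hq). eapply Rle_trans; apply (Cmod_qpow_le hq).
    + eapply Rle_trans; [apply HY|]. apply Rmult_le_compat.
      * apply Rmult_le_pos; [lra | left; apply exp_pos].
      * apply pow_le. lra.
      * apply Rmult_le_compat_l; [lra|]. apply poch_max_aux; [exact hq | apply Cmod_ge_0].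
      * apply pow_max_sqrt. lra.
  - unfold double_term, core_term, six_term, Wterm, Y. simpl pair_prod. rewrite !Cpow_1_l.
    rewrite (gprod_inv _ b q k hb).
    replace (a * q / (e * q ^ n * / (A * (e * q ^ n))) / b) with z by (unfold z; field; auto 6).
    replace (a * q / / (A * (e * q ^ n))) with (A * a * e * q * q ^ n) by (field; auto).
    ring.
Qed.

Lemma ex_series_pow (r : R) : (0 <= r < 1)%R -> ex_series (fun n => r ^ n)%R.
Proof. intro h. apply ex_series_geom. rewrite Rabs_pos_eq; lra. Qed.

(** The double series summed in both orders: first over k it is the line, by the 6phi5 sum; first
    over n it is the series of columns. *)
Lemma line_sum {q : C} (hq : qnorm q) (a b c d e f : C) :
  a <> 0 -> b <> 0 -> c <> 0 -> d <> 0 -> e <> 0 -> f <> 0 ->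
  let A := a * q / (c * d * e * f) in
  (Cmod (q / b) < 1)%R -> (Cmod (A * a * q / b) < 1)%R ->
  (forall n, qpoch_inf (a * q / (e * q ^ n)) q <> 0) -> qpoch_inf (A * a * e * q) q <> 0 ->
  qpoch_inf (A * a * q) q * qpoch_inf (a * q) q *
    (qpoch_inf (a * q / (b * e)) q * Wsum (A * e * e) (line_pairs A a b c d e f q) q (q / b)) =
  qpoch_inf (A * a * q / b) q *
  CSeries (fun k => vwp a q k * (poch b q k * qpoch_inf (a * q / b * q ^ k) q) * (A * a * q / b) ^ k *
    double_column A a c d e f q k).
Proof.
  intros ha hb hc hd he hf A ht hz n1 n2. assert (hq0 := qnorm_neq0 hq).
  assert (hA : A <> 0) by (unfold A; apply Cdiv_neq0; repeat apply Cmult_neq_0; assumption).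
  destruct (double_term_bound hq A a b c d e f hA ha hb he ht hz) as [K [r [hr hK]]].
  assert (hgeo := ex_series_pow r hr).
  assert (exr : forall n, ex_Cseries (double_term A a b c d e f q n)).
  { intro n. apply ex_Cseries_le with (fun k => (K * r ^ n) * r ^ k)%R; [apply hK | now apply ex_series_mul]. }
  assert (K0 : (0 <= K)%R).
  { specialize (hK O O). simpl in hK. rewrite !Rmult_1_r in hK. eapply Rle_trans; [apply Cmod_ge_0 | exact hK]. }
  assert (exs : ex_Cseries (fun n => CSeries (double_term A a b c d e f q n))).
  { apply ex_Cseries_le with (fun n => Series (fun k => r ^ k) * (K * r ^ n))%R.
    - intro n. rewrite Rmult_comm -Series_scal_l. apply CSeries_bound; [apply hK | now apply ex_series_mul].
    - now apply ex_series_mul, ex_series_mul. }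
  rewrite -(CSeries_scal (qpoch_inf (a * q / (b * e)) q)); [|now apply (ex_Wsum hq)].
  rewrite -CSeries_scal; [|apply ex_Cseries_scal; now apply (ex_Wsum hq)].
  transitivity (CSeries (fun n => qpoch_inf (A * a * q / b) q * CSeries (double_term A a b c d e f q n))).
  - apply CSeries_ext. intro n. rewrite (line_term hq A a b c d e f n hA ha hb he).
    assert (hN := qpow_neq0 hq n).
    unfold double_term. rewrite CSeries_scal.
    + assert (hx : e * q ^ n <> 0) by now apply Cmult_neq_0.
      assert (hAx : A * (e * q ^ n) <> 0) by now apply Cmult_neq_0.
      (* For x = e q^n and y = 1/(Ax) the product xy = 1/A is independent of n, so the constants of
         the 6phi5 sum leave the outer sum. *)
      assert (s := six_phi_five hq a (e * q ^ n) (/ (A * (e * q ^ n))) (/ b) hx (Cinv_neq0 _ hAx) (n1 n)).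
      replace (a * q / / (A * (e * q ^ n))) with (A * a * e * q * q ^ n) in s by (field; auto).
      replace (a * q / (e * q ^ n * / (A * (e * q ^ n)))) with (A * a * q) in s by (field; auto).
      specialize (s (pinf_neq0_shift hq _ n n2) hz).
      change (A * a * q * / b) with (A * a * q / b) in s.
      match goal with |- ?p * ?o * (?c1 * ?m * (?u * ?v)) = _ =>
        transitivity (c1 * m * (u * v * (o * p))) end; [ring|].
      rewrite -s. ring.
    + apply (ex_six hq), (gdecay_small hq).
      replace (a * q / (e * q ^ n * / (A * (e * q ^ n))) * / b) with (A * a * q / b) by (field; auto).
      exact hz.
  - rewrite CSeries_scal; [|exact exs]. f_equal.
    rewrite (CSeries_exchange _ (fun n => K * r ^ n)%R (fun k => r ^ k)%R); [|exact hK | now apply ex_series_mul | exact hgeo].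
    apply CSeries_ext. intro k.
    rewrite (CSeries_ext _ _ (fun n => double_term_column hq a b c d e f n k ha hb hc hd he hf)).
    rewrite CSeries_scal; [|apply (ex_Wsum hq), hq].
    unfold double_column, Wsum, A. ring.
Qed.

Definition base_pairs (a b c d e f q : C) : list (C * C) :=
  [(b, a * q / b); (c, a * q / c); (d, a * q / d); (e, a * q / e); (f, a * q / f)].

Lemma ex_column {q : C} (hq : qnorm q) (a b c d e f : C) :
  a <> 0 -> b <> 0 -> c <> 0 -> d <> 0 -> e <> 0 -> f <> 0 ->
  let A := a * q / (c * d * e * f) in
  (Cmod (q / b) < 1)%R -> (Cmod (A * a * q / b) < 1)%R ->
  ex_Cseries (fun k => vwp a q k * (poch b q k * qpoch_inf (a * q / b * q ^ k) q) * (A * a * q / b) ^ k *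
    double_column A a c d e f q k).
Proof.
  intros ha hb hc hd he hf A ht hz. assert (hq0 := qnorm_neq0 hq).
  assert (hA : A <> 0) by (unfold A; apply Cdiv_neq0; repeat apply Cmult_neq_0; assumption).
  destruct (double_term_bound hq A a b c d e f hA ha hb he ht hz) as [K [r [hr hK]]].
  assert (hgeo := ex_series_pow r hr).
  apply ex_Cseries_le with (fun k => Series (fun n => K * r ^ n) * r ^ k)%R; [|now apply ex_series_mul].
  intro k. rewrite -Series_scal_r.
  replace (vwp a q k * (poch b q k * qpoch_inf (a * q / b * q ^ k) q) * (A * a * q / b) ^ k *
    double_column A a c d e f q k) with (CSeries (fun n => double_term A a b c d e f q n k)).
  - apply CSeries_bound; [intro n; apply hK | now apply ex_series_scal_r, ex_series_mul].
  - rewrite (CSeries_ext _ _ (fun n => double_term_column hq a b c d e f n k ha hb hc hd he hf)).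
    rewrite CSeries_scal; [|apply (ex_Wsum hq), hq].
    unfold double_column, Wsum, A. ring.
Qed.

(** The conditions quantified over [n], each with its companion, serve the 6phi5 sum at every node
    of the two lines; those quantified over [k] and the following ones serve Bailey's sum in every
    column; the last one is for the final cancellation. *)
Lemma three_term_generic {q : C} (hq : qnorm q) (a b c d e f : C) :
  a <> 0 -> b <> 0 -> c <> 0 -> d <> 0 -> e <> 0 -> f <> 0 ->
  let A := a * q / (c * d * e * f) in
  (Cmod (q / b) < 1)%R -> (Cmod (A * a * q / b) < 1)%R ->
  qpoch_inf (A * e * e) q <> 0 -> qpoch_inf (A * f * f) q <> 0 ->
  qpoch_inf (f / e) q <> 0 -> qpoch_inf (e / f) q <> 0 ->
  (forall n, qpoch_inf (a * q / (e * q ^ n)) q <> 0) -> qpoch_inf (A * a * e * q) q <> 0 ->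
  (forall n, qpoch_inf (a * q / (f * q ^ n)) q <> 0) -> qpoch_inf (A * a * f * q) q <> 0 ->
  qpoch_inf f q <> 0 -> (forall k, qpoch_inf (f / (a * q ^ k)) q <> 0) ->
  qpoch_inf (a * q / (d * e)) q <> 0 ->
  qpoch_inf (e / d) q <> 0 -> qpoch_inf (f * f / (d * e)) q <> 0 ->
  qpoch_inf (A * a * q) q <> 0 ->
  qpoch_inf (q / c) q * qpoch_inf (q / d) q * qpoch_inf (e * f / a) q * qpoch_inf (A * a * q / b) q *
    Wsum a (base_pairs a b c d e f q) q (A * a * q / b) =
  qpoch_inf (a * q) q *
  (line_const A a c d e f q *
     (qpoch_inf (a * q / (b * e)) q * Wsum (A * e * e) (line_pairs A a b c d e f q) q (q / b)) +
   line_const A a c d f e q *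
     (qpoch_inf (a * q / (b * f)) q * Wsum (A * f * f) (line_pairs A a b c d f e q) q (q / b))).
Proof.
  intros ha hb hc hd he hf A ht hz n1 n2 n3 n4 n5 n6 n7 n8 n9 n10 n11 n12 n13 n14.
  assert (hq0 := qnorm_neq0 hq).
  assert (eA : a * q / (c * d * f * e) = A) by (unfold A; field; auto).
  assert (s1 := line_sum hq a b c d e f ha hb hc hd he hf ht hz n5 n6).
  assert (s2 := line_sum hq a b c d f e ha hb hc hd hf he). cbv zeta in s1, s2. rewrite eA in s2.
  specialize (s2 ht hz n7 n8). fold A in s1.
  assert (x1 := ex_column hq a b c d e f ha hb hc hd he hf ht hz).
  assert (x2 := ex_column hq a b c d f e ha hb hc hd hf he). cbv zeta in x1, x2. rewrite eA in x2.
  specialize (x2 ht hz). fold A in x1.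
  apply (Cmult_cancel_l _ _ _ n14).
  match goal with |- _ = ?o * (?p * (?l1 * ?w1 + ?l2 * ?w2)) =>
    transitivity (l1 * (o * p * w1) + l2 * (o * p * w2)) end; [|ring].
  rewrite s1 s2.
  match goal with |- _ = ?l1 * (?z * ?w1) + ?l2 * (?z * ?w2) =>
    transitivity (z * (l1 * w1 + l2 * w2)) end; [|ring].
  rewrite -(CSeries_scal (line_const A a c d e f q)); [|exact x1].
  rewrite -(CSeries_scal (line_const A a c d f e q)); [|exact x2].
  rewrite -CSeries_plus; try (apply ex_Cseries_scal; assumption).
  transitivity (qpoch_inf (A * a * q / b) q *
    (qpoch_inf (q / c) q * qpoch_inf (q / d) q * qpoch_inf (e * f / a) q * qpoch_inf (A * a * q) q *
     Wsum a (base_pairs a b c d e f q) q (A * a * q / b))); [ring|].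
  f_equal. unfold Wsum. rewrite -CSeries_scal; [|now apply (ex_Wsum hq)].
  apply CSeries_ext. intro k.
  assert (cs := column_sum hq a c d e f k ha hc hd he hf n1 n2 n3 n4 n9 (n10 k) n11 n12 n13).
  cbv zeta in cs. fold A in cs.
  match goal with |- _ = ?l1 * (?u * ?c1) + ?l2 * (?u * ?c2) =>
    transitivity (u * (l1 * c1 + l2 * c2)) end; [|ring].
  rewrite cs. unfold Wterm, base_pairs. simpl pair_prod. ring.
Qed.

(* The logarithm turns the exceptional values of s into a discrete set. *)
Lemma generic_scale {q : C} (hq : qnorm q) (mu : C) (s : nat -> R) : mu <> 0 ->
  (forall j, 1 < s j)%R -> is_lim_seq s 1%R ->
  eventually (fun j => forall i n, mu * s j * q ^ i <> q ^ n).
Proof.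
  intros hmu hs hl. assert (hm := proj1 (Cmod_gt_0 _) hmu).
  set (L := (- ln (Cmod q))%R).
  assert (hL : (0 < L)%R).
  { unfold L. assert (h := ln_increasing (Cmod q) 1 ltac:(apply hq) ltac:(apply hq)). rewrite ln_1 in h. lra. }
  set (u := (ln (Cmod mu) / L)%R).
  destruct (archimed u) as [h1 h2].
  set (m := up u) in *.
  (* A solution of mu s q^i = q^n has ln s = (p - u) L with p = i - n an integer. As s > 1, p
     exceeds u, hence p >= m, and then ln s >= (m - u) L; this margin excludes that once s is near
     1. *)
  assert (hd : (0 < L * (IZR m - u))%R) by (apply Rmult_lt_0_compat; lra).
  apply is_lim_seq_spec in hl. specialize (hl (mkposreal _ hd)). simpl in hl.
  apply: filter_imp hl => j hl i n heq.
  specialize (hs j). rewrite Rabs_pos_eq in hl; [|lra].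
  assert (h3 : (Cmod mu * s j * Cmod q ^ i = Cmod q ^ n)%R).
  { rewrite -!Cmod_pow -heq !Cmod_mult Cmod_R Rabs_pos_eq; [reflexivity | lra]. }
  assert (h4 : (ln (Cmod mu) + ln (s j) + INR i * ln (Cmod q) = INR n * ln (Cmod q))%R).
  { destruct hq as [q0 q1]. rewrite -!ln_pow // -h3.
    rewrite ln_mult; [|apply Rmult_lt_0_compat; lra | now apply pow_lt].
    rewrite ln_mult; lra. }
  assert (h5 : (ln (s j) <= s j - 1)%R).
  { assert (h := exp_ineq1_le (ln (s j))). rewrite exp_ln in h; lra. }
  assert (h6 : (0 < ln (s j))%R) by (rewrite -ln_1; apply ln_increasing; lra).
  assert (h7 : (u * L = ln (Cmod mu))%R) by (unfold u; field; lra).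
  assert (h8 : (ln (s j) = (IZR (Z.of_nat i - Z.of_nat n) - u) * L)%R).
  { rewrite minus_IZR -!INR_IZR_INZ. unfold L in *. lra. }
  set (p := (Z.of_nat i - Z.of_nat n)%Z) in *.
  assert (h9 : (u < IZR p)%R) by nra.
  assert (h10 : (IZR p < IZR m)%R) by nra.
  assert (h11 : (IZR m - 1 < IZR p)%R) by lra.
  apply lt_IZR in h10. rewrite -(minus_IZR m 1) in h11. apply lt_IZR in h11. lia.
Qed.

(** One condition on [w] serves all [n] at once, so an infinite family of nonvanishing requirements
    costs a single use of [generic_scale]. *)
Lemma pinf_generic_inv {q : C} (hq : qnorm q) (X w : C) (n : nat) :
  X * (w * q ^ n) = 1 -> (forall i m, w * q ^ i <> q ^ m) -> qpoch_inf X q <> 0.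
Proof.
  intros hX hw. apply (pinf_neq0 hq). intros i h. apply (hw n i).
  assert (h1 : X * q ^ i = 1) by (replace (X * q ^ i) with (1 - (1 - X * q ^ i)) by ring; rewrite h; ring).
  transitivity (w * q ^ n * (X * q ^ i)); [rewrite h1; ring|].
  transitivity (X * (w * q ^ n) * q ^ i); [ring|]. rewrite hX. ring.
Qed.

Lemma pinf_generic {q : C} (hq : qnorm q) (X w : C) (n : nat) :
  X * q ^ n = w -> (forall i m, w * q ^ i <> q ^ m) -> qpoch_inf X q <> 0.
Proof.
  intros hX hw. apply (pinf_neq0 hq). intros i h. apply (hw i n). rewrite -hX.
  assert (h1 : X * q ^ i = 1) by (replace (X * q ^ i) with (1 - (1 - X * q ^ i)) by ring; rewrite h; ring).
  transitivity (X * q ^ i * q ^ n); [ring|]. rewrite h1. ring.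
Qed.

Lemma Ccvg_div (u v : nat -> C) (l m : C) :
  m <> 0 -> Ccvg u l -> Ccvg v m -> Ccvg (fun n => u n / v n) (l / m).
Proof. intros hm hu hv. apply Ccvg_mult; [exact hu | now apply Ccvg_inv]. Qed.

(* Drives the limit lemmas by syntax only: plain [apply] would unfold products. *)
Ltac ccvg hq :=
  lazymatch goal with
  | |- Ccvg (fun _ => ?c) ?c => exact (Ccvg_const c)
  | |- Ccvg (fun j => @?u j + @?v j) (?l + ?m) => apply (Ccvg_plus u v l m); ccvg hq
  | |- Ccvg (fun j => @?u j * @?v j) (?l * ?m) => apply (Ccvg_mult u v l m); ccvg hq
  | |- Ccvg (fun j => @?u j / @?v j) (?l / ?m) => apply (Ccvg_div u v l m); [|ccvg hq|ccvg hq]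
  | |- Ccvg (fun j => qpoch_inf (@?u j) ?q) (qpoch_inf ?l ?q) => apply (Ccvg_pinf hq u l); ccvg hq
  | |- pairs_cvg (fun j => (@?u j, @?v j) :: @?Ls j) ((?x, ?y) :: ?L) =>
      apply (pairs_cvg_cons u v x y Ls L); [ccvg hq | ccvg hq | ccvg hq]
  | |- pairs_cvg (fun _ => []) [] => exact pairs_cvg_nil
  | |- _ => try assumption
  end.

(** Both sides are continuous along the scaling of e and f used below; the four remaining
    nonvanishing conditions are those on quantities that the scaling leaves fixed. *)
Lemma three_term {q : C} (hq : qnorm q) (a b c d e f : C) :
  a <> 0 -> b <> 0 -> c <> 0 -> d <> 0 -> e <> 0 -> f <> 0 ->
  let A := a * q / (c * d * e * f) in
  (Cmod (q / b) < 1)%R -> (Cmod (A * a * q / b) < 1)%R ->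
  qpoch_inf (A * e * e) q <> 0 -> qpoch_inf (A * f * f) q <> 0 ->
  qpoch_inf (f / e) q <> 0 -> qpoch_inf (e / f) q <> 0 ->
  qpoch_inf (q / c) q * qpoch_inf (q / d) q * qpoch_inf (e * f / a) q * qpoch_inf (A * a * q / b) q *
    Wsum a (base_pairs a b c d e f q) q (A * a * q / b) =
  qpoch_inf (a * q) q *
  (line_const A a c d e f q *
     (qpoch_inf (a * q / (b * e)) q * Wsum (A * e * e) (line_pairs A a b c d e f q) q (q / b)) +
   line_const A a c d f e q *
     (qpoch_inf (a * q / (b * f)) q * Wsum (A * f * f) (line_pairs A a b c d f e q) q (q / b))).
Proof.
  intros ha hb hc hd he hf A ht hz n1 n2 n3 n4. assert (hq0 := qnorm_neq0 hq).
  assert (n3' : qpoch_inf (q * f / e) q <> 0).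
  { replace (q * f / e) with (f / e * q ^ 1) by (simpl; field; auto). now apply (pinf_neq0_shift hq). }
  assert (n4' : qpoch_inf (q * e / f) q <> 0).
  { replace (q * e / f) with (e / f * q ^ 1) by (simpl; field; auto). now apply (pinf_neq0_shift hq). }
  assert (n1' := pinf_neq0_shift hq _ 1 n1). assert (n2' := pinf_neq0_shift hq _ 1 n2).
  rewrite Cpow_1_r in n1'. rewrite Cpow_1_r in n2'.
  (* Scaling e and f by s j > 1 leaves f/e, A e^2 and A f^2 unchanged and makes
     every other parameter combination generic. *)
  set (s := fun j : nat => (1 + / (INR j + 1))%R).
  assert (s1 : forall j, (1 < s j)%R).
  { intro j. unfold s. assert (h := pos_INR j). assert (0 < / (INR j + 1))%R by (apply Rinv_0_lt_compat; lra). lra. }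
  assert (sl : is_lim_seq s 1%R).
  { unfold s. replace (Finite 1) with (Finite (1 + 0)) by (f_equal; ring).
    apply is_lim_seq_plus'; [apply is_lim_seq_const|].
    apply (is_lim_seq_ext (fun j => / INR (S j))%R); [intro j; now rewrite S_INR|].
    apply (is_lim_seq_incr_1 (fun j => / INR j)%R).
    replace (Finite 0) with (Rbar_inv p_infty) by reflexivity.
    apply is_lim_seq_inv; [apply is_lim_seq_INR | discriminate]. }
  assert (ss1 : forall j, (1 < s j * s j)%R) by (intro j; specialize (s1 j); nra).
  assert (ssl : is_lim_seq (fun j => s j * s j)%R 1%R).
  { replace (Finite 1) with (Finite (1 * 1)) by (f_equal; ring). now apply is_lim_seq_mult'. }
  assert (G := fun mu h => generic_scale hq mu s h s1 sl).
  assert (nz : forall x y : C, x <> 0 -> y <> 0 -> x * y <> 0) by (intros; now apply Cmult_neq_0).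
  assert (haq := nz _ _ ha hq0).
  (* One entry per condition to be removed. The last one comes from Aaq, which contains 1/(ef) and
     so scales with the square of [s j]. *)
  assert (hall := filter_and _ _ (G (e / (a * q)) (Cdiv_neq0 _ _ he haq))
    (filter_and _ _ (G (f / (a * q)) (Cdiv_neq0 _ _ hf haq))
    (filter_and _ _ (G (c * d * f / (a * q * (a * q))) (Cdiv_neq0 _ _ (nz _ _ (nz _ _ hc hd) hf) (nz _ _ haq haq)))
    (filter_and _ _ (G (c * d * e / (a * q * (a * q))) (Cdiv_neq0 _ _ (nz _ _ (nz _ _ hc hd) he) (nz _ _ haq haq)))
    (filter_and _ _ (G f hf)
    (filter_and _ _ (G (f / a) (Cdiv_neq0 _ _ hf ha))
    (filter_and _ _ (G (d * e / (a * q)) (Cdiv_neq0 _ _ (nz _ _ hd he) haq))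
    (filter_and _ _ (G (e / d) (Cdiv_neq0 _ _ he hd))
    (filter_and _ _ (G (f * f / (d * e)) (Cdiv_neq0 _ _ (nz _ _ hf hf) (nz _ _ hd he)))
      (generic_scale hq (c * d * e * f / (a * q * (a * q))) _
        (Cdiv_neq0 _ _ (nz _ _ (nz _ _ (nz _ _ hc hd) he) hf) (nz _ _ haq haq)) ss1 ssl)))))))))).
  destruct hall as [N hN]. clear G.
  set (t := fun j => RtoC (s (j + N)%nat)).
  assert (t0 : forall j, t j <> 0).
  { intro j. unfold t. apply Cmod_gt_0. rewrite Cmod_R Rabs_pos_eq; specialize (s1 (j + N)%nat); lra. }
  assert (tl : Ccvg t 1).
  { apply (is_lim_seq_ext (fun j => Rabs (s (j + N)%nat - 1))).
    - intro j. unfold t. now rewrite -RtoC_minus Cmod_R.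
    - replace (Finite 0) with (Finite (Rabs (1 - 1))) by (f_equal; rewrite Rminus_diag Rabs_R0; reflexivity).
      apply (is_lim_seq_abs (fun j => s (j + N)%nat - 1)%R (1 - 1)%R).
      apply is_lim_seq_minus'; [|apply is_lim_seq_const].
      exact (proj1 (is_lim_seq_incr_n s N 1%R) sl). }
  set (ej := fun j => e * t j). set (fj := fun j => f * t j).
  assert (el : Ccvg ej e). { rewrite -(Cmult_1_r e). apply Ccvg_mult; [apply Ccvg_const | exact tl]. }
  assert (fl : Ccvg fj f). { rewrite -(Cmult_1_r f). apply Ccvg_mult; [apply Ccvg_const | exact tl]. }
  set (Aj := fun j => a * q / (c * d * ej j * fj j)).
  assert (Al : Ccvg Aj A).
  { unfold Aj, A. ccvg hq. repeat apply Cmult_neq_0; assumption. }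
  assert (hej : forall j, ej j <> 0) by (intro j; apply Cmult_neq_0; [exact he | apply t0]).
  assert (hfj : forall j, fj j <> 0) by (intro j; apply Cmult_neq_0; [exact hf | apply t0]).
  assert (eA1 : forall j, Aj j * ej j * ej j = A * e * e).
  { intro j. specialize (t0 j). unfold Aj, A, ej, fj. field. auto 6. }
  assert (eA2 : forall j, Aj j * fj j * fj j = A * f * f).
  { intro j. specialize (t0 j). unfold Aj, A, ej, fj. field. auto 6. }
  (* Scaling by t > 1 divides the argument by t^2, so |Aaq/b| bounds all arguments on the left
     uniformly. *)
  assert (ez : forall j, Aj j * a * q / b = A * a * q / b / (t j * t j)).
  { intro j. specialize (t0 j). unfold Aj, A, ej, fj. field. auto 7. }
  assert (hzj : forall j, (Cmod (Aj j * a * q / b) <= Cmod (A * a * q / b))%R).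
  { intro j. rewrite ez (Cmod_div _ _ (Cmult_neq_0 _ _ (t0 j) (t0 j))).
    assert (h := Cmod_ge_0 (A * a * q / b)).
    assert (h1 : (1 <= Cmod (t j * t j))%R).
    { unfold t. rewrite -RtoC_mult Cmod_R Rabs_pos_eq; specialize (ss1 (j + N)%nat); lra. }
    unfold Rdiv. rewrite -[X in (_ <= X)%R]Rmult_1_r. apply Rmult_le_compat_l; [exact h|].
    rewrite -Rinv_1. apply Rinv_le_contravar; lra. }
  assert (H : forall j,
    qpoch_inf (q / c) q * qpoch_inf (q / d) q * qpoch_inf (ej j * fj j / a) q * qpoch_inf (Aj j * a * q / b) q *
    Wsum a (base_pairs a b c d (ej j) (fj j) q) q (Aj j * a * q / b) =
    qpoch_inf (a * q) q *
    (line_const (Aj j) a c d (ej j) (fj j) q *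
      (qpoch_inf (a * q / (b * ej j)) q *
        Wsum (Aj j * ej j * ej j) (line_pairs (Aj j) a b c d (ej j) (fj j) q) q (q / b)) +
    line_const (Aj j) a c d (fj j) (ej j) q *
      (qpoch_inf (a * q / (b * fj j)) q *
        Wsum (Aj j * fj j * fj j) (line_pairs (Aj j) a b c d (fj j) (ej j) q) q (q / b)))).
  { intro j. specialize (hN (j + N)%nat ltac:(lia)).
    rewrite RtoC_mult in hN. change (RtoC (s (j + N)%nat)) with (t j) in hN.
    destruct hN as [g1 [g2 [g3 [g4 [g5 [g6 [g7 [g8 [g9 g10]]]]]]]]].
    assert (tj := t0 j).
    assert (ff : fj j / ej j = f / e) by (unfold fj, ej; field; auto).
    assert (ef : ej j / fj j = e / f) by (unfold fj, ej; field; auto).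
    apply (three_term_generic hq); auto; change (a * q / (c * d * ej j * fj j)) with (Aj j).
    - eapply Rle_lt_trans; [apply hzj | exact hz].
    - now rewrite eA1.
    - now rewrite eA2.
    - now rewrite ff.
    - now rewrite ef.
    - intro n. assert (hn := qpow_neq0 hq n).
      apply (pinf_generic_inv hq _ (e / (a * q) * t j) n); [unfold ej; field; auto 6 | exact g1].
    - apply (pinf_generic_inv hq _ (c * d * f / (a * q * (a * q)) * t j) 0);
        [unfold Aj, ej, fj; simpl; field; auto 7 | exact g3].
    - intro n. assert (hn := qpow_neq0 hq n).
      apply (pinf_generic_inv hq _ (f / (a * q) * t j) n); [unfold fj; field; auto 6 | exact g2].
    - apply (pinf_generic_inv hq _ (c * d * e / (a * q * (a * q)) * t j) 0);
        [unfold Aj, ej, fj; simpl; field; auto 7 | exact g4].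
    - apply (pinf_generic hq _ (f * t j) 0); [unfold fj; simpl; ring | exact g5].
    - intro n. assert (hn := qpow_neq0 hq n).
      apply (pinf_generic hq _ (f / a * t j) n); [unfold fj; field; auto | exact g6].
    - apply (pinf_generic_inv hq _ (d * e / (a * q) * t j) 0); [unfold ej; simpl; field; auto 6 | exact g7].
    - apply (pinf_generic hq _ (e / d * t j) 0); [unfold ej; simpl; field; auto | exact g8].
    - apply (pinf_generic hq _ (f * f / (d * e) * t j) 0); [unfold ej, fj; simpl; field; auto | exact g9].
    - apply (pinf_generic_inv hq _ (c * d * e * f / (a * q * (a * q)) * (t j * t j)) 0);
        [unfold Aj, ej, fj; simpl; field; auto 8 | exact g10]. }
  refine (Ccvg_unique _ _ _ _ (Ccvg_ext _ _ _ (fun j => eq_sym (H j)) _)).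
  - ccvg hq; try assumption. apply (Ccvg_Wsum hq) with (Cmod (A * a * q / b)); try assumption.
    + apply Ccvg_const.
    + unfold base_pairs. ccvg hq; assumption.
    + ccvg hq; exact hb.
  - unfold line_const. ccvg hq; try assumption; try (now repeat apply Cmult_neq_0).
    + apply (Ccvg_Wsum hq) with (Cmod (q / b)); try assumption.
      * ccvg hq.
      * unfold line_pairs. ccvg hq; try assumption; now repeat apply Cmult_neq_0.
      * apply Ccvg_const.
      * intros _. apply Rle_refl.
    + apply (Ccvg_Wsum hq) with (Cmod (q / b)); try assumption.
      * ccvg hq.
      * unfold line_pairs. ccvg hq; try assumption; now repeat apply Cmult_neq_0.
      * apply Ccvg_const.
      * intros _. apply Rle_refl.
Qed.

(** * The series of the statement *)

Lemma qpoch_nat (x q : C) (k : nat) : qpoch x q (Z.of_nat k) = poch x q k.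
Proof.
  unfold qpoch, poch. destruct k as [|k]; [reflexivity|].
  change (Cprod (fun i => 1 - x * q ^ i) (Z.to_nat (Z.of_nat (S k))) = Cprod (fun i => 1 - x * q ^ i) (S k)).
  now rewrite Nat2Z.id.
Qed.

(** Under this default value, inversion is involutive and multiplicative without side conditions, so
    a vanishing factor of a lower parameter at negative index makes the term 0. *)
Lemma Cinv_0 : / (RtoC 0) = 0.
Proof. unfold Cinv. simpl. apply injective_projections; simpl; unfold Rdiv; ring. Qed.

Lemma Cinv_invol (x : C) : / / x = x.
Proof.
  destruct (Ceq_dec x 0) as [->|h]; [now rewrite !Cinv_0|].
  field. exact h.
Qed.

Lemma Cinv_mul (x y : C) : / (x * y) = / x * / y.
Proof.
  destruct (Ceq_dec x 0) as [->|h]; [rewrite Cmult_0_l Cinv_0; ring|].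
  destruct (Ceq_dec y 0) as [->|h']; [rewrite Cmult_0_r Cinv_0; ring|].
  field. auto.
Qed.

Lemma Cinv_Cprod (u : nat -> C) (n : nat) : / Cprod (fun i => / u i) n = Cprod u n.
Proof.
  induction n as [|n IH]; simpl; [field; exact C1_nz|].
  now rewrite Cinv_mul IH Cinv_invol.
Qed.

(** Turning over each factor 1 - x q^-i gives (b;q)_-n / (aq/b;q)_-n as a power of aq/b^2 times a
    ratio of ordinary shifted factorials. *)
Lemma qpoch_neg_ratio {q : C} (hq : qnorm q) (a b : C) (m : nat) :
  a <> 0 -> b <> 0 -> (forall n, 1 - b / q ^ S n <> 0) ->
  qpoch b q (- Z.of_nat (S m)) * / qpoch (a * q / b) q (- Z.of_nat (S m)) =
  (a * q / (b * b)) ^ S m * (poch (b / a) q (S m) / poch (q / b) q (S m)).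
Proof.
  intros ha hb h. assert (hq0 := qnorm_neq0 hq).
  assert (e : forall x, qpoch x q (- Z.of_nat (S m)) = Cprod (fun i => / (1 - x / q ^ S i)) (S m)).
  { intro x. simpl Z.of_nat. simpl Z.opp. unfold qpoch. now rewrite SuccNat2Pos.id_succ. }
  rewrite !e Cinv_Cprod. clear e. generalize (S m). intro n.
  assert (h' : forall n, 1 - q / b * q ^ n <> 0).
  { intros k h0. apply (h k). assert (hk := qpow_neq0 hq k).
    replace (1 - b / q ^ S k) with (- (b / q ^ S k) * (1 - q / b * q ^ k)) by (simpl; field; auto).
    rewrite h0. ring. }
  induction n as [|n IH]; [unfold poch; simpl; field; exact C1_nz|].
  rewrite !poch_Sr Cpow_S.
  change (Cprod (fun i => / (1 - b / q ^ S i)) (S n)) with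
    (Cprod (fun i => / (1 - b / q ^ S i)) n * / (1 - b / q ^ S n)).
  change (Cprod (fun i => 1 - a * q / b / q ^ S i) (S n)) with
    (Cprod (fun i => 1 - a * q / b / q ^ S i) n * (1 - a * q / b / q ^ S n)).
  set (X := Cprod (fun i => / (1 - b / q ^ S i)) n) in *.
  set (Y := Cprod (fun i => 1 - a * q / b / q ^ S i) n) in *.
  transitivity (X * Y * (/ (1 - b / q ^ S n) * (1 - a * q / b / q ^ S n))); [ring|].
  rewrite IH. assert (hn := qpow_neq0 hq n).
  assert (h1 := h n). assert (h2 := h' n). assert (h3 := poch_neq0 (q / b) q n h').
  replace (q / b * q ^ n) with (q * q ^ n / b) in * by (field; auto).
  rewrite Cpow_S in h1. rewrite Cpow_S.
  assert (h4 : q * q ^ n - b <> 0).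
  { intro h0. apply h1. replace (1 - b / (q * q ^ n)) with ((q * q ^ n - b) / (q * q ^ n)) by (field; auto).
    rewrite h0. field. auto. }
  assert (h5 : b - q * q ^ n <> 0).
  { intro h0. apply h4. replace (q * q ^ n - b) with (- (b - q * q ^ n)) by ring. rewrite h0. ring. }
  generalize dependent (poch (q / b) q n). intros. field. auto 7.
Qed.

Lemma psi_term_nat (b c d e f b' c' d' e' f' q z : C) (n : nat) :
  psi_term [b; c; d; e; f] [b'; c'; d'; e'; f'] q z (Z.of_nat n) =
  poch b q n / poch b' q n * (poch c q n / poch c' q n) * (poch d q n / poch d' q n) *
  (poch e q n / poch e' q n) * (poch f q n / poch f' q n) * z ^ n.
Proof.
  unfold psi_term, qpochs, Cprod_list. simpl map. simpl fold_right. rewrite !qpoch_nat.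
  replace (Cpowz z (Z.of_nat n)) with (z ^ n).
  - unfold Cdiv. rewrite !Cinv_mul. replace (/ (RtoC 1)) with (RtoC 1) by (field; exact C1_nz). ring.
  - destruct n as [|n]; [reflexivity|].
    change (z ^ S n = z ^ Z.to_nat (Z.of_nat (S n))). now rewrite Nat2Z.id.
Qed.

(** The five ratios contribute powers of aq/b^2, ..., aq/f^2, whose product is aq z^2 for this z;
    against z^-n there remains (aqz)^n. *)
Lemma psi_term_neg {q : C} (hq : qnorm q) (a b c d e f z : C) (m : nat) :
  a <> 0 -> b <> 0 -> c <> 0 -> d <> 0 -> e <> 0 -> f <> 0 ->
  z = a * a * q ^ 2 / (b * c * d * e * f) ->
  (forall u n, In u [b; c; d; e; f] -> 1 - u / q ^ S n <> 0) ->
  psi_term [b; c; d; e; f] [a * q / b; a * q / c; a * q / d; a * q / e; a * q / f] q z (- Z.of_nat (S m)) =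
  poch (b / a) q (S m) / poch (q / b) q (S m) * (poch (c / a) q (S m) / poch (q / c) q (S m)) *
  (poch (d / a) q (S m) / poch (q / d) q (S m)) * (poch (e / a) q (S m) / poch (q / e) q (S m)) *
  (poch (f / a) q (S m) / poch (q / f) q (S m)) * (a * q * z) ^ S m.
Proof.
  intros ha hb hc hd he hf hz h. assert (hq0 := qnorm_neq0 hq).
  assert (r := fun (u : C) (hu : u <> 0) hi => qpoch_neg_ratio hq a u m ha hu (fun n => h u n hi)).
  assert (rb := r b hb ltac:(simpl; auto)). assert (rc := r c hc ltac:(simpl; auto)).
  assert (rd := r d hd ltac:(simpl; auto)). assert (re := r e he ltac:(simpl; auto 6)).
  assert (rf := r f hf ltac:(simpl; auto 7)). clear r.
  assert (hw : Cpowz z (- Z.of_nat (S m)) = (/ z) ^ S m).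
  { simpl Z.of_nat. simpl Z.opp. unfold Cpowz. rewrite SuccNat2Pos.id_succ.
    symmetry. apply Cpow_inv. rewrite hz. apply Cdiv_neq0; repeat apply Cmult_neq_0; auto. exact C1_nz. }
  unfold psi_term, qpochs, Cprod_list. rewrite hw. clear hw. cbn [map fold_right].
  set (N := (- Z.of_nat (S m))%Z) in *. clearbody N.
  unfold Cdiv at 1. rewrite !Cinv_mul.
  assert (E : (/ z) ^ S m = (a * q * z) ^ S m * (/ (a * q / (b * b))) ^ S m * (/ (a * q / (c * c))) ^ S m *
    (/ (a * q / (d * d))) ^ S m * (/ (a * q / (e * e))) ^ S m * (/ (a * q / (f * f))) ^ S m).
  { rewrite -!Cpow_mult_l. f_equal. rewrite hz. field. auto 8. }
  assert (C1 : forall u v t x : C, x <> 0 -> u * / v = x ^ S m * t -> u * / v * (/ x) ^ S m = t).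
  { intros u v t x hx hu. rewrite hu. transitivity ((x * / x) ^ S m * t); [rewrite Cpow_mult_l; ring|].
    rewrite Cinv_r // Cpow_1_l. ring. }
  assert (nz : forall x : C, x <> 0 -> a * q / (x * x) <> 0).
  { intros x hx. apply Cdiv_neq0; now apply Cmult_neq_0. }
  rewrite E. apply C1 in rb; [|now apply nz]. apply C1 in rc; [|now apply nz].
  apply C1 in rd; [|now apply nz]. apply C1 in re; [|now apply nz]. apply C1 in rf; [|now apply nz].
  rewrite -rb -rc -rd -re -rf. replace (/ (RtoC 1)) with (RtoC 1) by (field; exact C1_nz). ring.
Qed.

Lemma CSeries_shift (a : nat -> C) : ex_Cseries a -> a O = 0 -> CSeries a = CSeries (fun k => a (S k)).
Proof.
  intros h h0. rewrite (CSeries_incr_n a 0 h) sum_O h0. apply Cplus_0_l.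
Qed.

Lemma ex_pair_prod {q : C} (hq : qnorm q) (L : list (C * C)) (z : C) :
  (Cmod z < 1)%R -> ex_Cseries (fun n => pair_prod L q n * z ^ n).
Proof.
  intro hz. destruct (pairs_cvg_bound hq _ _ (pairs_cvg_const L)) as [K hK].
  apply ex_Cseries_le with (fun n => K * Cmod z ^ n)%R.
  - intro n. apply Cmod_mul_le; [apply (hK O)|]. rewrite Cmod_pow. apply Rle_refl.
  - apply ex_series_mul_geom. split; [apply Cmod_ge_0 | exact hz].
Qed.

Definition pair_norm (L : list (C * C)) (q : C) : C :=
  fold_right (fun p acc => qpoch_inf (snd p) q * acc) 1 L.

Lemma poch_ratio {q : C} (hq : qnorm q) (x y : C) (n : nat) : qpoch_inf y q <> 0 ->
  poch x q n / poch y q n = poch x q n * qpoch_inf (y * q ^ n) q / qpoch_inf y q.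
Proof.
  intro h. rewrite (pinf_poch hq y n) in h |- *. field.
  split; intro h0; apply h; rewrite h0; ring.
Qed.

Lemma psi_term_pairs {q : C} (hq : qnorm q) (b c d e f b' c' d' e' f' : C) (n : nat) :
  qpoch_inf b' q <> 0 -> qpoch_inf c' q <> 0 -> qpoch_inf d' q <> 0 ->
  qpoch_inf e' q <> 0 -> qpoch_inf f' q <> 0 ->
  poch b q n / poch b' q n * (poch c q n / poch c' q n) * (poch d q n / poch d' q n) *
  (poch e q n / poch e' q n) * (poch f q n / poch f' q n) =
  / pair_norm [(b, b'); (c, c'); (d, d'); (e, e'); (f, f')] q *
    pair_prod [(b, b'); (c, c'); (d, d'); (e, e'); (f, f')] q n.
Proof.
  intros. rewrite !(poch_ratio hq) //. simpl. field. auto 8.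
Qed.

Lemma psi_defined_pinf {q : C} (hq : qnorm q) us ls (l : C) :
  psi_defined us ls q -> In l ls -> qpoch_inf l q <> 0.
Proof. intros [h _] hl. apply (pinf_neq0 hq). intro i. now apply h. Qed.

Lemma psi_term_base {q : C} (hq : qnorm q) (a b c d e f z : C) (n : nat) :
  psi_defined [b; c; d; e; f] [a * q / b; a * q / c; a * q / d; a * q / e; a * q / f] q ->
  psi_term [b; c; d; e; f] [a * q / b; a * q / c; a * q / d; a * q / e; a * q / f] q z (Z.of_nat n) =
  / pair_norm (base_pairs a b c d e f q) q * (pair_prod (base_pairs a b c d e f q) q n * z ^ n).
Proof.
  intro h. assert (n0 := fun l => psi_defined_pinf hq _ _ l h).
  rewrite psi_term_nat (psi_term_pairs hq b c d e f); [unfold base_pairs; ring|..]; apply n0; simpl; auto 6.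
Qed.

Lemma psi_sum {q : C} (us ls : list C) (z N : C) (u v : nat -> C) :
  (forall n, psi_term us ls q z (Z.of_nat n) = N * u n) ->
  (forall n, psi_term us ls q z (- Z.of_nat (S n)) = N * v n) ->
  ex_Cseries u -> ex_Cseries v ->
  psi_cvg us ls q z /\ psi us ls q z = N * (CSeries u + CSeries v).
Proof.
  intros hu hv xu xv. split; [split|].
  - eapply (ex_series_ext (V := C_NormedModule)); [intro n; symmetry; apply hu | now apply ex_Cseries_scal].
  - eapply (ex_series_ext (V := C_NormedModule)); [intro n; symmetry; apply hv | now apply ex_Cseries_scal].
  - unfold psi. rewrite (CSeries_ext _ _ hu) (CSeries_ext _ _ hv) !CSeries_scal //. ring.
Qed.

(** The term at -n is q^n times the term at n, and 1 + q^n is [vwp 1 q n] for n > 0. *)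
Lemma psi_fold_even {q : C} (hq : qnorm q) (b c d e f : C) :
  b <> 0 -> c <> 0 -> d <> 0 -> e <> 0 -> f <> 0 ->
  let us := [b; c; d; e; f] in
  let ls := [1 * q / b; 1 * q / c; 1 * q / d; 1 * q / e; 1 * q / f] in
  let z := 1 * 1 * q ^ 2 / (b * c * d * e * f) in
  (Cmod z < 1)%R -> psi_defined us ls q ->
  psi_cvg us ls q z /\
  psi us ls q z =
  / pair_norm (base_pairs 1 b c d e f q) q * Wsum 1 (base_pairs 1 b c d e f q) q z.
Proof.
  intros hb hc hd he hf us ls z hz h. assert (hq0 := qnorm_neq0 hq).
  set (L := base_pairs 1 b c d e f q).
  assert (xu := ex_pair_prod hq L z hz).
  assert (hz' : (Cmod (q * z) < 1)%R).
  { rewrite Cmod_mult. assert (h0 := Cmod_ge_0 z). destruct hq. nra. }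
  (* Padding with 0 at index 0 aligns the terms at -n with those at n, while the term at 0 is
     counted once. *)
  set (v0 := fun n : nat => match n with O => RtoC 0 | S _ => pair_prod L q n * (q * z) ^ n end).
  assert (xv0 : ex_Cseries v0).
  { apply (ex_series_incr_1 (V := C_NormedModule)).
    exact (proj1 (ex_series_incr_1 (V := C_NormedModule) _) (ex_pair_prod hq L (q * z) hz')). }
  assert (xv := proj1 (ex_series_incr_1 (V := C_NormedModule) _) xv0).
  destruct (@psi_sum q us ls z (/ pair_norm L q) (fun n => pair_prod L q n * z ^ n) (fun n => v0 (S n))) as [p1 p2].
  - intro n. now apply (psi_term_base hq).
  - intro m.
    assert (n0' : forall x, In (1 * q / x) ls -> qpoch_inf (q / x) q <> 0).
    { intros x hx. rewrite -{1}(Cmult_1_l q). exact (psi_defined_pinf hq _ _ _ h hx). }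
    unfold us, ls. rewrite (psi_term_neg hq 1 b c d e f z m C1_nz hb hc hd he hf eq_refl (fun u n hu => proj2 h u n hu)).
    replace (1 * q * z) with (q * z) by ring.
    rewrite (psi_term_pairs hq (b / 1) (c / 1) (d / 1) (e / 1) (f / 1)).
    + unfold v0, L, base_pairs. rewrite !Cmult_1_l.
      assert (d1 : forall x : C, x / 1 = x) by (intro; field; exact C1_nz).
      rewrite !d1. unfold pair_norm. simpl. ring.
    + apply n0'; simpl; auto.
    + apply n0'; simpl; auto.
    + apply n0'; simpl; auto.
    + apply n0'; simpl; auto 6.
    + apply n0'; simpl; auto 7.
  - exact xu.
  - exact xv.
  - split; [exact p1|]. rewrite p2. f_equal.
    rewrite -(CSeries_shift v0 xv0 eq_refl) -CSeries_plus //.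
    apply CSeries_ext. intros [|m]; unfold Wterm, vwp, v0.
    + simpl. ring.
    + rewrite poch_Sr. assert (hp := poch_q_neq0 hq (S m)). rewrite poch_Sr in hp.
      replace (1 * q) with q by ring. rewrite Cpow_mult_l.
      replace (q ^ (2 * S m)) with (q ^ S m * q ^ S m) by (rewrite -Cpow_add_r; f_equal; lia).
      replace (q * q ^ m) with (q ^ S m) in * by reflexivity.
      generalize dependent (q ^ S m). intros Q hp.
      field. split; intro h0; apply hp; rewrite h0; ring.
Qed.

(** The term at -1-n is -q^(2n+1) times the term at n, and 1 - q^(2n+1) = (1 - q) [vwp q q n]. *)
Lemma psi_fold_odd {q : C} (hq : qnorm q) (b c d e f : C) :
  b <> 0 -> c <> 0 -> d <> 0 -> e <> 0 -> f <> 0 ->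
  let us := [b; c; d; e; f] in
  let ls := [q * q / b; q * q / c; q * q / d; q * q / e; q * q / f] in
  let z := q * q * q ^ 2 / (b * c * d * e * f) in
  (Cmod z < 1)%R -> psi_defined us ls q ->
  psi_cvg us ls q z /\
  psi us ls q z =
  / pair_norm (base_pairs q b c d e f q) q * ((1 - q) * Wsum q (base_pairs q b c d e f q) q z).
Proof.
  intros hb hc hd he hf us ls z hz h. assert (hq0 := qnorm_neq0 hq).
  set (L := base_pairs q b c d e f q).
  assert (xu := ex_pair_prod hq L z hz).
  assert (hz' : (Cmod (q ^ 2 * z) < 1)%R).
  { rewrite Cmod_mult Cmod_pow. assert (h0 := Cmod_ge_0 z). destruct hq. nra. }
  assert (xv := ex_Cseries_scal (- q) _ (ex_pair_prod hq L (q ^ 2 * z) hz')). cbv beta in xv.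
  destruct (@psi_sum q us ls z (/ pair_norm L q) (fun n => pair_prod L q n * z ^ n)
    (fun n => - q * (pair_prod L q n * (q ^ 2 * z) ^ n))) as [p1 p2].
  - intro n. now apply (psi_term_base hq).
  - intro m. assert (n0 := fun l => psi_defined_pinf hq _ _ l h).
    unfold us, ls. rewrite (psi_term_neg hq q b c d e f z m hq0 hb hc hd he hf eq_refl (fun u n hu => proj2 h u n hu)).
    (* The leading factors give (1 - x/q)/(1 - q/x) = -x/q; the five of them times one power of q^2
       z multiply to -q. *)
    assert (r : forall x : C, x <> 0 -> In x us ->
      poch (x / q) q (S m) / poch (q / x) q (S m) = - (x / q) * (poch x q m / poch (q * q / x) q m)).
    { intros x hx hin. rewrite !poch_Sl.
      replace (x / q * q) with x by (field; auto). replace (q / x * q) with (q * q / x) by (field; auto).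
      assert (h1 : qpoch_inf (q * q / x) q <> 0).
      { apply n0. unfold us in hin. simpl in hin |- *. intuition (subst; auto 7). }
      assert (h2 := poch_neq0_pinf hq _ m h1).
      assert (h3 : 1 - x / q <> 0).
      { assert (h3 := proj2 h x 0%nat hin). now rewrite Cpow_1_r in h3. }
      assert (h4 : q - x <> 0).
      { intro h0. apply h3. replace (1 - x / q) with ((q - x) / q) by (field; auto). rewrite h0. field. auto. }
      assert (h5 : x - q <> 0).
      { intro h0. apply h4. replace (q - x) with (- (x - q)) by ring. rewrite h0. ring. }
      generalize dependent (poch (q * q / x) q m). intros. field. auto. }
    rewrite !r; try assumption; try (unfold us; simpl; auto 7; fail).
    transitivity (- (b / q) * - (c / q) * - (d / q) * - (e / q) * - (f / q) * (q * q * z) ^ S m *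
      (poch b q m / poch (q * q / b) q m * (poch c q m / poch (q * q / c) q m) *
       (poch d q m / poch (q * q / d) q m) * (poch e q m / poch (q * q / e) q m) *
       (poch f q m / poch (q * q / f) q m))); [ring|].
    rewrite (psi_term_pairs hq b c d e f).
    + unfold L, base_pairs. rewrite Cpow_S.
      replace (q ^ 2 * z) with (q * q * z) by (simpl; ring).
      set (w := (q * q * z) ^ m).
      match goal with |- ?x * (?y * w) * (?n * ?p) = _ =>
        transitivity (x * y * (w * n * p)); [ring|]; replace (x * y) with (- q) end; [ring|].
      unfold z. field. auto 6.
    + apply n0; simpl; auto.
    + apply n0; simpl; auto.
    + apply n0; simpl; auto.
    + apply n0; simpl; auto 6.
    + apply n0; simpl; auto 7.
  - exact xu.
  - exact xv.
  - split; [exact p1|]. rewrite p2. f_equal.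
    unfold Wsum. rewrite -CSeries_plus // -CSeries_scal; [|now apply (ex_Wsum hq)].
    apply CSeries_ext. intro n.
    assert (hv : (1 - q) * vwp q q n = 1 - q * (q ^ 2) ^ n).
    { destruct n as [|m]; [unfold vwp; simpl; ring|].
      unfold vwp. rewrite (poch_Sl q). assert (hp := poch_q_neq0 hq (S m)). rewrite poch_Sl in hp.
      rewrite -Cpow_mult_r. field.
      split; intro h0; apply hp; rewrite h0; ring. }
    unfold Wterm. rewrite Cpow_mult_l.
    transitivity ((1 - q) * vwp q q n * (pair_prod L q n * z ^ n)); [rewrite hv; ring | ring].
Qed.

(** * From the [W87] series to the cleared series, and the relation for general a *)

Lemma qpochs_poch (xs : list C) (q : C) (k : nat) :
  qpochs xs q (Z.of_nat k) = fold_right (fun x acc => poch x q k * acc) 1 xs.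
Proof.
  unfold qpochs, Cprod_list. induction xs as [|x xs IH]; [reflexivity|].
  simpl. now rewrite qpoch_nat IH.
Qed.

Lemma W87_Wsum {q : C} (hq : qnorm q) (al b1 b2 b3 b4 b5 z : C) :
  (Cmod z < 1)%R -> W87_defined al b1 b2 b3 b4 b5 q ->
  let L := [(b1, al * q / b1); (b2, al * q / b2); (b3, al * q / b3); (b4, al * q / b4); (b5, al * q / b5)] in
  W87_cvg al b1 b2 b3 b4 b5 q z /\ pair_norm L q <> 0 /\
  pair_norm L q * W87 al b1 b2 b3 b4 b5 q z = Wsum al L q z.
Proof.
  intros hz [h1 h2] L.
  (* If 1 - x q^i were 0 for a lower parameter x, the denominator at index i + 1 would vanish; [r]
     stands for its remaining factors. *)
  assert (n0 : forall x : C, (exists r, forall k, qpochs [q; al * q / b1; al * q / b2; al * q / b3; al * q / b4; al * q / b5]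
      q (Z.of_nat k) = poch x q k * r k) -> qpoch_inf x q <> 0).
  { intros x [r hr]. apply (pinf_neq0 hq). intros i h0. apply (h2 (S i)). rewrite hr poch_Sr h0. ring. }
  assert (m1 : qpoch_inf (al * q / b1) q <> 0).
  { apply n0. eexists. intro k. rewrite qpochs_poch. cbn [fold_right].
    match goal with |- ?a * (?b * ?c) = _ => transitivity (b * (a * c)); [ring|reflexivity] end. }
  assert (m2 : qpoch_inf (al * q / b2) q <> 0).
  { apply n0. eexists. intro k. rewrite qpochs_poch. cbn [fold_right].
    match goal with |- ?a * (?a2 * (?b * ?c)) = _ => transitivity (b * (a * a2 * c)); [ring|reflexivity] end. }
  assert (m3 : qpoch_inf (al * q / b3) q <> 0).
  { apply n0. eexists. intro k. rewrite qpochs_poch. cbn [fold_right].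
    match goal with |- ?a * (?a2 * (?a3 * (?b * ?c))) = _ => transitivity (b * (a * a2 * a3 * c)); [ring|reflexivity] end. }
  assert (m4 : qpoch_inf (al * q / b4) q <> 0).
  { apply n0. eexists. intro k. rewrite qpochs_poch. cbn [fold_right].
    match goal with |- ?a * (?a2 * (?a3 * (?a4 * (?b * ?c)))) = _ =>
      transitivity (b * (a * a2 * a3 * a4 * c)); [ring|reflexivity] end. }
  assert (m5 : qpoch_inf (al * q / b5) q <> 0).
  { apply n0. eexists. intro k. rewrite qpochs_poch. cbn [fold_right].
    match goal with |- ?a * (?a2 * (?a3 * (?a4 * (?a5 * (?b * ?c))))) = _ =>
      transitivity (b * (a * a2 * a3 * a4 * a5 * c)); [ring|reflexivity] end. }
  assert (hN : pair_norm L q <> 0).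
  { unfold pair_norm, L. simpl. repeat (apply Cmult_neq_0; [assumption|]). exact C1_nz. }
  assert (e : forall n, Wterm al L q z n = pair_norm L q * W87_term al b1 b2 b3 b4 b5 q z n).
  { intro n. unfold Wterm, W87_term. rewrite !qpochs_poch -(vwp_eq hq al n h1).
    cbn [fold_right]. unfold L, pair_prod, pair_norm. cbn [fold_right fst snd].
    rewrite (pinf_poch hq (al * q / b1) n) (pinf_poch hq (al * q / b2) n) (pinf_poch hq (al * q / b3) n)
      (pinf_poch hq (al * q / b4) n) (pinf_poch hq (al * q / b5) n).
    assert (k1 := poch_neq0_pinf hq _ n m1). assert (k2 := poch_neq0_pinf hq _ n m2).
    assert (k3 := poch_neq0_pinf hq _ n m3). assert (k4 := poch_neq0_pinf hq _ n m4).
    assert (k5 := poch_neq0_pinf hq _ n m5). assert (k0 := poch_q_neq0 hq n).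
    generalize dependent (poch (al * q / b1) q n). generalize dependent (poch (al * q / b2) q n).
    generalize dependent (poch (al * q / b3) q n). generalize dependent (poch (al * q / b4) q n).
    generalize dependent (poch (al * q / b5) q n). generalize dependent (poch q q n).
    generalize (qpoch_inf (al * q / b1 * q ^ n) q) (qpoch_inf (al * q / b2 * q ^ n) q)
      (qpoch_inf (al * q / b3 * q ^ n) q) (qpoch_inf (al * q / b4 * q ^ n) q) (qpoch_inf (al * q / b5 * q ^ n) q).
    intros. field. auto 8. }
  assert (x : W87_cvg al b1 b2 b3 b4 b5 q z).
  { unfold W87_cvg. apply (ex_series_ext (V := C_NormedModule) (fun n => / pair_norm L q * Wterm al L q z n)).
    - intro n. rewrite e Cmult_assoc Cinv_l // Cmult_1_l. reflexivity.
    - apply ex_Cseries_scal. now apply (ex_Wsum hq). }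
  split; [exact x|]. split; [exact hN|].
  unfold W87, Wsum. rewrite -CSeries_scal //. apply CSeries_ext. intro n. now rewrite e.
Qed.

Lemma qpochs_inf_neq0 (xs : list C) (q : C) :
  qpochs_inf xs q <> 0 -> forall x, In x xs -> qpoch_inf x q <> 0.
Proof.
  unfold qpochs_inf, Cprod_list. induction xs as [|y xs IH]; [intros _ x []|].
  cbn [map fold_right]. intros h x [->|hx] h0.
  - apply h. rewrite h0. ring.
  - apply (IH (fun h1 => h (eq_trans (f_equal _ h1) (Cmult_0_r _))) x hx h0).
Qed.

(** [three_term] with the clearing products divided out again, in the shape that the theorem takes
    at a = 1 and a = q. *)
Lemma vwp_transformation {q : C} (hq : qnorm q) (a b c d e f : C) :
  a <> 0 -> b <> 0 -> c <> 0 -> d <> 0 -> e <> 0 -> f <> 0 ->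
  (Cmod (q / b) < 1)%R -> (Cmod (a * a * q ^ 2 / (b * c * d * e * f)) < 1)%R ->
  qpochs_inf
    [a * q / b; q / c; a * q / c; q / d; a * q / d; a * q / e; f / e; e * f / a;
     e * (a * q ^ 2) / (c * d * f); a * a * q ^ 2 / (b * c * d * e * f)] q <> 0 ->
  qpochs_inf
    [a * q / b; q / c; a * q / c; q / d; a * q / d; a * q / f; e / f; e * f / a;
     f * (a * q ^ 2) / (c * d * e); a * a * q ^ 2 / (b * c * d * e * f)] q <> 0 ->
  W87_defined (e * (a * q) / (c * d * f)) e (b * e / a) (a * q / (c * d)) (a * q / (c * f)) (a * q / (d * f)) q ->
  W87_defined (f * (a * q) / (c * d * e)) f (b * f / a) (a * q / (c * d)) (a * q / (c * e)) (a * q / (d * e)) q ->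
  W87_cvg (e * (a * q) / (c * d * f)) e (b * e / a) (a * q / (c * d)) (a * q / (c * f)) (a * q / (d * f)) q (q / b) /\
  W87_cvg (f * (a * q) / (c * d * e)) f (b * f / a) (a * q / (c * d)) (a * q / (c * e)) (a * q / (d * e)) q (q / b) /\
  / pair_norm (base_pairs a b c d e f q) q *
    Wsum a (base_pairs a b c d e f q) q (a * a * q ^ 2 / (b * c * d * e * f)) =
  qpochs_inf
    [a * q; a * q / (b * e); a * q / (c * e); a * q / (d * e); e * q / c; e * q / d;
     f; f / a; a * q ^ 2 / (c * d * f); a * a * q ^ 2 / (b * c * d * f)] q /
  qpochs_inf
    [a * q / b; q / c; a * q / c; q / d; a * q / d; a * q / e; f / e; e * f / a;
     e * (a * q ^ 2) / (c * d * f); a * a * q ^ 2 / (b * c * d * e * f)] q *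
  W87 (e * (a * q) / (c * d * f)) e (b * e / a) (a * q / (c * d)) (a * q / (c * f)) (a * q / (d * f)) q (q / b) +
  qpochs_inf
    [a * q; a * q / (b * f); a * q / (c * f); a * q / (d * f); f * q / c; f * q / d;
     e; e / a; a * q ^ 2 / (c * d * e); a * a * q ^ 2 / (b * c * d * e)] q /
  qpochs_inf
    [a * q / b; q / c; a * q / c; q / d; a * q / d; a * q / f; e / f; e * f / a;
     f * (a * q ^ 2) / (c * d * e); a * a * q ^ 2 / (b * c * d * e * f)] q *
  W87 (f * (a * q) / (c * d * e)) f (b * f / a) (a * q / (c * d)) (a * q / (c * e)) (a * q / (d * e)) q (q / b).
Proof.
  intros ha hb hc hd he hf ht hz D1 D2 w1 w2. assert (hq0 := qnorm_neq0 hq).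
  set (A := a * q / (c * d * e * f)).
  assert (v1 := qpochs_inf_neq0 _ _ D1). assert (v2 := qpochs_inf_neq0 _ _ D2).
  destruct (W87_Wsum hq _ _ _ _ _ _ (q / b) ht w1) as [x1 [k1 s1]].
  destruct (W87_Wsum hq _ _ _ _ _ _ (q / b) ht w2) as [x2 [k2 s2]].
  split; [exact x1|]. split; [exact x2|].
  destruct w1 as [w1 _]. destruct w2 as [w2 _].
  assert (ea1 : e * (a * q) / (c * d * f) = A * e * e) by (unfold A; field; auto).
  assert (ea2 : f * (a * q) / (c * d * e) = A * f * f) by (unfold A; field; auto).
  assert (lp1 : [(e, A * e * e * q / e); (b * e / a, A * e * e * q / (b * e / a));
      (a * q / (c * d), A * e * e * q / (a * q / (c * d)));
      (a * q / (c * f), A * e * e * q / (a * q / (c * f)));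
      (a * q / (d * f), A * e * e * q / (a * q / (d * f)))] = line_pairs A a b c d e f q).
  { unfold line_pairs.
    replace (A * e * e * q / e) with (A * e * q) by (field; auto).
    replace (A * e * e * q / (b * e / a)) with (A * a * e * q / b) by (field; auto).
    replace (A * e * e * q / (a * q / (c * d))) with (q * e / f) by (unfold A; field; auto 8).
    replace (A * e * e * q / (a * q / (c * f))) with (q * e / d) by (unfold A; field; auto 8).
    replace (A * e * e * q / (a * q / (d * f))) with (q * e / c) by (unfold A; field; auto 8).
    reflexivity. }
  assert (lp2 : [(f, A * f * f * q / f); (b * f / a, A * f * f * q / (b * f / a));
      (a * q / (c * d), A * f * f * q / (a * q / (c * d)));
      (a * q / (c * e), A * f * f * q / (a * q / (c * e)));
      (a * q / (d * e), A * f * f * q / (a * q / (d * e)))] = line_pairs A a b c d f e q).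
  { unfold line_pairs.
    replace (A * f * f * q / f) with (A * f * q) by (field; auto).
    replace (A * f * f * q / (b * f / a)) with (A * a * f * q / b) by (field; auto).
    replace (A * f * f * q / (a * q / (c * d))) with (q * f / e) by (unfold A; field; auto 8).
    replace (A * f * f * q / (a * q / (c * e))) with (q * f / d) by (unfold A; field; auto 8).
    replace (A * f * f * q / (a * q / (d * e))) with (q * f / c) by (unfold A; field; auto 8).
    reflexivity. }
  rewrite ea1 lp1 in k1 s1. rewrite ea2 lp2 in k2 s2. rewrite ea1 in w1. rewrite ea2 in w2. rewrite ea1 ea2.
  generalize dependent (W87 (A * e * e) e (b * e / a) (a * q / (c * d)) (a * q / (c * f)) (a * q / (d * f)) q (q / b)).
  generalize dependent (W87 (A * f * f) f (b * f / a) (a * q / (c * d)) (a * q / (c * e)) (a * q / (d * e)) q (q / b)).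
  intros W2 s2 W1 s1.
  replace (a * a * q ^ 2 / (b * c * d * e * f)) with (A * a * q / b) in * by (unfold A; simpl; field; auto 8).
  replace (e * (a * q ^ 2) / (c * d * f)) with (A * e * e * q) in * by (unfold A; simpl; field; auto 8).
  replace (f * (a * q ^ 2) / (c * d * e)) with (A * f * f * q) in * by (unfold A; simpl; field; auto 8).
  replace (a * q ^ 2 / (c * d * f)) with (A * e * q) by (unfold A; simpl; field; auto 8).
  replace (a * q ^ 2 / (c * d * e)) with (A * f * q) by (unfold A; simpl; field; auto 8).
  replace (a * a * q ^ 2 / (b * c * d * f)) with (A * a * e * q / b) by (unfold A; simpl; field; auto 8).
  replace (a * a * q ^ 2 / (b * c * d * e)) with (A * a * f * q / b) by (unfold A; simpl; field; auto 8).
  assert (n1 : qpoch_inf (a * q / b) q <> 0) by (apply v1; simpl; tauto).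
  assert (n2 : qpoch_inf (q / c) q <> 0) by (apply v1; simpl; tauto).
  assert (n3 : qpoch_inf (a * q / c) q <> 0) by (apply v1; simpl; tauto).
  assert (n4 : qpoch_inf (q / d) q <> 0) by (apply v1; simpl; tauto).
  assert (n5 : qpoch_inf (a * q / d) q <> 0) by (apply v1; simpl; tauto).
  assert (n6 : qpoch_inf (a * q / e) q <> 0) by (apply v1; simpl; tauto).
  assert (n7 : qpoch_inf (f / e) q <> 0) by (apply v1; simpl; tauto).
  assert (n8 : qpoch_inf (e * f / a) q <> 0) by (apply v1; simpl; tauto).
  assert (n9 : qpoch_inf (A * e * e * q) q <> 0) by (apply v1; simpl; tauto).
  assert (n10 : qpoch_inf (A * a * q / b) q <> 0) by (apply v1; simpl; tauto).
  assert (n11 : qpoch_inf (a * q / f) q <> 0) by (apply v2; simpl; tauto).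
  assert (n12 : qpoch_inf (e / f) q <> 0) by (apply v2; simpl; tauto).
  assert (n13 : qpoch_inf (A * f * f * q) q <> 0) by (apply v2; simpl; tauto).
  assert (T := three_term hq a b c d e f ha hb hc hd he hf). cbv zeta in T. fold A in T.
  specialize (T ht hz).
  (* The products listed in the denominators start at A e^2 q; the missing factor 1 - A e^2 is
     nonzero because the [W87] series is defined. The same holds for f. *)
  rewrite (pinf_S hq (A * e * e)) (pinf_S hq (A * f * f)) in T.
  specialize (T (Cmult_neq_0 _ _ w1 n9) (Cmult_neq_0 _ _ w2 n13) n7 n12).
  rewrite -s1 -s2 in T. clear s1 s2.
  unfold line_const in T.
  unfold pair_norm, line_pairs in T, k1, k2. cbn [fold_right fst snd] in T, k1, k2.
  unfold qpochs_inf, Cprod_list, pair_norm, base_pairs at 1. cbn [map fold_right fst snd].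
  replace (q * e / c) with (e * q / c) in * by (field; auto).
  replace (q * e / d) with (e * q / d) in * by (field; auto).
  replace (q * f / c) with (f * q / c) in * by (field; auto).
  replace (q * f / d) with (f * q / d) in * by (field; auto).
  clear D1 D2 v1 v2 lp1 lp2 ea1 ea2 x1 x2 w1 w2.
  set (S := Wsum a (base_pairs a b c d e f q) q (A * a * q / b)) in *. clearbody S.
  assert (hm : qpoch_inf (q / c) q * qpoch_inf (q / d) q * qpoch_inf (e * f / a) q * qpoch_inf (A * a * q / b) q <> 0).
  { repeat apply Cmult_neq_0; assumption. }
  apply (Cmult_cancel_l _ _ _ hm).
  match goal with |- ?m * (?n * S) = _ => transitivity (n * (m * S)); [ring|] end.
  rewrite T.
  (* This product divides [line_const] but is absent from the stated denominators; it is one of the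
     lower parameters of the [W87] series. *)
  assert (k3 : qpoch_inf (q * e / f) q <> 0) by (intro h; apply k1; rewrite h; ring).
  assert (k4 : qpoch_inf (q * f / e) q <> 0) by (intro h; apply k2; rewrite h; ring).
  clear T k1 k2 hm ht hz.
  (* With every infinite product made a variable, only a cancellation of fractions is left. *)
  repeat match goal with |- context [qpoch_inf ?x q] => generalize dependent (qpoch_inf x q) end.
  clearbody A. intros. field. auto 20.
Qed.

Theorem theorem7 (q b c d e f : C)
  (hq : (0 < Cmod q < 1)%R)
  (hb : b <> 0) (hc : c <> 0) (hd : d <> 0) (he : e <> 0) (hf : f <> 0) :
  ((Rmax (Cmod (q / b)) (Cmod (q^2 / (b * c * d * e * f))) < 1)%R ->
   psi_defined [b; c; d; e; f] [q / b; q / c; q / d; q / e; q / f] q ->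
   qpochs_inf
      [q / b; q / c; q / c; q / d; q / d; q / e; f / e; e * f;
       e * q^2 / (c * d * f); q^2 / (b * c * d * e * f)] q <> 0 ->
   qpochs_inf
      [q / b; q / c; q / c; q / d; q / d; q / f; e / f; e * f;
       f * q^2 / (c * d * e); q^2 / (b * c * d * e * f)] q <> 0 ->
   W87_defined (e * q / (c * d * f)) e (b * e) (q / (c * d)) (q / (c * f)) (q / (d * f)) q ->
   W87_defined (f * q / (c * d * e)) f (b * f) (q / (c * d)) (q / (c * e)) (q / (d * e)) q ->
   psi_cvg [b; c; d; e; f] [q / b; q / c; q / d; q / e; q / f] q (q^2 / (b * c * d * e * f)) /\
   W87_cvg (e * q / (c * d * f)) e (b * e) (q / (c * d)) (q / (c * f)) (q / (d * f)) q (q / b) /\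
   W87_cvg (f * q / (c * d * e)) f (b * f) (q / (c * d)) (q / (c * e)) (q / (d * e)) q (q / b) /\
   psi [b; c; d; e; f] [q / b; q / c; q / d; q / e; q / f] q (q^2 / (b * c * d * e * f)) =
   qpochs_inf
      [q; q / (b * e); q / (c * e); q / (d * e); e * q / c; e * q / d;
       f; f; q^2 / (c * d * f); q^2 / (b * c * d * f)] q /
   qpochs_inf
      [q / b; q / c; q / c; q / d; q / d; q / e; f / e; e * f;
       e * q^2 / (c * d * f); q^2 / (b * c * d * e * f)] q *
   W87 (e * q / (c * d * f)) e (b * e) (q / (c * d)) (q / (c * f)) (q / (d * f)) q (q / b)
   +
   qpochs_inf
      [q; q / (b * f); q / (c * f); q / (d * f); f * q / c; f * q / d;
       e; e; q^2 / (c * d * e); q^2 / (b * c * d * e)] q /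
   qpochs_inf
      [q / b; q / c; q / c; q / d; q / d; q / f; e / f; e * f;
       f * q^2 / (c * d * e); q^2 / (b * c * d * e * f)] q *
   W87 (f * q / (c * d * e)) f (b * f) (q / (c * d)) (q / (c * e)) (q / (d * e)) q (q / b))
  /\
  ((Rmax (Cmod (q / b)) (Cmod (q^4 / (b * c * d * e * f))) < 1)%R ->
   psi_defined [b; c; d; e; f] [q^2 / b; q^2 / c; q^2 / d; q^2 / e; q^2 / f] q ->
   qpochs_inf
      [q^2 / b; q / c; q^2 / c; q / d; q^2 / d; q^2 / e; f / e; e * f / q;
       e * q^3 / (c * d * f); q^4 / (b * c * d * e * f)] q <> 0 ->
   qpochs_inf
      [q^2 / b; q / c; q^2 / c; q / d; q^2 / d; q^2 / f; e / f; e * f / q;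
       f * q^3 / (c * d * e); q^4 / (b * c * d * e * f)] q <> 0 ->
   W87_defined (e * q^2 / (c * d * f)) e (b * e / q) (q^2 / (c * d)) (q^2 / (c * f)) (q^2 / (d * f)) q ->
   W87_defined (f * q^2 / (c * d * e)) f (b * f / q) (q^2 / (c * d)) (q^2 / (c * e)) (q^2 / (d * e)) q ->
   psi_cvg [b; c; d; e; f] [q^2 / b; q^2 / c; q^2 / d; q^2 / e; q^2 / f] q (q^4 / (b * c * d * e * f)) /\
   W87_cvg (e * q^2 / (c * d * f)) e (b * e / q) (q^2 / (c * d)) (q^2 / (c * f)) (q^2 / (d * f)) q (q / b) /\
   W87_cvg (f * q^2 / (c * d * e)) f (b * f / q) (q^2 / (c * d)) (q^2 / (c * e)) (q^2 / (d * e)) q (q / b) /\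
   psi [b; c; d; e; f] [q^2 / b; q^2 / c; q^2 / d; q^2 / e; q^2 / f] q (q^4 / (b * c * d * e * f)) =
   qpochs_inf
      [q; q^2 / (b * e); q^2 / (c * e); q^2 / (d * e); e * q / c; e * q / d;
       f; f / q; q^3 / (c * d * f); q^4 / (b * c * d * f)] q /
   qpochs_inf
      [q^2 / b; q / c; q^2 / c; q / d; q^2 / d; q^2 / e; f / e; e * f / q;
       e * q^3 / (c * d * f); q^4 / (b * c * d * e * f)] q *
   W87 (e * q^2 / (c * d * f)) e (b * e / q) (q^2 / (c * d)) (q^2 / (c * f)) (q^2 / (d * f)) q (q / b)
   +
   qpochs_inf
      [q; q^2 / (b * f); q^2 / (c * f); q^2 / (d * f); f * q / c; f * q / d;
       e; e / q; q^3 / (c * d * e); q^4 / (b * c * d * e)] q /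
   qpochs_inf
      [q^2 / b; q / c; q^2 / c; q / d; q^2 / d; q^2 / f; e / f; e * f / q;
       f * q^3 / (c * d * e); q^4 / (b * c * d * e * f)] q *
   W87 (f * q^2 / (c * d * e)) f (b * f / q) (q^2 / (c * d)) (q^2 / (c * e)) (q^2 / (d * e)) q (q / b)).

Proof.
  assert (hq0 := qnorm_neq0 hq).
  assert (d1 : forall x : C, x / 1 = x) by (intro; field; exact C1_nz).
  split; intros hmax hp D1 D2 w1 w2; apply Rmax_Rlt in hmax; destruct hmax as [ht hz].
  - assert (P := psi_fold_even hq b c d e f hb hc hd he hf).
    assert (M := vwp_transformation hq 1 b c d e f C1_nz hb hc hd he hf).
    cbv zeta in P. rewrite !Cmult_1_l in P. rewrite !Cmult_1_l !d1 in M.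
    destruct (P hz hp) as [p1 p2]. clear P.
    destruct (M ht hz D1 D2 w1 w2) as [x1 [x2 m]].
    repeat split; try assumption; try apply p1. now rewrite p2.
  - assert (P := psi_fold_odd hq b c d e f hb hc hd he hf).
    assert (M := vwp_transformation hq q b c d e f hq0 hb hc hd he hf).
    cbv zeta in P.
    assert (q4 : q * q * q ^ 2 = q ^ 4) by (simpl; ring).
    assert (q3 : q * q ^ 2 = q ^ 3) by (simpl; ring).
    assert (q2 : q * q = q ^ 2) by (simpl; ring).
    rewrite !q4 !q2 in P. rewrite !q4 !q3 !q2 in M.
    destruct (P hz hp) as [p1 p2]. clear P.
    destruct (M ht hz D1 D2 w1 w2) as [x1 [x2 m]].
    repeat split; try assumption; try apply p1.
    rewrite p2.
    transitivity ((1 - q) * (/ pair_norm (base_pairs q b c d e f q) q *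
      Wsum q (base_pairs q b c d e f q) q (q ^ 4 / (b * c * d * e * f)))); [ring|].
    rewrite m.
    (* For a = q the leading product is (aq;q)_oo = (q^2;q)_oo; the factor 1 - q from the folding
       completes it to (q;q)_oo. *)
    assert (hs : forall l, (1 - q) * qpochs_inf (q ^ 2 :: l) q = qpochs_inf (q :: l) q).
    { intro l. unfold qpochs_inf, Cprod_list. cbn [map fold_right]. rewrite (pinf_S hq q) -q2. ring. }
    rewrite -!hs. unfold Cdiv. ring.
Qed.
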